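(* Let $p$ and $q$ be primes with $q\neq p$, let $\mathbf{k}$ be a field of characteristic $p$, and let $H$ be a pointed Hopf algebra over $\mathbf{k}$ with $\dim_{\mathbf{k}} H = pq$. Let $\nu_n(H)\in\mathbf{k}$ denote the $n$-th indicator of $H$. If $H$ is commutative and cocommutative, then for every positive integer $n$, \[\nu_n(H)\equiv \chi_p(n)\,\chi_q(n) \pmod p.\] Otherwise (i.e. if $H$ is not both commutative and cocommutative), for every positive integer $n$, \[\nu_n(H)\equiv \chi_p(n) \pmod p.\] Here the congruence $\nu_n(H)\equiv a \pmod p$ with $a\in\mathbb{Z}$ means that $\nu_n(H)$ equals the image of $a$ in $\mathbf{k}$.
   Context: For a prime $r$ and a positive integer $n$, define $\chi_r(n)=r$ if $r\mid n$ and $\chi_r(n)=1$ if $r\nmid n$. Let $H$ be a finite-dimensional Hopf algebra over a field $\mathbf{k}$, with comultiplication $\Delta$, counit $\varepsilon$ and antipode $S$. $H$ is pointed if every simple subcoalgebra of $H$ is one-dimensional. For $n\ge 1$, put $m^{[n]}(h_1\otimes\cdots\otimes h_n)=h_1\cdots h_n$, and define $\Delta^{[n]}:H\to H^{\otimes n}$ by $\Delta^{[1]}(h)=h$ and $\Delta^{[n]}(h)=(\Delta^{[n-1]}\otimes \mathrm{id})(\Delta(h))$ for $n\ge 2$. The $n$-th Sweedler power map $P_n:H\to H$ is given by $P_0(h)=\varepsilon(h)1_H$ and $P_n(h)=m^{[n]}(\Delta^{[n]}(h))$ for $n\ge 1$. The $n$-th (Frobenius-Schur) indicator of $H$, for a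 positive integer $n$, is \[\nu_n(H)=\mathrm{Tr}(S\circ P_{n-1})\in\mathbf{k},\] the trace of the $\mathbf{k}$-linear endomorphism $S\circ P_{n-1}$ of $H$. *)

(* Defs.v *)
From HB Require Import structures.
From mathcomp Require Import all_boot all_order all_algebra all_field.

Set Implicit Arguments.
Unset Strict Implicit.
Unset Printing Implicit Defensive.

Import GRing.Theory.
Import passmx.
Local Open Scope ring_scope.

(* The tensor product of finite-dimensional spaces, in coordinates: the matrix
   unit E_ij stands for e_i (x) e'_j, where e and e' are the library's bases of
   U and V. *)
Section Tensor.
Variable K : fieldType.

Definition tensor (U V : vectType K) : vectType K :=
  'M[K]_(\dim {:U}, \dim {:V}).

Definition tens (U V : vectType K) (u : U) (v : V) : tensor U V :=
  \matrix_(i, j) (coord (vbasis {:U}) i u * coord (vbasis {:V}) j v).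

Definition tlift_fun (U V W : vectType K) (b : U -> V -> W)
    (t : tensor U V) : W :=
  \sum_i \sum_j
    (t : 'M[K]_(_, _)) i j *: b (vbasis {:U})`_i (vbasis {:V})`_j.

Fact tlift_fun_is_linear (U V W : vectType K) (b : U -> V -> W) :
  linear (tlift_fun b).
Proof.
move=> a s t; rewrite /tlift_fun scaler_sumr -big_split /=.
apply: eq_bigr => i _; rewrite scaler_sumr -big_split /=.
by apply: eq_bigr => j _; rewrite !mxE scalerDl scalerA.
Qed.

HB.instance Definition _ (U V W : vectType K) (b : U -> V -> W) :=
  GRing.isSemilinear.Build K (tensor U V) W _ (tlift_fun b)
    (GRing.semilinear_linear (tlift_fun_is_linear b)).

(* The linear map U (x) V -> W induced by a map b that is bilinear in every use
   below (see tlift_tens). *)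
Definition tlift (U V W : vectType K) (b : U -> V -> W) :
  'Hom(tensor U V, W) := linfun (tlift_fun b).

Definition tmap (U V U' V' : vectType K) (f : 'Hom(U, U')) (g : 'Hom(V, V')) :
  'Hom(tensor U V, tensor U' V') := tlift (fun u v => tens (f u) (g v)).

Definition tassoc (U V W : vectType K) :
    'Hom(tensor (tensor U V) W, tensor U (tensor V W)) :=
  tlift (fun t w => tlift (fun u v => tens u (tens v w)) t).

Definition tswap (U V : vectType K) : 'Hom(tensor U V, tensor V U) :=
  tlift (fun u v => tens v u).

Definition tensv (U V : vectType K) (C : {vspace U}) (D : {vspace V}) :
    {vspace tensor U V} :=
  <<[seq tens c d | c <- vbasis C, d <- vbasis D]>>%VS.

Definition tmul (A B : falgType K) (s t : tensor A B) : tensor A B :=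
  tlift (fun a b => tlift (fun c d => tens (a * c) (b * d)) t) s.

(* tensor_pow V n is the (n+1)-fold tensor power of V. *)
Fixpoint tensor_pow (V : vectType K) (n : nat) : vectType K :=
  if n is m.+1 then tensor (tensor_pow V m) V else V.

Lemma tensPl (U V : vectType K) a (u u' : U) (v : V) :
  tens (a *: u + u') v = a *: tens u v + tens u' v.
Proof. by apply/matrixP => i j; rewrite !mxE linearP mulrDl mulrA. Qed.

Lemma tensPr (U V : vectType K) a (u : U) (v v' : V) :
  tens u (a *: v + v') = a *: tens u v + tens u v'.
Proof. by apply/matrixP => i j; rewrite !mxE linearP mulrDr mulrCA. Qed.

Lemma tlift_tens (U V W : vectType K) (b : U -> V -> W) :
    (forall v, linear (b^~ v)) -> (forall u, linear (b u)) ->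
  forall u v, tlift b (tens u v) = b u v.
Proof.
move=> bl br u v; rewrite lfunE /= /tlift_fun.
pose fl v := GRing.isSemilinear.Build K U W _ (b^~ v)
  (GRing.semilinear_linear (bl v)).
pose fr u := GRing.isSemilinear.Build K V W _ (b u)
  (GRing.semilinear_linear (br u)).
pose L v : {linear U -> W} := HB.pack (b^~ v) (fl v).
pose R u : {linear V -> W} := HB.pack (b u) (fr u).
rewrite [u in RHS](coord_vbasis (memvf u)) -[RHS]/(L v _) linear_sum.
apply: eq_bigr => i _; rewrite linearZ /= [v in RHS](coord_vbasis (memvf v)).
rewrite -[b _ _ in RHS]/(R _ _) linear_sum scaler_sumr.
by apply: eq_bigr => j _; rewrite linearZ /= scalerA mxE.
Qed.

Lemma tlift_linearP (U V W X : vectType K) (b : X -> U -> V -> W)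
    (t : tensor U V) :
  (forall u v, linear (fun x => b x u v)) -> linear (fun x => tlift (b x) t).
Proof.
move=> bl a x y; rewrite !lfunE /= /tlift_fun scaler_sumr -big_split /=.
apply: eq_bigr => i _; rewrite scaler_sumr -big_split /=.
by apply: eq_bigr => j _; rewrite bl scalerDr !scalerA mulrC.
Qed.

Lemma tmapE (U V U' V' : vectType K) (f : 'Hom(U, U')) (g : 'Hom(V, V')) u v :
  tmap f g (tens u v) = tens (f u) (g v).
Proof.
by rewrite /tmap tlift_tens // => w a x y; rewrite linearP ?tensPl ?tensPr.
Qed.

Lemma tassocE (U V W : vectType K) (u : U) (v : V) (w : W) :
  tassoc U V W (tens (tens u v) w) = tens u (tens v w).
Proof.
rewrite /tassoc tlift_tens.
- by rewrite tlift_tens // => z a x y; rewrite ?tensPl ?tensPr ?tensPl ?tensPr.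
- by move=> z a x y; rewrite linearP.
- by move=> t; apply: tlift_linearP => z z' a x y; rewrite !tensPr.
Qed.

Lemma tswapE (U V : vectType K) (u : U) (v : V) :
  tswap U V (tens u v) = tens v u.
Proof.
by rewrite /tswap tlift_tens // => w a x y; rewrite ?tensPl ?tensPr.
Qed.

Lemma tmulE (A B : falgType K) (a c : A) (b d : B) :
  tmul (tens a b) (tens c d) = tens (a * c) (b * d).
Proof.
rewrite /tmul tlift_tens.
- rewrite tlift_tens // => z e x y.
    by rewrite mulrDr -scalerAr tensPl.
  by rewrite mulrDr -scalerAr tensPr.
- move=> z; apply: tlift_linearP => x' y' e x y.
  by rewrite mulrDl -scalerAl tensPl.
- move=> z; apply: tlift_linearP => x' y' e x y.
  by rewrite mulrDl -scalerAl tensPr.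
Qed.

Lemma tensor_ext (U V W : vectType K) (f g : 'Hom(tensor U V, W)) :
  (forall u v, f (tens u v) = g (tens u v)) -> f = g.
Proof.
move=> fg; apply/lfunP => t.
rewrite [t](matrix_sum_delta (t : 'M_(_, _))) !linear_sum.
apply: eq_bigr => i _; rewrite !linear_sum; apply: eq_bigr => j _.
rewrite !linearZ /=; congr (_ *: _).
suff -> : delta_mx i j = tens (vbasis {:U})`_i (vbasis {:V})`_j by [].
apply/matrixP => k l; rewrite !mxE.
rewrite !coord_free ?(basis_free (vbasisP _)) //.
by rewrite -natrM mulnb eq_sym [l == j]eq_sym.
Qed.

End Tensor.

HB.mixin Record hasComul (K : fieldType) V of Vector K V := {
  comul : 'Hom(V, tensor V V);
  counit : 'Hom(V, K^o);
  comulA : forall h : V,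
    tassoc V V V (tmap comul \1%VF (comul h)) = tmap \1%VF comul (comul h);
  counitl : forall h : V,
    tlift (fun a b : V => (counit a : K) *: b) (comul h) = h;
  counitr : forall h : V,
    tlift (fun a b : V => (counit b : K) *: a) (comul h) = h
}.

#[short(type="coalgType")]
HB.structure Definition Coalgebra (K : fieldType) :=
  { V of Vector K V & hasComul K V }.

HB.mixin Record Coalgebra_isHopf (K : fieldType) H
    of Falgebra K H & Coalgebra K H := {
  comulM : forall x y : H, comul (x * y) = tmul (comul x) (comul y);
  comul1 : comul (1 : H) = tens (1 : H) (1 : H);
  counitM : forall x y : H, (counit (x * y) : K) = counit x * counit y;
  counit1 : counit (1 : H) = 1;
  antipode : 'End(H);
  antipodel : forall h : H,
    tlift (fun a b : H => antipode a * b) (comul h) = (counit h : K) *: (1 : H);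
  antipoder : forall h : H,
    tlift (fun a b : H => a * antipode b) (comul h) = (counit h : K) *: (1 : H)
}.

#[short(type="hopfAlgType")]
HB.structure Definition HopfAlgebra (K : fieldType) :=
  { H of Falgebra K H & Coalgebra K H & Coalgebra_isHopf K H }.

Section Coalgebras.
Variables (K : fieldType) (C : coalgType K).

Definition cocommutative : Prop := forall h : C, tswap C C (comul h) = comul h.

Definition subcoalgebra (D : {vspace C}) : bool :=
  (comul @: D <= tensv D D)%VS.

Definition simple_subcoalgebra (D : {vspace C}) : Prop :=
  [/\ subcoalgebra D, D != 0%VS &
      forall E : {vspace C},
        subcoalgebra E -> (E <= D)%VS -> E = 0%VS \/ E = D].

Definition pointed : Prop :=
  forall D : {vspace C}, simple_subcoalgebra D -> \dim D = 1%N.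

(* comul_iter n is Delta^[n+1]. *)
Fixpoint comul_iter (n : nat) : 'Hom(C, tensor_pow C n) :=
  if n is m.+1 then (tmap (comul_iter m) \1 \o comul)%VF else \1%VF.

End Coalgebras.

(* mul_iter A n is m^[n+1]. *)
Fixpoint mul_iter (K : fieldType) (A : falgType K) (n : nat) :
    'Hom(tensor_pow A n, A) :=
  if n is m.+1 then tlift (fun t a => mul_iter A m t * a) else \1%VF.

Definition lftrace (K : fieldType) (V : vectType K) (f : 'End(V)) : K :=
  \tr (mxof (vbasis {:V}) (vbasis {:V}) f).

Section Indicator.
Variables (K : fieldType) (H : hopfAlgType K).

Definition commutative_alg : Prop := forall x y : H, x * y = y * x.

Definition sweedler0_fun (h : H) : H := (counit h : K)%:A.

Fact sweedler0_fun_is_linear : linear sweedler0_fun.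
Proof.
by move=> a x y; rewrite /sweedler0_fun linearP scalerDl -scalerA.
Qed.

HB.instance Definition _ := GRing.isSemilinear.Build K H H _ sweedler0_fun
  (GRing.semilinear_linear sweedler0_fun_is_linear).

Definition sweedler (n : nat) : 'End(H) :=
  if n is m.+1 then (mul_iter H m \o comul_iter H m)%VF
  else linfun sweedler0_fun.

Lemma sweedler0 (h : H) : sweedler 0 h = (counit h : K)%:A.
Proof. by rewrite lfunE. Qed.

(* Meaningful for n > 0 only. *)
Definition indicator (n : nat) : K := lftrace (antipode \o sweedler n.-1)%VF.

End Indicator.

Definition chi (r n : nat) : nat := if (r %| n)%N then r else 1%N.

(* Main.v *)
(** The group-likes of H are linearly independent, so they form a finite group G.
    A left coideal subalgebra L containing G has dimension dividing dim H: since
    H is pointed, H has a flag of left coideals stable under L whose steps are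
    free of rank one over L.  Hence |G| is 1, p, q or pq.

    If |G| = pq, then H = kG and the n-th indicator is the image in k of the
    number of solutions of x^n = 1 in G, known modulo p by Frobenius' theorem.

    Otherwise let L = kG, or L = k[x] with x primitive when G is trivial (then
    dim L = p).  There is y outside L with Delta y = y (x) 1 + g (x) y + c and c
    in L (x) L; after a finite extension of k it can be taken to be an
    eigenvector, modulo L, of conjugation by a generator of G (of ad x).  If
    y L <= L y + L and y g - z g y lies in L, then L + L y + ... + L y^(m-1) is a
    coideal subalgebra of dimension m dim L for some m > 1 with
    1 + z + ... + z^(m-1) = 0.  When |G| is 1 or p, z = 1, hence p divides m and
    p^2 divides pq, which is absurd.

    When |G| = q, averaging over G makes y an exact eigenvector, x y = theta y x,
    with g = x^i; then m = p, z = 1, and the x^b y^j form a basis of H.  As g and y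
    commute, the binomial formula computes P_n on this basis, and the trace of
    S o P_(n-1) reduces to the sum over b < q of the coefficients of x^b in
    x^(b - b n) kappa_b^(p-1), kappa_b = sum_(l < n) theta^(b l) g^(-l). *)

Require Import Defs.
From HB Require Import structures.
From mathcomp Require Import all_boot all_order all_algebra all_field.
From mathcomp Require Import all_fingroup all_solvable zify.
From Stdlib Require Import Classical.

Set Implicit Arguments.
Unset Strict Implicit.
Unset Printing Implicit Defensive.

(** * Counting roots of unity in groups of order pq *)

(** Divisibility of dimensions is the main tool, and its proof dictates the setting. Freeness over
    [L] rests on one remark: the elements of [L] that send a new generator into lower terms form a
    left coideal, and in the pointed case a nonzero left coideal contains a group-like, which is a
    unit of [L]. So [L] has to contain the group-likes and their inverses, but one-sided coideals
    suffice, and the generator y matters only modulo [L]. The eigenvalue attached to y may lie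
    outside k. Over an extension new subcoalgebras may appear, so pointedness is carried over as a
    flag, whose defining relations survive extension of scalars. Characteristic p acts through
    elementary facts: a p-th root of unity is 1; if m ones sum to 0, then p divides m; the sum of (1
    - N)^j over j < p is N^(p-1), which produces the power of kappa_b in the trace; and n^(p-1) is
    the image of chi_p(n), which is the source of that factor when |G| = q. In that case averaging
    over G is possible because q is invertible in k. *)

Section GroupsOfOrderPQ.
Import GroupScope.
Variables (p q : nat) (gT : finGroupType).
Hypotheses (p_pr : prime p) (q_pr : prime q) (neq_qp : q != p).
Hypothesis cardG : #|gT| = (p * q)%N.

Let G : {group gT} := [set: gT]%G.

Let cG : #|G| = (p * q)%N. Proof. by rewrite cardsT cardG. Qed.

Let cop_pq : coprime p q.
Proof. by rewrite prime_coprime // dvdn_prime2 // eq_sym. Qed.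

(** The solutions form a subgroup [D] whose order divides [p * q]; by Cauchy's theorem each of the
    two primes divides that order exactly when it divides [n]. *)
Lemma card_roots_abelian n : abelian G ->
  #|[set x : gT | x ^+ n == 1]| = (chi p n * chi q n)%N.
Proof.
move=> abG; pose D := Group (group_Ldiv n abG).
have -> : [set x : gT | x ^+ n == 1] = D.
  by apply/setP => x; rewrite !inE.
have rD r : prime r -> r %| p * q -> (r %| #|D|) = (r %| n).
  move=> r_pr rpq; apply/idP/idP => [/(Cauchy r_pr)[x xD ox]|rn].
    by rewrite -ox order_dvdn; have /LdivP[_ ->] := xD.
  have [x xG ox] : {x | x \in G & #[x] = r} by apply: Cauchy; rewrite ?cG.
  rewrite -ox order_dvdG //; apply/LdivP; split=> //.
  by apply/eqP; rewrite -order_dvdn ox.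
have Dpq : #|D| %| p * q by rewrite -cG cardSg ?subsetIl.
have rDp := rD p p_pr (dvdn_mulr _ (dvdnn _)).
have rDq := rD q q_pr (dvdn_mull _ (dvdnn _)).
apply/eqP; rewrite eqn_dvd /chi; case: ifP => pn; case: ifP => qn.
- by rewrite Dpq Gauss_dvd // rDp rDq pn qn.
- rewrite muln1 rDp pn andbT -(Gauss_dvdl _ (_ : coprime #|D| q)) //.
  by rewrite coprime_sym prime_coprime // rDq qn.
- rewrite mul1n rDq qn andbT -(Gauss_dvdr _ (_ : coprime #|D| p)) //.
  by rewrite coprime_sym prime_coprime // rDp pn.
- rewrite mul1n dvd1n andbT -(Gauss_dvdr 1 (_ : coprime #|D| p)) //; last first.
    by rewrite coprime_sym prime_coprime // rDp pn.
  rewrite -(Gauss_dvdl _ (_ : coprime #|D| q)) ?muln1 //.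
  by rewrite coprime_sym prime_coprime // rDq qn.
Qed.

(** If [p] divides [n], Frobenius' theorem makes [p] divide the count. Otherwise an element [y] of
    order [p] acts by conjugation on the solutions. A nontrivial fixed solution would have order [q]
    and commute with [y], and the two would generate all of [G], making it abelian; so 1 is the only
    fixed point. *)
Lemma card_roots_nonabelian n : ~~ abelian G ->
  #|[set x : gT | x ^+ n == 1]| = chi p n %[mod p].
Proof.
move=> nabG.
have -> : [set x : gT | x ^+ n == 1] = 'Ldiv_n(G) by apply/setP => x; rewrite !inE.
rewrite /chi; case: ifP => pn.
  have -> : 'Ldiv_n(G) = 'Ldiv_(gcdn n #|G|)(G).
    apply/setP => x; rewrite !inE -!order_dvdn dvdn_gcd.
    by rewrite [#[x] %| #|_|]order_dvdG ?andbT ?inE.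
  rewrite modnn; apply/eqP; apply: dvdn_trans (Frobenius_Ldiv (dvdn_gcdr _ _)).
  by rewrite dvdn_gcd pn cG dvdn_mulr.
have [y yG oy] : {y | y \in G & #[y] = p} by apply: Cauchy; rewrite // cG dvdn_mulr.
have pP : p.-group <[y]> by rewrite /pgroup -orderE oy pnat_id.
rewrite (@pgroup_fix_mod _ _ _ 'J p <[y]>%G) //; last first.
  apply/actsP => a ya x; rewrite !inE /= -conjXg conjg_eq1.
  by [].
suff -> : 'Fix_('Ldiv_n(G) | 'J)(<[y]>) = 1 by rewrite cards1.
apply/setP => x; rewrite afixJ in_setI in_set1; apply/andP/eqP => [[/LdivP[_ xn] xC]|->].
  apply/eqP; apply: contraT => x1.
  have oxq : #[x] = q.
    have : #[x] %| (p * q)%N by rewrite -cG order_dvdG ?inE.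
    rewrite Gauss_dvdr; last first.
      rewrite coprime_sym prime_coprime //; apply: contraFN pn => px.
      by apply: dvdn_trans px _; rewrite order_dvdn xn eqxx.
    by case/primeP: q_pr => _ /[apply] /orP[/eqP|/eqP //]; move/eqP; rewrite order_eq1 (negPf x1).
  case/negP: nabG; have -> : G = (<[x]> <*> <[y]>)%G.
    apply/val_inj/eqP; rewrite /= eq_sym eqEcard subsetT /= cG dvdn_leq ?cardG_gt0 // Gauss_dvd //.
    by rewrite -{1}oy -oxq !orderE !cardSg ?joing_subl ?joing_subr.
  rewrite abelianY !cycle_abelian /= centsC cycle_subG.
  exact: xC.
split; last exact: group1.
by rewrite !inE expg1n eqxx.
Qed.

End GroupsOfOrderPQ.

Lemma prime_order_generator (gT : finGroupType) (r : nat) : prime r -> #|gT| = r ->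
  exists2 x : gT, #[x]%g = r & forall y : gT, exists i, y = (x ^+ i)%g.
Proof.
move=> r_pr cT; have [x _ ox] : {x | x \in [set: gT] & #[x]%g = r}.
  by apply: Cauchy; rewrite // cardsT cT.
exists x => // y; apply/cycleP.
suff -> : <[x]>%g = [set: gT] by [].
by apply/eqP; rewrite eqEcard subsetT cardsT cT -ox orderE leqnn.
Qed.

Import GRing.Theory passmx.
Local Open Scope ring_scope.

(** * Slices of tensors *)

Section TensorSlices.
Variable K : fieldType.
Implicit Types U V W : vectType K.

Lemma tensDl U V (u u' : U) (v : V) : tens (u + u') v = tens u v + tens u' v.
Proof. by have := tensPl 1 u u' v; rewrite !scale1r. Qed.

Lemma tensDr U V (u : U) (v v' : V) : tens u (v + v') = tens u v + tens u v'.
Proof. by have := tensPr 1 u v v'; rewrite !scale1r. Qed.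

Lemma tens0l U V (v : V) : tens (0 : U) v = 0.
Proof. by apply: (addIr (tens 0 v)); rewrite -tensDl !add0r. Qed.

Lemma tens0r U V (u : U) : tens u (0 : V) = 0.
Proof. by apply: (addIr (tens u 0)); rewrite -tensDr !add0r. Qed.

Lemma tensZl U V a (u : U) (v : V) : tens (a *: u) v = a *: tens u v.
Proof. by have := tensPl a u 0 v; rewrite tens0l !addr0. Qed.

Lemma tensZr U V a (u : U) (v : V) : tens u (a *: v) = a *: tens u v.
Proof. by have := tensPr a u v 0; rewrite tens0r !addr0. Qed.

Lemma tensNl U V (u : U) (v : V) : tens (- u) v = - tens u v.
Proof. by rewrite -scaleN1r tensZl scaleN1r. Qed.

Lemma tensNr U V (u : U) (v : V) : tens u (- v) = - tens u v.
Proof. by rewrite -scaleN1r tensZr scaleN1r. Qed.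

Lemma tens_suml U V I (r : seq I) (P : pred I) (F : I -> U) (v : V) :
  tens (\sum_(i <- r | P i) F i) v = \sum_(i <- r | P i) tens (F i) v.
Proof.
by apply: (big_morph (fun u => tens u v)) => [x y|]; rewrite ?tensDl ?tens0l.
Qed.

Lemma tens_sumr U V I (r : seq I) (P : pred I) (F : I -> V) (u : U) :
  tens u (\sum_(i <- r | P i) F i) = \sum_(i <- r | P i) tens u (F i).
Proof.
by apply: (big_morph (fun v => tens u v)) => [x y|]; rewrite ?tensDr ?tens0r.
Qed.

(** Contractions of one tensor factor by a functional. They stand in for Sweedler notation: equality
    of tensors and membership in [tensv C D] are tested on all slices, without choosing a
    decomposition into pure tensors. *)
Definition sliceL U V (f : 'Hom(U, K^o)) : 'Hom(tensor U V, V) :=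
  tlift (fun a b => (f a : K) *: b).

Definition sliceR U V (f : 'Hom(V, K^o)) : 'Hom(tensor U V, U) :=
  tlift (fun a b => (f b : K) *: a).

Lemma sliceL_tens U V (f : 'Hom(U, K^o)) u (v : V) :
  sliceL V f (tens u v) = (f u : K) *: v.
Proof.
rewrite /sliceL tlift_tens // => [w|w] a x y; first by rewrite linearP scalerDl scalerA.
by rewrite scalerDr !scalerA mulrC.
Qed.

Lemma sliceR_tens U V (f : 'Hom(V, K^o)) (u : U) v :
  sliceR U f (tens u v) = (f v : K) *: u.
Proof.
rewrite /sliceR tlift_tens // => [w|w] a x y; last by rewrite linearP scalerDl scalerA.
by rewrite scalerDr !scalerA mulrC.
Qed.

Definition coordf V (i : 'I_(\dim {:V})) : 'Hom(V, K^o) :=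
  linfun (coord (vbasis {:V}) i : V -> K^o).

Lemma coordfE V i (v : V) : coordf i v = coord (vbasis {:V}) i v.
Proof. by rewrite lfunE. Qed.

Lemma coordf_sum V (v : V) : v = \sum_i (coordf i v : K) *: (vbasis {:V})`_i.
Proof.
rewrite {1}(coord_vbasis (memvf v)).
by apply: eq_bigr => i _; rewrite coordfE.
Qed.

Lemma funct_sum V (f : 'Hom(V, K^o)) :
  f = \sum_(i < \dim {:V}) (f (vbasis {:V})`_i : K) *: coordf i.
Proof.
apply/lfunP => v; rewrite {1}(coordf_sum v) linear_sum sum_lfunE.
by apply: eq_bigr => i _; rewrite linearZ scale_lfunE; exact: mulrC.
Qed.

Fact tens_is_linear U V (u : U) : linear (tens u : V -> tensor U V).
Proof. by move=> a x y; rewrite tensPr. Qed.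

Definition tensR U V (u : U) : 'Hom(V, tensor U V) :=
  let L : {linear V -> tensor U V} := HB.pack (tens u : V -> tensor U V)
    (GRing.isSemilinear.Build K V (tensor U V) _ (tens u)
       (GRing.semilinear_linear (@tens_is_linear U V u))) in linfun L.

Lemma tensRE U V (u : U) (v : V) : tensR V u v = tens u v.
Proof. by rewrite lfunE. Qed.

Definition tensL U V (v : V) : 'Hom(U, tensor U V) := (tswap V U \o tensR U v)%VF.

Lemma tensLE U V (v : V) (u : U) : tensL U v u = tens u v.
Proof. by rewrite comp_lfunE tensRE tswapE. Qed.

Lemma tens_sliceL U V (t : tensor U V) :
  t = \sum_(i < \dim {:U}) tens (vbasis {:U})`_i (sliceL V (coordf i) t).
Proof.
have -> : \sum_(i < \dim {:U}) tens (vbasis {:U})`_i (sliceL V (coordf i) t) =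
    (\sum_(i < \dim {:U}) (tensR V (vbasis {:U})`_i \o sliceL V (coordf i)))%VF t.
  by rewrite sum_lfunE; apply: eq_bigr => i _; rewrite comp_lfunE tensRE.
set f := (F in fun_of_lfun F _); suff -> : f = \1%VF by rewrite id_lfunE.
apply: tensor_ext => u v.
rewrite id_lfunE sum_lfunE [u in RHS]coordf_sum tens_suml; apply: eq_bigr => i _.
by rewrite comp_lfunE tensRE sliceL_tens tensZl tensZr.
Qed.

Lemma tens_sliceR U V (t : tensor U V) :
  t = \sum_(i < \dim {:V}) tens (sliceR U (coordf i) t) (vbasis {:V})`_i.
Proof.
have -> : \sum_(i < \dim {:V}) tens (sliceR U (coordf i) t) (vbasis {:V})`_i =
    (\sum_(i < \dim {:V}) (tensL U (vbasis {:V})`_i \o sliceR U (coordf i)))%VF t.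
  by rewrite sum_lfunE; apply: eq_bigr => i _; rewrite comp_lfunE tensLE.
set f := (F in fun_of_lfun F _); suff -> : f = \1%VF by rewrite id_lfunE.
apply: tensor_ext => u v.
rewrite id_lfunE sum_lfunE [v in RHS]coordf_sum tens_sumr; apply: eq_bigr => i _.
by rewrite comp_lfunE tensLE sliceR_tens tensZl tensZr.
Qed.

Lemma sliceL_ext U V (t s : tensor U V) :
  (forall f, sliceL V f t = sliceL V f s) -> t = s.
Proof.
by move=> ts; rewrite (tens_sliceL t) (tens_sliceL s); apply: eq_bigr => i _; rewrite ts.
Qed.

Lemma sliceR_ext U V (t s : tensor U V) :
  (forall f, sliceR U f t = sliceR U f s) -> t = s.
Proof.
by move=> ts; rewrite (tens_sliceR t) (tens_sliceR s); apply: eq_bigr => i _; rewrite ts.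
Qed.

Lemma tens_ind U V (P : tensor U V -> Prop) :
  (forall u v, P (tens u v)) -> (forall s t, P s -> P t -> P (s + t)) ->
  forall t, P t.
Proof.
move=> Pt PD t; rewrite (tens_sliceL t); elim/big_ind: _ => //.
by rewrite -(tens0r V (0 : U)).
Qed.

Lemma slice_slice U V (f : 'Hom(U, K^o)) (g : 'Hom(V, K^o)) (t : tensor U V) :
  f (sliceR U g t) = g (sliceL V f t).
Proof.
elim/tens_ind: t => [u v|s t IHs IHt]; last by rewrite !linearD /= IHs IHt.
by rewrite sliceR_tens sliceL_tens !linearZ /=; exact: mulrC.
Qed.

Lemma tens_mem U V (C : {vspace U}) (D : {vspace V}) c d :
  c \in C -> d \in D -> tens c d \in tensv C D.
Proof.
move=> cC dD; rewrite (coord_vbasis cC) tens_suml memv_suml // => i _.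
rewrite (coord_vbasis dD) tens_sumr memv_suml // => j _.
rewrite tensZl tensZr !memvZ // memv_span //; apply/allpairsP.
by exists ((vbasis C)`_i, (vbasis D)`_j); rewrite !mem_nth ?size_tuple.
Qed.

(* A tensor all of whose left slices lie in D and right slices in C lies in
   C (x) D: expand along a basis of D. *)
Lemma tensvP U V (C : {vspace U}) (D : {vspace V}) t :
  reflect ((forall f, sliceL V f t \in D) /\ (forall f, sliceR U f t \in C))
    (t \in tensv C D).
Proof.
apply: (iffP idP) => [tCD|[tL tR]].
  suff H (f : 'Hom(U, K^o)) (f' : 'Hom(V, K^o)) : (tensv C D <= sliceL V f @^-1: D :&: sliceR U f' @^-1: C)%VS.
    split=> f; [have := subvP (H f 0) _ tCD | have := subvP (H 0 f) _ tCD];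
    by rewrite memv_cap -!memv_preim => /andP[].
  apply/span_subvP => _ /allpairsP[[c d] /= [cC dD ->]].
  rewrite memv_cap -!memv_preim sliceL_tens sliceR_tens.
  by rewrite !memvZ ?(vbasis_mem cC) ?(vbasis_mem dD).
pose b := vbasis D.
(* The coordinates along the basis of [D] become functionals on all of [V] through the projector
   onto [D], so that they can be used to slice. *)
pose cb (i : 'I_(\dim D)) : 'Hom(V, K^o) := (linfun (coord b i : V -> K^o) \o projv D)%VF.
suff -> : t = \sum_(i < \dim D) tens (sliceR U (cb i) t) b`_i.
  apply: memv_suml => i _; apply: tens_mem; first exact: tR.
  by rewrite vbasis_mem ?mem_nth ?size_tuple.
apply: sliceL_ext => f; rewrite linear_sum /=.
rewrite {1}(coord_vbasis (tL f)); apply: eq_bigr => i _.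
rewrite sliceL_tens; congr (_ *: _).
by rewrite slice_slice /cb comp_lfunE projv_id ?tL // [RHS]lfunE.
Qed.

End TensorSlices.

Section TensorMaps.
Variable K : fieldType.
Implicit Types U V W : vectType K.

Lemma lfunZ U V (f : 'Hom(U, V)) a u : f (a *: u) = a *: f u.
Proof. exact: linearZ. Qed.

Lemma functZ U (f : 'Hom(U, K^o)) a u : f (a *: u) = (a * f u : K).
Proof. exact: linearZ. Qed.

Lemma sliceL_tmap U V U' V' (f : 'Hom(U', K^o)) (g : 'Hom(U, U'))
    (g' : 'Hom(V, V')) (t : tensor U V) :
  sliceL V' f (tmap g g' t) = g' (sliceL V (f \o g)%VF t).
Proof.
elim/tens_ind: t => [u v|s t IHs IHt]; last by rewrite !linearD /= IHs IHt.
by rewrite tmapE !sliceL_tens linearZ comp_lfunE.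
Qed.

Lemma sliceR_tmap U V U' V' (f : 'Hom(V', K^o)) (g : 'Hom(U, U'))
    (g' : 'Hom(V, V')) (t : tensor U V) :
  sliceR U' f (tmap g g' t) = g (sliceR U (f \o g')%VF t).
Proof.
elim/tens_ind: t => [u v|s t IHs IHt]; last by rewrite !linearD /= IHs IHt.
by rewrite tmapE !sliceR_tens linearZ comp_lfunE.
Qed.

Lemma sliceL_assoc U V W (f : 'Hom(U, K^o)) (s : tensor U V) (w : W) :
  sliceL _ f (tassoc U V W (tens s w)) = tens (sliceL V f s) w.
Proof.
elim/tens_ind: s => [u v|s t IHs IHt].
  by rewrite tassocE !sliceL_tens tensZl.
by rewrite tensDl !linearD /= IHs IHt tensDl.
Qed.

Lemma tmap_sliceR_assoc U V W (f : 'Hom(W, K^o)) (s : tensor U V) (w : W) :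
  tmap \1 (sliceR V f) (tassoc U V W (tens s w)) = (f w : K) *: s.
Proof.
elim/tens_ind: s => [u v|s t IHs IHt].
  by rewrite tassocE !tmapE sliceR_tens tensZr id_lfunE.
by rewrite tensDl !linearD /= IHs IHt.
Qed.

End TensorMaps.

(** * The two coactions of the dual space on a coalgebra *)

Section CoalgebraActions.
Variables (K : fieldType) (C : coalgType K).
Implicit Types (f g : 'Hom(C, K^o)) (h : C) (U : {vspace C}).

(* The left and right slices of the coproduct: [lam f h] is f(h1) h2 and
   [rho f h] is h1 f(h2). *)
Definition lam f : 'End(C) := (sliceL C f \o comul)%VF.
Definition rho f : 'End(C) := (sliceR C f \o comul)%VF.

Lemma lamE f h : lam f h = sliceL C f (comul h).
Proof. exact: comp_lfunE. Qed.

Lemma rhoE f h : rho f h = sliceR C f (comul h).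
Proof. exact: comp_lfunE. Qed.

Lemma lam_counit h : lam counit h = h.
Proof. by rewrite lamE; exact: counitl. Qed.

Lemma rho_counit h : rho counit h = h.
Proof. by rewrite rhoE; exact: counitr. Qed.

(** Every functional is recovered from the coaction through [counit], so a vector is determined by
    its images under the operators [lam f]. *)
Lemma counit_lam f h : counit (lam f h) = f h.
Proof. by rewrite lamE -slice_slice -rhoE rho_counit. Qed.

Lemma counit_rho f h : counit (rho f h) = f h.
Proof. by rewrite rhoE slice_slice -lamE lam_counit. Qed.

(** Coassociativity contracted on its leftmost factor. *)
Lemma comul_lam f h : comul (lam f h) = tmap (lam f) \1 (comul h).
Proof.
have := congr1 (sliceL _ f) (comulA h).
rewrite sliceL_tmap (_ : f \o \1 = f)%VF; last first.
  by apply/lfunP => x; rewrite comp_lfunE id_lfunE.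
rewrite -lamE => <-.
elim/tens_ind: (comul h) => [u v|s t IHs IHt]; last by rewrite !linearD /= IHs IHt.
by rewrite !tmapE id_lfunE sliceL_assoc lamE.
Qed.

Lemma comul_rho f h : comul (rho f h) = tmap \1 (rho f) (comul h).
Proof.
have := congr1 (tmap \1 (sliceR _ f)) (comulA h).
have -> : tmap \1 (sliceR C f) (tmap \1 comul (comul h)) = tmap \1 (rho f) (comul h).
  elim/tens_ind: (comul h) => [u v|s t IHs IHt]; last by rewrite !linearD /= IHs IHt.
  by rewrite !tmapE rhoE !id_lfunE.
move=> <-; rewrite rhoE.
elim/tens_ind: (comul h) => [u v|s t IHs IHt]; last by rewrite !linearD /= IHs IHt.
by rewrite tmapE tmap_sliceR_assoc sliceR_tens linearZ /= id_lfunE.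
Qed.

Lemma lam_lam f g h : lam f (lam g h) = lam (f \o lam g)%VF h.
Proof. by rewrite lamE comul_lam sliceL_tmap id_lfunE -lamE. Qed.

Lemma rho_rho f g h : rho f (rho g h) = rho (f \o rho g)%VF h.
Proof. by rewrite rhoE comul_rho sliceR_tmap id_lfunE -rhoE. Qed.

Lemma lam_rho f g h : lam f (rho g h) = rho g (lam f h).
Proof.
rewrite lamE comul_rho sliceL_tmap (_ : f \o \1 = f)%VF -?lamE //.
by apply/lfunP => x; rewrite comp_lfunE id_lfunE.
Qed.

Lemma rho_sum f h :
  rho f h = \sum_(i < \dim {:C}) (f (vbasis {:C})`_i : K) *: rho (coordf i) h.
Proof.
rewrite rhoE [comul h]tens_sliceR linear_sum; apply: eq_bigr => i _ /=.
by rewrite sliceR_tens -rhoE.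
Qed.

Lemma lam_sum f h :
  lam f h = \sum_(i < \dim {:C}) (f (vbasis {:C})`_i : K) *: lam (coordf i) h.
Proof.
rewrite lamE [comul h]tens_sliceL linear_sum; apply: eq_bigr => i _ /=.
by rewrite sliceL_tens -lamE.
Qed.

Definition lam_stable U := forall f u, u \in U -> lam f u \in U.
Definition rho_stable U := forall f u, u \in U -> rho f u \in U.

Definition grouplike h := (comul h == tens h h) && (counit h == 1).

Lemma grouplike_comul (g : C) : grouplike g -> comul g = tens g g.
Proof. by case/andP => /eqP. Qed.

Lemma grouplike_counit (g : C) : grouplike g -> counit g = 1.
Proof. by case/andP => _ /eqP. Qed.

Lemma lam_grouplike f (g : C) : grouplike g -> lam f g = (f g : K) *: g.
Proof. by move=> gG; rewrite lamE grouplike_comul // sliceL_tens. Qed.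

Lemma rho_grouplike f (g : C) : grouplike g -> rho f g = (f g : K) *: g.
Proof. by move=> gG; rewrite rhoE grouplike_comul // sliceR_tens. Qed.

Lemma grouplike_neq0 (g : C) : grouplike g -> g != 0.
Proof.
move=> gG; apply/eqP => g0; have := grouplike_counit gG.
by rewrite g0 linear0 => /eqP; rewrite eq_sym (oner_eq0 K).
Qed.

End CoalgebraActions.

(** * Comodule eigenvectors and pointed coalgebras *)

Section Subspaces.
Variables (K : fieldType) (V : vectType K).
Implicit Types (U W : {vspace V}).

Lemma minimal_subspace (P : {vspace V} -> Prop) U0 : P U0 ->
  exists U, [/\ P U, (U <= U0)%VS & forall W, P W -> (W <= U)%VS -> W = U].
Proof.
have [n] := ubnP (\dim U0); elim: n U0 => // n IHn U0 ltU PU0.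
case: (classic (exists W, [/\ P W, (W <= U0)%VS & W <> U0])).
  case=> W [PW WU0 neW].
  have [] := IHn W _ PW; last first.
    by move=> U [PU UW minU]; exists U; split=> //; apply: subv_trans WU0.
  rewrite -ltnS; apply: leq_trans ltU; rewrite ltnS ltn_neqAle dimvS // andbT.
  apply: contra_notN neW => /eqP dW.
  by apply/eqP; rewrite eqEdim WU0 dW leqnn.
move=> noW; exists U0; split=> // W PW WU0; apply: NNPP => neW.
by apply: noW; exists W.
Qed.

Lemma separating_functional U u : u \notin U ->
  exists2 f : 'Hom(V, K^o), (forall w, w \in U -> f w = 0) & f u = 1.
Proof.
move=> uU; pose P := (\1 - projv U)%VF.
have Pu0 : P u != 0.
  apply: contra uU => /eqP; rewrite add_lfunE opp_lfunE id_lfunE => /eqP.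
  by rewrite subr_eq0 => /eqP ->; rewrite memv_proj.
have [i ci0] : exists i, (coordf i (P u) : K) != 0.
  apply/existsP; apply: contraNT Pu0 => /existsPn c0.
  by rewrite (coordf_sum (P u)) big1 // => i _; rewrite (eqP (negPn (c0 i))) scale0r.
exists ((coordf i (P u) : K)^-1 *: (coordf i \o P)%VF).
  move=> w wU; have Pw0 : P w = 0.
    by rewrite /P add_lfunE opp_lfunE id_lfunE projv_id // subrr.
  by rewrite scale_lfunE comp_lfunE Pw0 linear0 scaler0.
by rewrite scale_lfunE comp_lfunE; exact: mulVf.
Qed.

End Subspaces.

(* Two commuting families of endomorphisms with the formal properties of
   [lam] and [rho], so that left and right coideals are treated at once. *)
Section Comodules.
Variables (K : fieldType) (V : vectType K) (e : 'Hom(V, K^o)).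
Variables (lam rho : 'Hom(V, K^o) -> 'End(V)).
Hypothesis e_lam : forall f v, e (lam f v) = f v.
Hypothesis e_rho : forall f v, e (rho f v) = f v.
Hypothesis rho_e : forall v, rho e v = v.
Hypothesis lam_rho : forall f g v, lam f (rho g v) = rho g (lam f v).
Hypothesis rho_rho : forall f g v, rho f (rho g v) = rho (f \o rho g)%VF v.
Hypothesis lam_sum : forall f v,
  lam f v = \sum_(i < \dim {:V}) (f (vbasis {:V})`_i : K) *: lam (coordf i) v.
Hypothesis rho_sum : forall f v,
  rho f v = \sum_(i < \dim {:V}) (f (vbasis {:V})`_i : K) *: rho (coordf i) v.

Let stable (F : 'Hom(V, K^o) -> 'End(V)) (U : {vspace V}) :=
  forall f u, u \in U -> F f u \in U.

Hypothesis simple_dim1 : forall D : {vspace V}, D != 0%VS ->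
  stable lam D -> stable rho D ->
  (forall E : {vspace V}, E != 0%VS -> stable lam E -> stable rho E ->
     (E <= D)%VS -> E = D) -> \dim D = 1%N.

(** The vectors on which the coaction is given by [d]. Coordinate functionals suffice because [lam]
    is linear in its functional, and they make the intersection finite. *)
Let eigenline (d : V) : {vspace V} :=
  (\bigcap_(i < \dim {:V}) lker (lam (coordf i) - (coordf i d : K) *: \1%VF))%VS.

Let eigenlineP d v :
  reflect (forall f, lam f v = (f d : K) *: v) (v \in eigenline d).
Proof.
apply: (iffP idP) => [vE f|lv]; last first.
  rewrite /eigenline memvE; apply/subv_bigcapP => i _; rewrite -memvE memv_ker.
  by rewrite add_lfunE opp_lfunE scale_lfunE id_lfunE lv subrr.
have vi i : lam (coordf i) v = (coordf i d : K) *: v.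
  move: vE; rewrite /eigenline memvE => /subv_bigcapP/(_ i isT).
  rewrite -memvE memv_ker add_lfunE opp_lfunE scale_lfunE id_lfunE.
  by rewrite subr_eq0 => /eqP.
rewrite lam_sum [f in RHS]funct_sum sum_lfunE scaler_suml.
by apply: eq_bigr => i _; rewrite vi scale_lfunE scalerA.
Qed.

(** The sum [C] of the images [rho g @: M] is the coefficient coalgebra of the simple comodule [M].
    It is stable on both sides, so it contains a minimal bistable [D], a line by [simple_dim1],
    spanned by some [d] with [e d = 1]. Each [rho g] commutes with [lam], so [C] is a sum of
    quotients of [M]; hence the eigenvector [d] in [C] forces an eigenvector in [M], which is a
    multiple of [d]. *)
Let simple_has_grouplike (M : {vspace V}) : M != 0%VS -> stable lam M ->
  (forall W, W != 0%VS -> stable lam W -> (W <= M)%VS -> W = M) ->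
  exists d, [/\ d \in M, e d = 1 & forall f, lam f d = (f d : K) *: d].
Proof.
move=> M0 Ml Ms.
pose sumrho (r : seq 'Hom(V, K^o)) := (\sum_(g <- r) rho g @: M)%VS.
have sumrho_lam r : stable lam (sumrho r).
  move=> f; rewrite /sumrho; elim: r => [|g r IHr] u.
    by rewrite !big_nil !memv0 => /eqP ->; rewrite linear0.
  rewrite !big_cons => /memv_addP[_ /memv_imgP[v vM ->] [w wr ->]].
  by rewrite linearD memv_add ?IHr //= lam_rho memv_img ?Ml.
pose all_f := [seq (coordf i : 'Hom(V, K^o)) | i <- enum 'I_(\dim {:V})].
pose C := sumrho all_f.
have rhoC f v : v \in M -> rho f v \in C.
  move=> vM; rewrite rho_sum memv_suml // => i _; apply: memvZ.
  rewrite /C /sumrho big_map.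
  have := memv_img (rho (coordf i)) vM; apply: subvP.
  rewrite (big_rem i) ?mem_enum //=; exact: addvSl.
have C0 : C != 0%VS.
  apply: contra M0 => /eqP C0; rewrite -subv0; apply/subvP => v vM.
  by rewrite -C0 -(rho_e v) rhoC.
have Cr : stable rho C.
  move=> f u; rewrite {1}/C /sumrho big_map big_enum => /memv_sumP[w wP ->].
  rewrite linear_sum memv_suml // => i _ /=.
  by have /memv_imgP[v vM ->] := wP i isT; rewrite rho_rho rhoC.
have [D [[D0 Dl Dr] DC minD]] := @minimal_subspace K V
  (fun D => [/\ D != 0%VS, stable lam D & stable rho D]) C
  (And3 C0 (sumrho_lam all_f) Cr).
have dD : \dim D = 1%N.
  by apply: simple_dim1 => // E E0 El Er ED; apply: minD.
have [d0 d0D d00] : exists2 d0, d0 \in D & d0 != 0.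
  by exists (vpick D); rewrite ?memv_pick ?vpick0.
have Dd0 : D = <[d0]>%VS.
  by apply/eqP; rewrite eq_sym eqEdim -memvE d0D dim_vline d00 dD.
have ed0 : (e d0 : K) != 0.
  apply: contra d00 => /eqP ed0; rewrite (coordf_sum d0) big1 // => i _.
  have := Dl (coordf i) d0 d0D; rewrite Dd0 => /vlineP[c lc].
  by rewrite -e_lam lc lfunZ ed0 scaler0 scale0r.
pose d := (e d0 : K)^-1 *: d0.
have dD' : d \in D by rewrite memvZ.
have ed : e d = 1 by rewrite functZ mulVf.
have dl f : lam f d = (f d : K) *: d.
  have := Dl f d dD'; rewrite Dd0 => /vlineP[c lc].
  have : lam f d = (c * (e d0 : K)) *: d by rewrite lc /d scalerA mulfK.
  by move=> lcd; rewrite -(e_lam f d) lcd functZ ed mulr1.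
have ME0 : (M :&: eigenline d)%VS != 0%VS.
  apply/negP => /eqP ME0.
  suff sE r : (sumrho r :&: eigenline d)%VS = 0%VS.
    have : d \in (sumrho all_f :&: eigenline d)%VS.
      by rewrite memv_cap (subvP DC) //=; apply/eigenlineP.
    rewrite sE memv0 => /eqP d0'; move: ed; rewrite d0' linear0 => /eqP.
    by rewrite eq_sym (oner_eq0 K).
  elim: r => [|g r IHr]; first by rewrite /sumrho big_nil cap0v.
  (* By minimality [W] is [M] or 0. In the first case the summand [rho g @: M] adds nothing; in the
     second the sum is direct, and the [M]-component of an eigenvector is itself an eigenvector,
     hence 0. *)
  pose W := (M :&: (rho g @^-1: sumrho r))%VS.
  have Wl : stable lam W.
    move=> f u; rewrite !memv_cap -!memv_preim => /andP[uM gu].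
    by rewrite Ml // -lam_rho sumrho_lam.
  have sub0 U : (U <= 0)%VS -> U = 0%VS by rewrite subv0 => /eqP.
  have [W0|W0] := eqVneq W 0%VS; last first.
    have WM := Ms W W0 Wl (capvSl _ _).
    suff -> : sumrho (g :: r) = sumrho r by [].
    rewrite {1}/sumrho big_cons.
    apply/addv_idPr/subvP => _ /memv_imgP[v vM ->].
    by move: vM; rewrite -{1}WM memv_cap -memv_preim => /andP[_].
  apply: sub0; apply/subvP => u; rewrite memv_cap {1}/sumrho big_cons.
  case/andP=> /memv_addP[_ /memv_imgP[v vM ->] [z zr ->]] /eigenlineP lu.
  have v0 : v = 0.
    apply/eqP; rewrite -memv0 -ME0 memv_cap vM; apply/eigenlineP => f.
    apply/eqP; rewrite -subr_eq0 -memv0 -W0 memv_cap.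
    rewrite memvB ?memvZ ?Ml // -memv_preim linearB /= -lam_rho lfunZ.
    have E := lu f; rewrite linearD /= scalerDr in E.
    rewrite -[lam f (rho g v)](addrK (lam f z)) E addrAC.
    rewrite [X in X - _ - _]addrC addrK.
    by rewrite memvB ?memvZ ?sumrho_lam.
  move: lu; rewrite v0 linear0 add0r => lz.
  by rewrite -IHr memv_cap zr; apply/eigenlineP.
have vM := memv_pick (M :&: eigenline d)%VS.
set v := vpick _ in vM; have v0 : v != 0 by rewrite vpick0.
move: vM; rewrite memv_cap => /andP[vM /eigenlineP lv].
exists d; split=> //.
have vd : v = (e v : K) *: d.
  rewrite {1}(coordf_sum v) (coordf_sum d) scaler_sumr; apply: eq_bigr => i _.
  by rewrite -e_lam lv functZ scalerA mulrC.
have ev0 : (e v : K) != 0 by apply: contra v0 => /eqP ev; rewrite vd ev scale0r.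
by rewrite -(scale1r d) -(mulVf ev0) -scalerA -vd memvZ.
Qed.

(** The subquotient case is reduced to a simple subcomodule. Take [T] minimal among the stable
    subspaces of [U'] strictly above [U], and a functional [f0] that kills [U] but not [T]. Then
    [rho f0] is a comodule map, and by minimality its kernel on [T] is [U], so it embeds T/U into
    [V], where [simple_has_grouplike] applies. *)
Lemma comodule_eigenvector (U U' : {vspace V}) :
  stable lam U -> stable lam U' -> (U <= U')%VS -> U != U' ->
  exists v g, [/\ v \in U', v \notin U, e g = 1,
    forall f, lam f g = (f g : K) *: g &
    forall f, lam f v - (f g : K) *: v \in U].
Proof.
move=> Ul U'l UU' neU.
have [T [[Tl UT neUT] TU' minT]] := @minimal_subspace K V
  (fun W => [/\ stable lam W, (U <= W)%VS & U != W]) U' (And3 U'l UU' neU).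
have [u uT uU] : exists2 u, u \in T & u \notin U.
  by apply/subvPn; apply: contra neUT => TU; rewrite eqEsubv UT TU.
have [f0 f0U f0u] := separating_functional uU.
have kerU w : w \in U -> rho f0 w = 0.
  move=> wU; rewrite (coordf_sum (rho f0 w)) big1 // => i _.
  by rewrite -e_lam lam_rho e_rho f0U ?scale0r ?Ul.
have TkerU w : w \in T -> rho f0 w = 0 -> w \in U.
  pose N := (T :&: lker (rho f0))%VS.
  have [->|neN] := eqVneq U N; first by rewrite memv_cap memv_ker => -> ->; rewrite eqxx.
  have NT : N = T.
    apply: minT (capvSl _ _); split=> //.
      move=> f v; rewrite !memv_cap !memv_ker => /andP[vT /eqP v0].
      by rewrite Tl //= -lam_rho v0 linear0.
    apply/subvP => v vU; rewrite memv_cap memv_ker kerU // eqxx andbT.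
    exact: subvP vU.
  have : u \in N by rewrite NT.
  rewrite memv_cap memv_ker => /andP[_ /eqP u0].
  by move: f0u; rewrite -e_rho u0 linear0 => /eqP; rewrite eq_sym (oner_eq0 K).
pose M := (rho f0 @: T)%VS.
have [] := @simple_has_grouplike M.
- apply: contraNneq uU => M0; apply: TkerU => //; apply/eqP.
  by rewrite -memv0 -M0 memv_img.
- by move=> f _ /memv_imgP[v vT ->]; rewrite lam_rho memv_img ?Tl.
- move=> W W0 Wl WM; pose N := (T :&: (rho f0 @^-1: W))%VS.
  have NT : N = T.
    apply: minT (capvSl _ _); split.
    + move=> f v; rewrite !memv_cap -!memv_preim => /andP[vT vW].
      by rewrite Tl //= -lam_rho Wl.
    + apply/subvP => v vU; rewrite memv_cap -memv_preim kerU // mem0v andbT.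
      exact: subvP vU.
    + apply: contraNneq W0 => UN; rewrite -subv0; apply/subvP => w wW.
      have /memv_imgP[v vT wv] := subvP WM _ wW.
      have vU : v \in U by rewrite UN memv_cap vT -memv_preim -wv.
      by rewrite wv kerU // mem0v.
  apply/eqP; rewrite eqEsubv WM; apply/subvP => _ /memv_imgP[v vT ->].
  by move: vT; rewrite -NT memv_cap -memv_preim => /andP[].
move=> d [/memv_imgP[v vT dv] ed dl]; exists v, d; split=> //.
- exact: subvP vT.
- by apply/negP => /kerU v0; move: ed; rewrite dv v0 linear0 => /eqP; rewrite eq_sym (oner_eq0 K).
move=> f; apply: TkerU; first by rewrite memvB ?memvZ ?Tl.
by rewrite linearB /= -lam_rho lfunZ -dv dl subrr.
Qed.

End Comodules.

Section PointedCoalgebras.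
Variables (K : fieldType) (C : coalgType K).
Implicit Types (U W D : {vspace C}) (s : seq C).

Lemma subcoalgebraP D : reflect (lam_stable D /\ rho_stable D) (subcoalgebra D).
Proof.
apply: (iffP idP) => [/subvP Dsub|[Dl Dr]].
  split=> f d dD; have := Dsub _ (memv_img comul dD) => /tensvP[tl tr].
    by rewrite lamE.
  by rewrite rhoE.
apply/subvP => _ /memv_imgP[d dD ->]; apply/tensvP.
by split=> f; rewrite -?lamE -?rhoE ?Dl ?Dr.
Qed.

(* Every simple left (right) subquotient comodule of C is a line on which the
   coaction is given by an element of s. *)
Definition left_pointed s := forall U W, lam_stable U -> lam_stable W ->
  (U <= W)%VS -> U != W -> exists v g, [/\ v \in W, v \notin U, g \in s &
    forall f, lam f v - (f g : K) *: v \in U].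

Definition right_pointed s := forall U W, rho_stable U -> rho_stable W ->
  (U <= W)%VS -> U != W -> exists v g, [/\ v \in W, v \notin U, g \in s &
    forall f, rho f v - (f g : K) *: v \in U].

Lemma eigen_grouplike (d : C) : counit d = 1 ->
  (forall f, lam f d = (f d : K) *: d) -> grouplike d.
Proof.
move=> ed dl; apply/andP; split; last exact/eqP.
by apply/eqP/sliceL_ext => f; rewrite -lamE sliceL_tens dl.
Qed.

(** Apply [lam f] to a relation expressing a group-like g through independent group-likes t_i with
    coefficients c_i. Comparing coefficients gives f(t_i) = f(g) for every f whenever c_i is
    nonzero, so g is one of the t_i. *)
Lemma grouplike_free s : uniq s -> all (@grouplike K C) s -> free s.
Proof.
elim: s => [|g s IHs] /=; first by rewrite nil_free.
case/andP=> gs us /andP[gG sG]; have fs := IHs us sG.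
rewrite free_cons fs andbT; apply: contra gs => gspan.
pose t := in_tuple s; pose c i : K := coord t i g.
have gE : g = \sum_i c i *: t`_i by rewrite {1}(@coord_span _ _ _ t g).
have ts (i : 'I_(size s)) : t`_i \in s by rewrite mem_nth.
have cE (f : 'Hom(C, K^o)) (i : 'I_(size s)) : c i * (f t`_i : K) = (f g : K) * c i.
  have : lam f g = \sum_i (c i * (f t`_i : K)) *: t`_i.
    rewrite {1}gE linear_sum; apply: eq_bigr => j _ /=.
    by rewrite lfunZ lam_grouplike ?scalerA // (allP sG).
  rewrite lam_grouplike // [g in _ *: g]gE scaler_sumr => E.
  have := congr1 (coord t i) E.
  under eq_bigr => j _ do rewrite scalerA.
  by rewrite !(@coord_sum_free _ _ _ t).
have [i ci0] : exists i, c i != 0.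
  apply/existsP; apply: contraNT (grouplike_neq0 gG) => /existsPn c0.
  by rewrite gE big1 // => i _; rewrite (eqP (negPn (c0 i))) scale0r.
suff -> : g = t`_i by [].
rewrite (coordf_sum g) (coordf_sum t`_i); apply: eq_bigr => j _.
congr (_ *: _); apply: (mulfI ci0).
by rewrite cE mulrC.
Qed.

(** Independence bounds the length of a list of distinct group-likes by the dimension, so a list
    that cannot be enlarged exists. *)
Lemma exists_grouplike_seq : exists s, uniq s /\ forall g, (g \in s) = grouplike g.
Proof.
suff [s [us sG smax]] : exists s, [/\ uniq s, all (@grouplike K C) s &
    forall g, grouplike g -> g \in s].
  by exists s; split=> // g; apply/idP/idP => [/(allP sG)|/smax].
have [n] := ubnP (\dim {:C} - size ([::] : seq C)).
have : uniq ([::] : seq C) by []; have : all (@grouplike K C) [::] by [].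
elim: n ([::] : seq C) => // n IHn s sG us lts.
case: (classic (exists g, grouplike g && (g \notin s))) => [[g /andP[gG gs]]|noG].
  have ugs : uniq (g :: s) by rewrite /= gs.
  have gsG : all (@grouplike K C) (g :: s) by rewrite /= gG.
  apply: (IHn (g :: s)) => //.
  have : (size (g :: s) <= \dim {:C})%N.
    have := grouplike_free ugs gsG; rewrite /free => /eqP <-.
    exact/dimvS/subvf.
  by move=> /= lt; rewrite -ltnS (leq_trans _ lts) // ltnS ltn_sub2l.
exists s; split=> // g gG; apply: contraT => gs; case: noG.
by exists g; rewrite gG.
Qed.

Hypothesis C_pointed : pointed C.
Variable s : seq C.
Hypothesis sG : forall g, (g \in s) = grouplike g.

Let simple1 D : D != 0%VS -> lam_stable D -> rho_stable D ->
  (forall E, E != 0%VS -> lam_stable E -> rho_stable E -> (E <= D)%VS -> E = D) ->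
  \dim D = 1%N.
Proof.
move=> D0 Dl Dr minD; apply: C_pointed; split=> //; first exact/subcoalgebraP.
move=> E /subcoalgebraP[El Er] ED.
by have [->|E0] := eqVneq E 0%VS; [left | right; apply: minD].
Qed.

Lemma pointed_left_pointed : left_pointed s.
Proof.
move=> U W Ul Wl UW neU.
have [v [g [vW vU eg gl vl]]] := comodule_eigenvector (@counit_lam K C)
  (@counit_rho K C) (@rho_counit K C) (@lam_rho K C) (@rho_rho K C)
  (@lam_sum K C) (@rho_sum K C) (@simple1) Ul Wl UW neU.
by exists v, g; split=> //; rewrite sG; apply: eigen_grouplike.
Qed.

Lemma pointed_right_pointed : right_pointed s.
Proof.
move=> U W Ur Wr UW neU.
have simple1' D : D != 0%VS -> rho_stable D -> lam_stable D ->
    (forall E, E != 0%VS -> rho_stable E -> lam_stable E -> (E <= D)%VS -> E = D) ->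
    \dim D = 1%N.
  by move=> D0 Dr Dl minD; apply: simple1 => // E E0 El Er; apply: minD.
have [v [g [vW vU eg gr vr]]] := comodule_eigenvector (@counit_rho K C)
  (@counit_lam K C) (@lam_counit K C) (fun f g v => esym (@lam_rho K C g f v))
  (@lam_lam K C) (@rho_sum K C) (@lam_sum K C)
  simple1'
  Ur Wr UW neU.
exists v, g; split=> //; rewrite sG; apply: eigen_grouplike => // f.
have := gr; move=> {}gr.
have cg : comul g = tens g g.
  by apply: sliceR_ext => f'; rewrite -rhoE sliceR_tens gr.
by rewrite lamE cg sliceL_tens.
Qed.

End PointedCoalgebras.

(** * Convolution, Sweedler powers and group-likes *)

Section TensorProductAlgebra.
Variables (K : fieldType) (A B : falgType K).
Implicit Types (s t : tensor A B).

Lemma tmulDl s s' t : tmul (s + s') t = tmul s t + tmul s' t.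
Proof. exact: linearD. Qed.

Lemma tmulZl a s t : tmul (a *: s) t = a *: tmul s t.
Proof. exact: linearZ. Qed.

Lemma tmul_tensl a b t : tmul (tens a b) t = tmap (amull a) (amull b) t.
Proof.
have tl (x : A) (y : B) : (forall v, linear ((fun c d => tens (x * c) (y * d))^~ v))
    /\ (forall u, linear ((fun c d => tens (x * c) (y * d)) u)).
  split=> z e u v; first by rewrite mulrDr -scalerAr tensPl.
  by rewrite mulrDr -scalerAr tensPr.
rewrite /tmul tlift_tens.
- elim/tens_ind: t => [c d|s t IHs IHt]; last by rewrite !linearD /= IHs IHt.
  by rewrite tmapE tlift_tens ?lfunE //=; case: (tl a b).
- move=> z; apply: tlift_linearP => x' y' e x y.
  by rewrite mulrDl -scalerAl tensPl.
- move=> z; apply: tlift_linearP => x' y' e x y.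
  by rewrite mulrDl -scalerAl tensPr.
Qed.

Lemma tmulDr s t t' : tmul s (t + t') = tmul s t + tmul s t'.
Proof.
elim/tens_ind: s => [a b|s s' IHs IHs']; first by rewrite !tmul_tensl linearD.
by rewrite !tmulDl IHs IHs' addrACA.
Qed.

Lemma tmulZr a s t : tmul s (a *: t) = a *: tmul s t.
Proof.
elim/tens_ind: s => [c b|s s' IHs IHs']; first by rewrite !tmul_tensl lfunZ.
by rewrite !tmulDl IHs IHs' scalerDr.
Qed.

Lemma tmul0l t : tmul 0 t = 0. Proof. exact: linear0. Qed.

Lemma tmul0r t : tmul t 0 = 0.
Proof. by have := tmulZr 0 t 0; rewrite !scale0r. Qed.

Lemma tmulNl s t : tmul (- s) t = - tmul s t.
Proof. by rewrite -scaleN1r tmulZl scaleN1r. Qed.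

Lemma tmulNr s t : tmul s (- t) = - tmul s t.
Proof. by rewrite -scaleN1r tmulZr scaleN1r. Qed.

Lemma tmul_suml I (r : seq I) (P : pred I) F t :
  tmul (\sum_(i <- r | P i) F i) t = \sum_(i <- r | P i) tmul (F i) t.
Proof.
by apply: (big_morph (fun s => tmul s t)) => [x y|]; rewrite ?tmulDl ?tmul0l.
Qed.

Lemma tmul_sumr I (r : seq I) (P : pred I) F t :
  tmul t (\sum_(i <- r | P i) F i) = \sum_(i <- r | P i) tmul t (F i).
Proof.
by apply: (big_morph (fun s => tmul t s)) => [x y|]; rewrite ?tmulDr ?tmul0r.
Qed.

Lemma tmul1l t : tmul (tens 1 1) t = t.
Proof.
elim/tens_ind: t => [c d|s t IHs IHt]; last by rewrite tmulDr IHs IHt.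
by rewrite tmulE !mul1r.
Qed.

Lemma tmul1r t : tmul t (tens 1 1) = t.
Proof.
elim/tens_ind: t => [c d|s t IHs IHt]; last by rewrite tmulDl IHs IHt.
by rewrite tmulE !mulr1.
Qed.

Lemma tmulA r s t : tmul r (tmul s t) = tmul (tmul r s) t.
Proof.
elim/tens_ind: r => [a b|r r' IH IH']; last by rewrite !tmulDl IH IH'.
elim/tens_ind: s => [c d|s s' IH IH'].
  elim/tens_ind: t => [u v|t t' IH IH']; last by rewrite !tmulDr IH IH'.
  by rewrite !tmulE !mulrA.
by rewrite tmulDr !tmulDl tmulDr IH IH'.
Qed.

Lemma sliceL_tmul_tensl (f : 'Hom(A, K^o)) a b t :
  sliceL B f (tmul (tens a b) t) = b * sliceL B (f \o amull a)%VF t.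
Proof. by rewrite tmul_tensl sliceL_tmap lfunE. Qed.

Lemma sliceL_tmul_tensr (f : 'Hom(A, K^o)) a b t :
  sliceL B f (tmul t (tens a b)) = sliceL B (f \o amulr a)%VF t * b.
Proof.
elim/tens_ind: t => [c d|s t IHs IHt].
  by rewrite tmulE !sliceL_tens comp_lfunE [amulr _ _]lfunE /= scalerAl.
by rewrite tmulDl !linearD /= IHs IHt mulrDl.
Qed.

End TensorProductAlgebra.

Section HopfBasics.
Variables (K : fieldType) (H : hopfAlgType K).
Implicit Types (f : 'Hom(H, K^o)) (g h : H) (phi psi chi : 'End(H)).

Definition convt phi psi : 'Hom(tensor H H, H) :=
  tlift (fun a b => phi a * psi b).

Lemma convt_tens phi psi a b : convt phi psi (tens a b) = phi a * psi b.
Proof.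
rewrite /convt tlift_tens // => z e x y.
  by rewrite linearP mulrDl scalerAl.
by rewrite linearP mulrDr scalerAr.
Qed.

Definition conv phi psi : 'End(H) := (convt phi psi \o comul)%VF.

Lemma convE phi psi h : conv phi psi h = convt phi psi (comul h).
Proof. exact: comp_lfunE. Qed.

Lemma convA phi psi chi : conv phi (conv psi chi) = conv (conv phi psi) chi.
Proof.
apply/lfunP => h; rewrite convE [RHS]convE.
pose M3 : 'Hom(tensor H (tensor H H), H) := tlift (fun a s => phi a * convt psi chi s).
have M3E a s : M3 (tens a s) = phi a * convt psi chi s.
  rewrite /M3 tlift_tens // => z e x y.
    by rewrite linearP mulrDl scalerAl.
  by rewrite linearP mulrDr scalerAr.
transitivity (M3 (tmap \1 comul (comul h))).
  elim/tens_ind: (comul h) => [a b|s t IHs IHt]; last by rewrite !linearD /= IHs IHt.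
  by rewrite convt_tens tmapE M3E id_lfunE convE.
rewrite -comulA.
elim/tens_ind: (comul h) => [a b|s t IHs IHt]; last by rewrite !linearD /= IHs IHt.
rewrite convt_tens tmapE id_lfunE convE.
elim/tens_ind: (comul a) => [u v|s t IHs IHt].
  by rewrite tassocE M3E !convt_tens mulrA.
by rewrite tensDl !linearD /= IHs IHt mulrDl.
Qed.

Lemma conv_antipoder h : conv \1 (antipode : 'End(H)) h = (counit h : K) *: 1.
Proof.
rewrite convE -antipoder.
elim/tens_ind: (comul h) => [a b|s t IHs IHt]; last by rewrite !linearD /= IHs IHt.
rewrite convt_tens id_lfunE tlift_tens // => z e x y.
  by rewrite mulrDl scalerAl.
by rewrite linearP mulrDr scalerAr.
Qed.

(* phi = phi * (id * S) = (phi * id) * S for the convolution product. *)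
Lemma conv_id_antipode phi (c : H) :
  (forall h, conv phi \1 h = (counit h : K) *: c) -> forall h, phi h = c * antipode h.
Proof.
move=> phic h.
have E1 : conv phi (conv \1 antipode) h = phi h.
  rewrite convE -{2}[h]rho_counit rhoE.
  elim/tens_ind: (comul h) => [a b|s t IHs IHt]; last by rewrite !linearD /= IHs IHt.
  by rewrite convt_tens conv_antipoder sliceR_tens lfunZ -scalerAr mulr1.
have E2 : conv (conv phi \1) antipode h = c * antipode h.
  rewrite convE -{2}[h]lam_counit lamE.
  elim/tens_ind: (comul h) => [a b|s t IHs IHt]; last by rewrite !linearD /= IHs IHt mulrDr.
  by rewrite convt_tens phic sliceL_tens lfunZ -scalerAl -scalerAr.
by rewrite -E1 convA.
Qed.

(** The recursion starts at [n = 0] because P_0 is the unit of convolution. Together with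
    [sweedler0] it is the only access to Sweedler powers later on. *)
Lemma sweedlerS n : sweedler H n.+1 = conv (sweedler H n) \1.
Proof.
apply/lfunP => h; rewrite convE; case: n => [|n].
  rewrite /= comp_lfunE !id_lfunE -{1}[h]lam_counit lamE.
  elim/tens_ind: (comul h) => [a b|s t IHs IHt]; last by rewrite !linearD /= IHs IHt.
  by rewrite convt_tens sweedler0 sliceL_tens id_lfunE -scalerAl mul1r.
have lin_m : (forall v, linear ((fun t a => mul_iter H n t * a)^~ v)) /\
     (forall u, linear ((fun t a => mul_iter H n t * a) u)).
  split=> z e x y; first by rewrite linearP mulrDl scalerAl.
  by rewrite mulrDr scalerAr.
rewrite /= !comp_lfunE.
elim/tens_ind: (comul h) => [a b|s t IHs IHt]; last by rewrite !linearD /= IHs IHt.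
rewrite tmapE tlift_tens ?convt_tens ?id_lfunE /= ?comp_lfunE //; by case: lin_m.
Qed.

Lemma grouplike1 : grouplike (1 : H).
Proof. by rewrite /grouplike comul1 counit1 !eqxx. Qed.

Lemma grouplikeM g h : grouplike g -> grouplike h -> grouplike (g * h).
Proof.
move=> gG hG; rewrite /grouplike comulM !grouplike_comul // tmulE eqxx /=.
by rewrite counitM !grouplike_counit //= mulr1.
Qed.

Lemma grouplikeX g n : grouplike g -> grouplike (g ^+ n).
Proof.
move=> gG; elim: n => [|n IHn]; first by rewrite expr0 grouplike1.
by rewrite exprS grouplikeM.
Qed.

Lemma grouplike_mulVr g : grouplike g -> antipode g * g = 1 /\ g * antipode g = 1.
Proof.
move=> gG; split.
  have := antipodel g; rewrite grouplike_comul // grouplike_counit // scale1r.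
  rewrite tlift_tens // => z e x y; first by rewrite linearP mulrDl scalerAl.
  by rewrite mulrDr scalerAr.
have := antipoder g; rewrite grouplike_comul // grouplike_counit // scale1r.
rewrite tlift_tens // => z e x y; first by rewrite mulrDl scalerAl.
by rewrite linearP mulrDr scalerAr.
Qed.

Lemma grouplike_unit g : grouplike g -> g \is a GRing.unit.
Proof. by move=> gG; apply/unitrP; exists (antipode g); apply: grouplike_mulVr. Qed.

Lemma antipode_grouplike g : grouplike g -> antipode g = g^-1.
Proof.
move=> gG; have [Sg _] := grouplike_mulVr gG.
by rewrite -[antipode g]mulr1 -(mulrV (grouplike_unit gG)) mulrA Sg mul1r.
Qed.

Lemma grouplikeV g : grouplike g -> grouplike g^-1.
Proof.
move=> gG; have gU := grouplike_unit gG.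
have [c1 c2] : comul (g^-1) = tens g^-1 g^-1 /\ (counit g^-1 : K) = 1.
  split.
    have E : tmul (tens g^-1 g^-1) (tmul (comul g) (comul g^-1)) = tens g^-1 g^-1.
      by rewrite -comulM mulrV // comul1 tmul1r.
    by rewrite -[RHS]E tmulA (grouplike_comul gG) tmulE mulVr // tmul1l.
  have := counitM g g^-1; rewrite mulrV // counit1 grouplike_counit //.
  by rewrite [RHS]mul1r.
by rewrite /grouplike c1 eqxx; apply/eqP.
Qed.

End HopfBasics.

(** * Coideal subalgebras and freeness *)

Section Freeness.
Variables (K : fieldType) (H : hopfAlgType K).
Implicit Types (f : 'Hom(H, K^o)) (L U W : {vspace H}) (t r : tensor H H).

(* t lies in H (x) U *)
Definition in_right U t := forall f, sliceL H f t \in U.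

Lemma in_rightD U t r : in_right U t -> in_right U r -> in_right U (t + r).
Proof. by move=> tU rU f; rewrite linearD memvD ?tU ?rU. Qed.

Lemma in_rightZ U a t : in_right U t -> in_right U (a *: t).
Proof. by move=> tU f; rewrite lfunZ memvZ ?tU. Qed.

Lemma in_right_tens U a b : b \in U -> in_right U (tens a b).
Proof. by move=> bU f; rewrite sliceL_tens memvZ. Qed.

Lemma in_right_comul U u : lam_stable U -> u \in U -> in_right U (comul u).
Proof. by move=> Ul uU f; rewrite -lamE Ul. Qed.

Definition stabilizes L U := forall a u, a \in L -> u \in U -> a * u \in U.

Lemma in_right_tmul L U W t r : (forall a u, a \in L -> u \in U -> a * u \in W) ->
  in_right L t -> in_right U r -> in_right W (tmul t r).
Proof.
move=> LUW tL rU f; rewrite (tens_sliceL t) tmul_suml linear_sum memv_suml // => i _ /=.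
by rewrite sliceL_tmul_tensl LUW.
Qed.

(** Modulo [U] the coproduct of a u is Delta(a) (g (x) u), so right multiplication by [u] is a
    comodule map from [L], up to translation by [g]. *)
Lemma lam_mul L U g u a f : lam_stable L -> stabilizes L U ->
  in_right U (comul u - tens g u) -> a \in L ->
  lam f (a * u) - lam (f \o amulr g)%VF a * u \in U.
Proof.
move=> Ll LU ur aL; rewrite lamE comulM -[comul u](subrK (tens g u)) tmulDr linearD /=.
rewrite sliceL_tmul_tensr -lamE addrK.
by apply: (in_right_tmul LU) => //; apply: in_right_comul.
Qed.

Variable s : seq H.
Hypothesis sG : forall g, g \in s -> grouplike g.
Hypothesis spt : left_pointed s.

Lemma lam_eigen_line v g : (forall f, lam f v = (f g : K) *: v) ->
  v = (counit v : K) *: g.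
Proof.
move=> lv; rewrite {1}(coordf_sum v) (coordf_sum g) scaler_sumr.
by apply: eq_bigr => i _; rewrite -counit_lam lv functZ scalerA mulrC.
Qed.

Lemma left_coideal_grouplike U : lam_stable U -> U != 0%VS ->
  exists2 g, g \in s & g \in U.
Proof.
move=> Ul U0; have l0 : lam_stable (0%VS : {vspace H}).
  by move=> f u; rewrite memv0 => /eqP ->; rewrite linear0 mem0v.
have U0' : 0%VS != U by rewrite eq_sym.
have [v [g [vU v0 gs vg]]] := spt l0 Ul (sub0v U) U0'.
exists g => //; have lv f : lam f v = (f g : K) *: v.
  by apply/eqP; rewrite -subr_eq0 -memv0.
have vE := lam_eigen_line lv.
have e0 : (counit v : K) != 0.
  by apply: contra v0 => /eqP e0; rewrite vE e0 scale0r mem0v.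
by rewrite -[g]scale1r -(mulVf e0) -scalerA -vE memvZ.
Qed.

(* [lam_stable] says that L is a left coideal. *)
Record coideal_subalg L : Prop := CoidealSubalg {
  csub_lam : lam_stable L;
  csub_mul : stabilizes L L;
  csub_one : 1 \in L;
  csub_grp : forall g, g \in s -> g \in L;
  csub_grpV : forall g, g \in s -> g^-1 \in L
}.

(** The elements of [L] sending [u] into [U] form a left coideal [I]. If it were nonzero it would
    contain a group-like [h], and multiplying by the inverse of [h], which lies in [L], would put
    [u] itself into [U]. *)
Lemma coinvariant_free L U u g : coideal_subalg L -> lam_stable U ->
  stabilizes L U -> grouplike g -> in_right U (comul u - tens g u) -> u \notin U ->
  forall a, a \in L -> a * u \in U -> a = 0.
Proof.
move=> [Ll LL L1 Lg LV] Ul LU gG ur uU a aL auU; apply/eqP; apply: contraT => a0.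
pose I := (L :&: (amulr u @^-1: U))%VS.
have IP x : (x \in I) = (x \in L) && (x * u \in U).
  by rewrite memv_cap -memv_preim lfunE.
have Il : lam_stable I.
  move=> f x; rewrite !IP => /andP[xL xuU]; rewrite Ll //=.
  (* [f'] undoes the translation by [g] that [lam_mul] introduces. *)
  pose f' := (f \o amulr (g^-1)%R)%VF.
  have := lam_mul f' Ll LU ur xL.
  have -> : (f' \o amulr g)%VF = f.
    apply/lfunP => y; rewrite !comp_lfunE ![amulr _ _]lfunE /=.
    by rewrite mulrK // grouplike_unit.
  by move=> xlU; rewrite -[lam f x * u](subKr (lam f' (x * u))) memvB ?Ul.
have I0 : I != 0%VS.
  by apply: contraNneq a0 => I0; rewrite -memv0 -I0 IP aL.
have [h hs] := left_coideal_grouplike Il I0; rewrite IP => /andP[hL huU].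
case/negP: uU; have := LU _ _ (LV h hs) huU.
by rewrite mulrA mulVr ?mul1r // grouplike_unit ?sG.
Qed.

Lemma coinvariant_extend L U u g : coideal_subalg L -> lam_stable U ->
  stabilizes L U -> grouplike g -> in_right U (comul u - tens g u) -> u \notin U ->
  let U' := (U + amulr u @: L)%VS in
  [/\ lam_stable U', stabilizes L U' & \dim U' = (\dim U + \dim L)%N].
Proof.
move=> Lc Ul LU gG ur uU U'; have [Ll LL L1 Lg LV] := Lc.
have free := coinvariant_free Lc Ul LU gG ur uU; split.
- move=> f _ /memv_addP[x xU [_ /memv_imgP[a aL ->] ->]].
  rewrite linearD memvD //; first by apply/(subvP (addvSl _ _))/Ul.
  rewrite lfunE /= -[lam f _](subrK (lam (f \o amulr g)%VF a * u)) memv_add //.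
    exact: (lam_mul _ Ll LU).
  by apply/memv_imgP; exists (lam (f \o amulr g)%VF a); rewrite ?Ll ?lfunE.
- move=> b _ bL /memv_addP[x xU [_ /memv_imgP[a aL ->] ->]].
  rewrite mulrDr memv_add ?LU //; apply/memv_imgP; exists (b * a); first exact: LL.
  by rewrite !lfunE /= mulrA.
- rewrite dimv_disjoint_sum; last first.
    apply/eqP; rewrite -subv0; apply/subvP => w; rewrite memv_cap => /andP[wU].
    case/memv_imgP=> a aL wE; rewrite wE lfunE /= in wU *.
    by rewrite (free _ aL wU) mul0r mem0v.
  congr (_ + _)%N; apply: limg_dim_eq; apply/eqP; rewrite -subv0.
  apply/subvP => a; rewrite memv_cap memv_ker lfunE /= => /andP[aL /eqP au].
  by rewrite (free a) ?mem0v // au mem0v.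
Qed.

Lemma coideal_subalg_dim L : coideal_subalg L -> (\dim L %| \dim {:H})%N.
Proof.
move=> Lc; have [Ll LL L1 Lg LV] := Lc.
suff : exists U, [/\ lam_stable U, stabilizes L U, U = fullv & (\dim L %| \dim U)%N].
  by case=> U [_ _ -> dU].
have : exists U, [/\ lam_stable U, stabilizes L U & (\dim L %| \dim U)%N].
  exists 0%VS; split; rewrite ?dimv0 ?dvdn0 //.
    by move=> f u; rewrite memv0 => /eqP ->; rewrite linear0 mem0v.
  by move=> a u _; rewrite memv0 => /eqP ->; rewrite mulr0 mem0v.
case=> U; have [n] := ubnP (\dim {:H} - \dim U).
elim: n U => // n IHn U ltn [Ul LU dU].
have [Ufull|nU] := eqVneq U fullv; first by exists U.
have fl : lam_stable (fullv : {vspace H}) by move=> *; rewrite memvf.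
have [v [g [_ vU gs vg]]] := spt Ul fl (subvf U) nU.
have vr : in_right U (comul v - tens g v).
  by move=> f; rewrite linearB /= -lamE sliceL_tens.
have [U'l LU' dU'] := coinvariant_extend Lc Ul LU (sG gs) vr vU.
apply: IHn (And3 U'l LU' _); last by rewrite dU' dvdn_addl.
rewrite dU'; have L0 : (0 < \dim L)%N.
  rewrite lt0n dimv_eq0; apply/negP => /eqP L0; have := L1.
  by rewrite L0 memv0 oner_eq0.
rewrite -ltnS; apply: leq_trans ltn; rewrite ltnS ltn_sub2l //.
  rewrite ltn_neqAle dimvS ?subvf // andbT; apply: contra nU.
  by rewrite eqEdim subvf => /eqP ->; rewrite leqnn.
by rewrite -addn1 leq_add2l.
Qed.

End Freeness.

Lemma tensv_ind (K : fieldType) (U V : vectType K) (C : {vspace U}) (D : {vspace V})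
    (P : tensor U V -> Prop) :
  (forall c d, c \in C -> d \in D -> P (tens c d)) ->
  (forall s t, P s -> P t -> P (s + t)) ->
  forall t, t \in tensv C D -> P t.
Proof.
move=> Pt PD t tCD; have P0 : P 0 by rewrite -(tens0l U (0 : V)); apply: Pt; apply: mem0v.
have := coord_span (X := in_tuple [seq tens c d | c <- vbasis C, d <- vbasis D]) tCD.
move=> ->; elim/big_ind: _ => // i _.
have : (in_tuple [seq tens c d | c <- vbasis C, d <- vbasis D])`_i \in
   [seq tens c d | c <- vbasis C, d <- vbasis D] by rewrite mem_nth.
case/allpairsP=> [[c d] /= [cC dD ->]].
by rewrite -tensZl; apply: Pt; rewrite ?memvZ ?vbasis_mem.
Qed.

Section GrouplikeSpan.
Variables (K : fieldType) (H : hopfAlgType K) (s : seq H).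

(** After an extension of scalars the image of the list of group-likes is still a group of
    group-likes, but it is not known to contain all of them. The results used over the extension
    therefore ask for closure rather than completeness. *)
Record closed_grouplikes : Prop := ClosedGrouplikes {
  cg_grouplike : forall g, g \in s -> grouplike g;
  cg_one : 1 \in s;
  cg_mul : forall g h, g \in s -> h \in s -> g * h \in s;
  cg_inv : forall g, g \in s -> g^-1 \in s
}.

Hypothesis sC : closed_grouplikes.

Lemma span_stabilizes : stabilizes <<s>>%VS <<s>>%VS.
Proof.
move=> a u aS uS.
rewrite (coord_span (X := in_tuple s) aS) mulr_suml memv_suml // => i _.
rewrite (coord_span (X := in_tuple s) uS) mulr_sumr memv_suml // => j _.
rewrite -scalerAl -scalerAr !memvZ // memv_span //.
by apply: (cg_mul sC); apply: mem_nth.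
Qed.

Lemma span_coideal_subalg : coideal_subalg s <<s>>%VS.
Proof.
split.
- move=> f u uS; rewrite (coord_span (X := in_tuple s) uS) linear_sum memv_suml // => i _ /=.
  have gs : (in_tuple s)`_i \in s by rewrite mem_nth.
  by rewrite lfunZ lam_grouplike ?(cg_grouplike sC) // !memvZ ?memv_span.
- exact: span_stabilizes.
- by rewrite memv_span ?(cg_one sC).
- by move=> g gs; rewrite memv_span.
- by move=> g gs; rewrite memv_span ?(cg_inv sC).
Qed.

Lemma span_rho_stable : rho_stable <<s>>%VS.
Proof.
move=> f u uS; rewrite (coord_span (X := in_tuple s) uS) linear_sum memv_suml // => i _ /=.
have gs : (in_tuple s)`_i \in s by rewrite mem_nth.
by rewrite lfunZ rho_grouplike ?(cg_grouplike sC) // !memvZ ?memv_span.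
Qed.

End GrouplikeSpan.

(** * Skew-primitive elements modulo a coideal subalgebra *)

Section SkewPrimitives.
Variables (K : fieldType) (H : hopfAlgType K).
Implicit Types (f : 'Hom(H, K^o)) (L U W : {vspace H}) (t r : tensor H H).

Lemma tensv_tmul L t r : stabilizes L L -> t \in tensv L L -> r \in tensv L L ->
  tmul t r \in tensv L L.
Proof.
move=> LL tL rL; elim/tensv_ind: t / tL => [a b aL bL|t t' IH IH']; last first.
  by rewrite tmulDl memvD.
elim/tensv_ind: r / rL => [c d cL dL|t t' IH IH']; last by rewrite tmulDr memvD.
by rewrite tmulE tens_mem ?LL.
Qed.

Variable s : seq H.
Hypothesis sG : forall g, (g \in s) = grouplike g.
Hypothesis spl : left_pointed s.
Hypothesis spr : right_pointed s.

(** Pointedness is used on both sides in turn. A left eigenvector modulo [L], divided by its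
    group-like, shows that the space [V] of all w with Delta w in 1 (x) w + H (x) L is larger than
    [L]. As [V] is a right coideal, it contains a right eigenvector [w] modulo [L], with group-like
    [h]. Both conditions together leave an error in L (x) L, and right multiplication by the inverse
    of [h] normalises the term in w (x) h. *)
Lemma exists_skew_primitive L : coideal_subalg s L -> rho_stable L -> L != fullv ->
  exists y g c, [/\ y \notin L, grouplike g, c \in tensv L L &
    comul y = tens y 1 + tens g y + c].
Proof.
move=> [Ll LL L1 Lg LV] Lr nL.
have fl : lam_stable (fullv : {vspace H}) by move=> *; rewrite memvf.
have [v [g [_ vL gs vg]]] := spl Ll fl (subvf L) nL.
have gG : grouplike g by rewrite -sG.
have gU := grouplike_unit gG; have gVG := grouplikeV gG.
pose u := g^-1 * v.
have uL : u \notin L.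
  by apply: contra vL => uL; rewrite -[v](mulVKr gU); apply: LL => //; apply: Lg.
have uright : in_right L (comul u - tens 1 u).
  have -> : comul u - tens 1 u = tmul (tens g^-1 g^-1) (comul v - tens g v).
    by rewrite tmulDr tmulNr tmulE mulVr // /u comulM (grouplike_comul gVG).
  apply: (@in_right_tmul _ _ L L) => //; first by apply: in_right_tens; apply: LV.
  by move=> f; rewrite linearB /= -lamE sliceL_tens.
pose V := (\bigcap_(i < \dim {:H})
  ((lam (coordf i) - (coordf i (1 : H) : K) *: \1%VF) @^-1: L))%VS.
have VP w : reflect (in_right L (comul w - tens 1 w)) (w \in V).
  have E i : (w \in (lam (coordf i) - (coordf i (1 : H) : K) *: \1%VF) @^-1: L)%VS
      = (sliceL H (coordf i) (comul w - tens 1 w) \in L).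
    rewrite -memv_preim add_lfunE opp_lfunE scale_lfunE id_lfunE.
    by rewrite linearB /= sliceL_tens -lamE.
  apply: (iffP idP) => [|wV]; last first.
    by rewrite /V memvE; apply/subv_bigcapP => i _; rewrite -memvE E.
  rewrite /V memvE => /subv_bigcapP wV.
  move=> f; rewrite (tens_sliceL (comul w - tens 1 w)) linear_sum memv_suml // => i _ /=.
  by rewrite sliceL_tens memvZ // -E memvE wV.
have Vr : rho_stable V.
  move=> f w /VP wV; apply/VP => f'.
  rewrite linearB /= -lamE sliceL_tens lam_rho -lfunZ -linearB /= Lr //.
  by have := wV f'; rewrite linearB /= -lamE sliceL_tens.
have LV' : (L <= V)%VS.
  apply/subvP => a aL; apply/VP => f; rewrite linearB /= -lamE sliceL_tens.
  by rewrite memvB ?memvZ ?Ll.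
have nLV : L != V.
  by apply: contraNneq uL => ->; apply/VP.
have [w [h [/VP wV wL hs wh]]] := spr Lr Vr LV' nLV.
have hG : grouplike h by rewrite -sG.
have hU := grouplike_unit hG; have hVG := grouplikeV hG.
pose c0 := comul w - tens w h - tens 1 w.
have c0L : c0 \in tensv L L.
  apply/tensvP; split=> f.
    rewrite /c0 addrAC linearB /= memvB ?wV // sliceL_tens memvZ //.
    exact: Lg.
  rewrite /c0 linearB /= memvB //; last by rewrite sliceR_tens memvZ.
  by rewrite linearB /= -rhoE sliceR_tens.
exists (w * h^-1), h^-1, (tmul c0 (tens h^-1 h^-1)); split=> //.
- apply: contra wL => whL; rewrite -[w](mulrVK hU).
  by apply: LL => //; apply: Lg.
- by rewrite tensv_tmul // tens_mem ?LV.
rewrite /c0 !tmulDl !tmulNl !tmulE mulrV // mul1r comulM (grouplike_comul hVG).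
by rewrite -[X in _ = _ + X]addrA -opprD [RHS]addrC subrK.
Qed.

Lemma grouplikes_closed : closed_grouplikes s.
Proof.
split=> [g||g h|g]; rewrite ?sG //; [exact: grouplike1 | exact: grouplikeM | exact: grouplikeV].
Qed.

Lemma group_coideal_subalg : coideal_subalg s <<s>>%VS.
Proof. exact: span_coideal_subalg grouplikes_closed. Qed.

Lemma group_rho_stable : rho_stable <<s>>%VS.
Proof. exact: span_rho_stable grouplikes_closed. Qed.

(** Over the group algebra the error c can be absorbed. Let [phi] be 1 at [g] and 0 at the other
    group-likes, so that [lam phi] projects the span of [s] onto the line of [g]. Applying
    [comul_lam] to [lam phi y] shows that y plus the [phi]-slice of c is exactly skew-primitive. *)
Lemma exists_exact_skew_primitive : uniq s -> <<s>>%VS != fullv ->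
  exists y g, [/\ y \notin <<s>>%VS, grouplike g & comul y = tens y 1 + tens g y].
Proof.
move=> us nS.
have [y [g [c [yS gG cS dy]]]] :=
  exists_skew_primitive group_coideal_subalg group_rho_stable nS.
have fs : free s by apply: grouplike_free => //; apply/allP => h; rewrite sG.
have gs : g \in s by rewrite sG.
have g_notin : g \notin <<rem g s>>%VS.
  have := fs; rewrite (perm_free (perm_to_rem gs)) free_cons => /andP[].
  by [].
have [phi phi0 phig] := separating_functional g_notin.
have lphi a : a \in <<s>>%VS -> lam phi a = (phi a : K) *: g.
  move=> aS; rewrite (coord_span (X := in_tuple s) aS) !linear_sum scaler_suml.
  apply: eq_bigr => i _ /=; rewrite lfunZ functZ -scalerA; congr (_ *: _).
  have hs : (in_tuple s)`_i \in s by rewrite mem_nth.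
  rewrite lam_grouplike -?sG //; have [->//|ne] := eqVneq (in_tuple s)`_i g.
  by rewrite phi0 ?scale0r // memv_span // mem_rem_uniq // inE ne.
have cphi : tmap (lam phi) \1 c = tens g (sliceL H phi c).
  elim/tensv_ind: c / cS {dy} => [a b aS bS|t t' IH IH'].
    by rewrite tmapE sliceL_tens lphi // id_lfunE tensZl tensZr.
  by rewrite !linearD /= IH IH' tensDr.
have slS : sliceL H phi c \in <<s>>%VS by have /tensvP[] := cS.
have [z zE] : exists z, z = y + sliceL H phi c by exists (y + sliceL H phi c).
have lz : lam phi y = z + (phi y : K) *: 1.
  by rewrite zE lamE dy !linearD /= !sliceL_tens phig scale1r -addrA addrC.
exists z, g; split=> //.
  apply: contra yS => zS; rewrite -[y](addrK (sliceL H phi c)).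
  by rewrite -zE memvB.
have := comul_lam phi y; rewrite lz linearD /= lfunZ comul1 dy !linearD /=.
rewrite !tmapE !id_lfunE (lam_grouplike _ gG) phig scale1r cphi lz.
rewrite -[RHS]addrA -tensDr -zE tensDl tensZl addrAC; apply: addIr.
Qed.

End SkewPrimitives.

(** * Adjoining a skew-primitive element *)

Lemma add_shuffle (V : nmodType) (a b d e x1 x2 x3 x4 x5 x6 : V) :
  a + b + x1 + x2 + (e + d + x3) + (x4 + x5 + x6) =
  e + (d + a) + (b + x1 + x2 + x3 + (x4 + x5 + x6)).
Proof. by rewrite [LHS](AC (4*3*3) (5*(6*1)*(2*3*4*7*(8*9*10)))). Qed.

Section Adjunction.
Variables (K : fieldType) (H : hopfAlgType K).
Implicit Types (f phi : 'Hom(H, K^o)) (U W : {vspace H}) (t r : tensor H H).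

Variable s : seq H.
Hypothesis sG : forall g, g \in s -> grouplike g.
Hypothesis spl : left_pointed s.

Variable L : {vspace H}.
Hypothesis Lc : coideal_subalg s L.
Hypothesis Lr : rho_stable L.

Variables (y g : H) (c : tensor H H) (z : K).
Hypothesis yL : y \notin L.
Hypothesis gG : grouplike g.
Hypothesis gL : g \in L.
Hypothesis gVL : g^-1 \in L.
Hypothesis cL : c \in tensv L L.
Hypothesis dy : comul y = tens y 1 + tens g y + c.
Hypothesis ycomm : forall a, a \in L -> exists b d, [/\ b \in L, d \in L & y * a = b * y + d].
Hypothesis yg : y * g - z *: (g * y) \in L.

(** Exponents stay below [n], so [y ^+ m \in powers m] says that y^m reduces to lower powers. *)
Fixpoint powers n : {vspace H} :=
  if n is m.+1 then (powers m + amulr (y ^+ m) @: L)%VS else 0%VS.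

Let Ll := csub_lam Lc.
Let LL := csub_mul Lc.
Let L1 := csub_one Lc.

Lemma powersS m : (powers m <= powers m.+1)%VS.
Proof. exact: addvSl. Qed.

Lemma powers_le m n : (m <= n)%N -> (powers m <= powers n)%VS.
Proof.
elim: n => [|n IHn]; first by rewrite leqn0 => /eqP ->.
rewrite leq_eqVlt => /predU1P[->//|]; rewrite ltnS => /IHn le.
exact: subv_trans (powersS n).
Qed.

Lemma powers_mem b m n : b \in L -> (m < n)%N -> b * y ^+ m \in powers n.
Proof.
move=> bL lt; apply: (subvP (powers_le lt)); rewrite /= -[b * _]add0r memv_add ?mem0v //.
by apply/memv_imgP; exists b; rewrite ?lfunE.
Qed.

Lemma expy_powers m n : (m < n)%N -> y ^+ m \in powers n.
Proof. by move=> lt; rewrite -[y ^+ m]mul1r powers_mem. Qed.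

Lemma powers_ind (P : H -> Prop) n : P 0 -> (forall u v, P u -> P v -> P (u + v)) ->
  (forall b m, b \in L -> (m < n)%N -> P (b * y ^+ m)) -> forall u, u \in powers n -> P u.
Proof.
move=> P0 PD; elim: n => [|n IHn] Pm u; first by rewrite memv0 => /eqP ->.
case/memv_addP=> v vn [_ /memv_imgP[b bL ->] ->]; rewrite lfunE /=.
by apply: PD; [apply: IHn vn => // a m aL lt; apply: Pm => //; apply: ltnW | apply: Pm].
Qed.

Lemma powers_stab n : stabilizes L (powers n).
Proof.
move=> a u aL; elim/powers_ind => [|v w IH IH'|b m bL lt].
- by rewrite mulr0 mem0v.
- by rewrite mulrDr memvD.
- by rewrite mulrA powers_mem ?LL.
Qed.

Lemma powers_y n u : u \in powers n -> y * u \in powers n.+1.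
Proof.
elim/powers_ind => [|v w IH IH'|b m bL lt].
- by rewrite mulr0 mem0v.
- by rewrite mulrDr memvD.
have [b' [d [b'L dL E]]] := ycomm bL.
rewrite mulrA E mulrDl -mulrA -exprS memvD ?powers_mem //.
exact: ltn_trans lt _.
Qed.

Lemma powers_y_pred n u : u \in powers n.-1 -> y * u \in powers n.
Proof.
case: n => [|n] /=; last exact: powers_y.
by rewrite memv0 => /eqP ->; rewrite mulr0 mem0v.
Qed.

(* t lies in L (x) P_n + H (x) P_(n-1). *)
Let tri n t := in_right (powers n) t /\
  forall phi, (forall a, a \in L -> phi a = 0) -> sliceL H phi t \in powers n.-1.

Let triD n t r : tri n t -> tri n r -> tri n (t + r).
Proof.
move=> [t1 t2] [r1 r2]; split; first exact: in_rightD.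
by move=> phi phiL; rewrite linearD memvD ?t2 ?r2.
Qed.

Let tri_tensL n a b : a \in L -> b \in powers n -> tri n (tens a b).
Proof.
move=> aL bn; split; first exact: in_right_tens.
by move=> phi phiL; rewrite sliceL_tens phiL // scale0r mem0v.
Qed.

Let pred_le n : (powers n.-1 <= powers n)%VS.
Proof. exact/powers_le/leq_pred. Qed.

Let tri_pred n t : in_right (powers n.-1) t -> tri n t.
Proof. by move=> tn; split=> // f; apply/(subvP (pred_le n))/tn. Qed.

Let triS n t : tri n t -> tri n.+1 t.
Proof. by move=> [t1 t2]; apply: tri_pred. Qed.

Let phi_amull a phi : a \in L -> (forall b, b \in L -> phi b = 0) ->
  forall b, b \in L -> (phi \o amull a)%VF b = 0.
Proof. by move=> aL phiL b bL; rewrite comp_lfunE lfunE /= phiL ?LL. Qed.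

Let tri_mulL n a b t : a \in L -> b \in L -> tri n t -> tri n (tmul (tens a b) t).
Proof.
move=> aL bL [t1 t2]; split=> [f|phi phiL]; rewrite sliceL_tmul_tensl powers_stab //.
by apply: t2; apply: phi_amull.
Qed.

Let tri_cmul n d t : d \in tensv L L -> tri n t -> tri n (tmul d t).
Proof.
move=> dL tn; elim/tensv_ind: d / dL => [a b aL bL|t' r' IH IH'].
  exact: tri_mulL.
by rewrite tmulDl; apply: triD.
Qed.

Let tri_y1 n t : in_right (powers n) t -> tri n.+1 (tmul (tens y 1) t).
Proof. by move=> tn; apply: tri_pred => f; rewrite sliceL_tmul_tensl mul1r; apply: tn. Qed.

Let tri_gy n t : tri n t -> tri n.+1 (tmul (tens g y) t).
Proof.
move=> [t1 t2]; split=> [f|phi phiL]; rewrite sliceL_tmul_tensl.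
  exact: powers_y.
by apply: powers_y_pred; apply: t2; apply: phi_amull.
Qed.

(** The Gaussian integer (n)_z. *)
Let qint n : K := \sum_(i < n) z ^+ i.

Let gXL n : g ^+ n \in L.
Proof. by elim: n => [|n IHn]; rewrite ?expr0 // exprS LL. Qed.

Let ygX n : exists2 a, a \in L & y * g ^+ n = z ^+ n *: (g ^+ n * y) + a.
Proof.
elim: n => [|n [a aL IHn]]; first by exists 0; rewrite ?mem0v // !expr0 mulr1 mul1r scale1r addr0.
pose b := y * g - z *: (g * y).
have E : y * g = z *: (g * y) + b by rewrite /b addrC subrK.
exists (z *: (g * a) + b * g ^+ n); first by rewrite memvD ?memvZ ?LL.
rewrite {1}exprS mulrA E mulrDl -scalerAl -[g * y * _]mulrA IHn mulrDr scalerDr -scalerAr scalerA.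
by rewrite -exprS mulrA -exprS addrA.
Qed.

(** Of the z-binomial expansion only the first two terms are tracked. Against a functional vanishing
    on [L], the remainder [tri n] contributes only to [powers n.-1], so the coefficient of y^(n-1)
    comes from the second term alone. For [n = 0] the predecessors carry no information, but
    [qint 0] is 0. *)
Lemma comul_expy n : exists2 t, tri n t &
  comul (y ^+ n) = tens (g ^+ n) (y ^+ n) +
    qint n *: tens (g ^+ n.-1 * y) (y ^+ n.-1) + t.
Proof.
elim: n => [|n [t tn IHn]].
  exists 0; last by rewrite !expr0 /qint big_ord0 scale0r !addr0 comul1.
  by split=> f; rewrite linear0 mem0v.
rewrite exprS comulM IHn dy.
have [a aL Ea] := ygX n.
pose T1 := tens (g ^+ n) (y ^+ n).
pose T2 := qint n *: tens (g ^+ n.-1 * y) (y ^+ n.-1).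
have T2n : in_right (powers n) T2.
  rewrite /T2; have [->|n0] := posnP n.
    by move=> f; rewrite /qint big_ord0 scale0r linear0 mem0v.
  by apply/in_rightZ/in_right_tens/expy_powers; rewrite prednK.
exists (tens a (y ^+ n) + tmul (tens y 1) T2 + tmul (tens y 1) t + tmul (tens g y) t
   + tmul c (T1 + T2 + t)).
  have yn : y ^+ n \in powers n.+1 by apply: expy_powers.
  apply: triD; first apply: triD; first apply: triD; first apply: triD.
  - exact: tri_tensL.
  - exact: tri_y1.
  - by apply: tri_y1; case: tn.
  - exact: tri_gy.
  apply: tri_cmul => //; apply: triD; last exact: triS.
  by apply: triD; [apply: tri_tensL | apply: tri_pred].
rewrite -/T1 -/T2 !tmulDl !tmulDr.
have -> : tmul (tens y 1) T1 = z ^+ n *: tens (g ^+ n * y) (y ^+ n) + tens a (y ^+ n).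
  by rewrite /T1 tmulE mul1r Ea tensDl tensZl.
have -> : tmul (tens g y) T1 = tens (g ^+ n.+1) (y * y ^+ n) by rewrite /T1 tmulE exprS.
have -> : tmul (tens g y) T2 = qint n *: tens (g ^+ n * y) (y ^+ n).
  rewrite /T2; have [->|n0] := posnP n.
    by rewrite /qint big_ord0 !scale0r tmul0r.
  by rewrite tmulZr tmulE mulrA -!exprS prednK.
have -> : qint n.+1 = qint n + z ^+ n by rewrite /qint big_ord_recr.
rewrite scalerDl /=.
set A := z ^+ n *: _; set B := tens a _; set D := qint n *: _; set E := tens (g ^+ _) _.
set x1 := tmul _ T2; set x2 := tmul _ t; set x3 := tmul _ t; set x4 := tmul c T1.
set x5 := tmul c T2; set x6 := tmul c t.
exact: add_shuffle.
Qed.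

Lemma comul_expy_right n : in_right (powers n) (comul (y ^+ n) - tens (g ^+ n) (y ^+ n)).
Proof.
have [t [tn _] ->] := comul_expy n.
rewrite -[X in X - _]addrA [X in X - _]addrC addrK.
apply: in_rightD => //; have [->|n0] := posnP n.
  by move=> f; rewrite /qint big_ord0 scale0r linear0 mem0v.
by apply/in_rightZ/in_right_tens/expy_powers; rewrite prednK.
Qed.

Lemma powers_dim n : (forall i, (i < n)%N -> y ^+ i \notin powers i) ->
  lam_stable (powers n) /\ \dim (powers n) = (n * \dim L)%N.
Proof.
elim: n => [|n IHn] yn.
  split; last by rewrite dimv0.
  by move=> f u; rewrite memv0 => /eqP ->; rewrite linear0 mem0v.
have [|pl dn] := IHn; first by move=> i lt; apply: yn; apply: ltnW.
have [|//|pl' _ dn'] := coinvariant_extend sG spl Lc pl (@powers_stab n) _ (comul_expy_right n).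
- exact: grouplikeX.
- exact: yn.
by split=> //; rewrite dn' dn mulSn addnC.
Qed.

(** [m] is the least exponent for which y^m reduces to lower powers; it exists because each
    irreducible power adds \dim L dimensions. The reduction makes [powers m] closed under products.
    The relation (m)_z = 0 is the vanishing of the second coefficient of Delta(y^m), and it gives m
    > 1 since (1)_z = 1. *)
Lemma adjunction : exists m, [/\ (1 < m)%N, \sum_(i < m) z ^+ i = 0,
  coideal_subalg s (powers m), \dim (powers m) = (m * \dim L)%N &
  forall i, (i < m)%N -> y ^+ i \notin powers i] /\ y ^+ m \in powers m.
Proof.
have L0 : (0 < \dim L)%N.
  rewrite lt0n dimv_eq0; apply: contraTneq L1 => ->.
  by rewrite memv0 oner_eq0.
have exm : exists m, y ^+ m \in powers m.
  case: (classic (exists m, y ^+ m \in powers m)) => // no.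
  have [|_ dn] := @powers_dim (\dim {:H}).+1.
    by move=> i _; apply/negP => yi; apply: no; exists i.
  have : (\dim (powers (\dim {:H}).+1) <= \dim {:H})%N by rewrite dimvS ?subvf.
  by rewrite dn leqNgt (leq_trans _ (leq_pmulr _ L0)).
case: (ex_minnP exm) => m ym minm.
have yi i : (i < m)%N -> y ^+ i \notin powers i.
  by move=> lt; apply/negP => /minm; rewrite leqNgt lt.
have m0 : (0 < m)%N.
  by rewrite lt0n; apply: contraTneq ym => ->; rewrite memv0 oner_eq0.
have [pl dm] := powers_dim yi.
have pstab : stabilizes (powers m) (powers m).
  have ypow u : u \in powers m -> y * u \in powers m.
    move=> um; have := powers_y um; rewrite /= => /memv_addP[v vm [_ /memv_imgP[b bL ->] ->]].
    by rewrite memvD // lfunE /= powers_stab.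
  have yXpow n u : u \in powers m -> y ^+ n * u \in powers m.
    move=> um; elim: n => [|n IHn]; first by rewrite expr0 mul1r.
    by rewrite exprS -mulrA ypow.
  move=> a u am um; elim/powers_ind: a / am => [|v w IH IH'|b n bL lt].
  - by rewrite mul0r mem0v.
  - by rewrite mulrDl memvD.
  - by rewrite -mulrA powers_stab ?yXpow.
have Lm a : a \in L -> a \in powers m.
  by move=> aL; rewrite -[a]mulr1 -(expr0 y) powers_mem.
(* A functional vanishing on [L] lowers the filtration by one: it kills the leading term of
   Delta(y^n), and multiplication by Delta(b), which lies in L (x) L, does no harm. *)
have lam_pred phi u : (forall a, a \in L -> phi a = 0) -> u \in powers m ->
    lam phi u \in powers m.-1.
  move=> phiL um; elim/powers_ind: u / um => [|v w IH IH'|b n bL lt].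
  - by rewrite linear0 mem0v.
  - by rewrite linearD memvD.
  have bLL : comul b \in tensv L L.
    by apply/tensvP; split=> f; rewrite -?lamE -?rhoE ?(csub_lam Lc) ?Lr.
  rewrite lamE comulM; elim/tensv_ind: {bL} (comul b) / bLL => [a d aL dL|t r IH IH'].
    rewrite sliceL_tmul_tensl; apply: powers_stab => //.
    have phiL' := phi_amull aL phiL.
    have [t [_ tn] ->] := comul_expy n; rewrite !linearD /= lfunZ !sliceL_tens.
    rewrite phiL' // scale0r add0r memvD //.
      have [->|n0] := posnP n; first by rewrite /qint big_ord0 scale0r mem0v.
      by rewrite !memvZ // expy_powers // -ltnS !prednK.
    by apply: subvP (tn _ phiL'); apply: powers_le; rewrite -!subn1 leq_sub2r // ltnW.
  by rewrite tmulDl linearD memvD.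
have qm : qint m = 0.
  have gyL : g ^+ m.-1 * y \notin L.
    elim: m.-1 => [|n IHn]; first by rewrite expr0 mul1r.
    apply: contra IHn => gyL; rewrite -[_ * y](mulKr (grouplike_unit gG)).
    by rewrite [g * _]mulrA -exprS LL.
  (* This [phi] reads off the second term: modulo lower powers [lam phi] sends y^m to (m)_z y^(m-1),
     whereas [lam_pred] sends it into [powers m.-1]. Minimality of [m] leaves only (m)_z = 0. *)
  have [phi phiL phiy] := separating_functional gyL.
  apply/eqP; apply: contraT => q0.
  have := lam_pred phi _ phiL ym.
  have [t [_ tm] E] := comul_expy m.
  rewrite lamE E !linearD /= lfunZ !sliceL_tens phiy phiL // scale0r add0r scale1r.
  move=> qy; have : qint m *: y ^+ m.-1 \in powers m.-1.
    by rewrite -[X in X \in _](addrK (sliceL H phi t)) memvB ?tm.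
  move=> /(memvZ (qint m)^-1); rewrite scalerA mulVf // scale1r => ym1.
  by have := yi m.-1; rewrite prednK // leqnn ym1 => /(_ isT).
exists m; split=> //; split=> //.
- rewrite ltn_neqAle m0 andbT; apply: contraTneq (oner_neq0 K) => m1.
  by move: qm; rewrite -m1 /qint big_ord1 expr0 => ->; rewrite eqxx.
- split=> //.
  + exact: Lm.
  + by move=> h hs; apply: Lm; apply: (csub_grp Lc).
  + by move=> h hs; apply: Lm; apply: (csub_grpV Lc).
Qed.

End Adjunction.

(** * Extension of scalars *)

(* Extension of scalars along sigma : K -> E, in the coordinates of the
   library basis of V. *)
Definition base_change (K E : fieldType) (sigma : {rmorphism K -> E})
  (V : vectType K) : Type := 'rV[E]_(\dim {:V}).

Section BaseChangeVect.
Variables (K E : fieldType) (sigma : {rmorphism K -> E}) (V : vectType K).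
Local Notation VE := (base_change sigma V).

HB.instance Definition _ := Vector.on VE.

Definition emb (v : V) : VE := \row_i sigma (coord (vbasis {:V}) i v).

Lemma embD u v : emb (u + v) = emb u + emb v.
Proof. by apply/rowP => i; rewrite !mxE linearD rmorphD. Qed.

Lemma embZ a v : emb (a *: v) = sigma a *: emb v.
Proof. by apply/rowP => i; rewrite !mxE linearZ /= rmorphM. Qed.

Lemma emb0 : emb 0 = 0.
Proof. by rewrite -(scale0r (0 : V)) embZ rmorph0 scale0r. Qed.

Lemma embN v : emb (- v) = - emb v.
Proof. by rewrite -scaleN1r embZ rmorphN1 scaleN1r. Qed.

Lemma emb_sum I (r : seq I) (P : pred I) F :
  emb (\sum_(i <- r | P i) F i) = \sum_(i <- r | P i) emb (F i).
Proof. exact: (big_morph emb embD emb0). Qed.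

Lemma emb_inj : injective emb.
Proof.
move=> u v uv; rewrite (coord_vbasis (memvf u)) (coord_vbasis (memvf v)).
apply: eq_bigr => i _; congr (_ *: _); apply: (fmorph_inj sigma).
by move/rowP/(_ i): uv; rewrite !mxE.
Qed.

Lemma emb_delta (i : 'I_(\dim {:V})) : emb (vbasis {:V})`_i = delta_mx 0 i.
Proof.
apply/rowP => j; rewrite !mxE coord_free ?(basis_free (vbasisP _)) // eqxx /=.
by rewrite eq_sym rmorph_nat.
Qed.

Lemma base_change_sum (u : VE) :
  u = \sum_(i < \dim {:V}) (u : 'rV_(_)) 0 i *: emb (vbasis {:V})`_i.
Proof. by rewrite {1}[u]row_sum_delta; apply: eq_bigr => i _; rewrite emb_delta. Qed.

Lemma base_change_ind (P : VE -> Prop) : (forall a v, P (a *: emb v)) ->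
  (forall u v, P u -> P v -> P (u + v)) -> forall u, P u.
Proof.
move=> Pe PD u; rewrite (base_change_sum u); elim/big_ind: _ => //.
by have := Pe 0 0; rewrite scale0r.
Qed.

Definition bc_ext_fun (W : vectType E) (F : V -> W) (u : VE) : W :=
  \sum_(i < \dim {:V}) (u : 'rV_(_)) 0 i *: F (vbasis {:V})`_i.

Fact bc_ext_is_linear (W : vectType E) (F : V -> W) : linear (bc_ext_fun F).
Proof.
move=> a u v; rewrite /bc_ext_fun scaler_sumr -big_split /=.
by apply: eq_bigr => i _; rewrite !mxE scalerDl scalerA.
Qed.

HB.instance Definition _ (W : vectType E) (F : V -> W) :=
  GRing.isSemilinear.Build E VE W _ (bc_ext_fun F)
    (GRing.semilinear_linear (bc_ext_is_linear F)).

(** Semilinearity of [F] is deferred to [bc_ext_emb], so that extensions can be nested, as in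
    [bc_mul], before anything is proved about them. *)
Definition bc_ext (W : vectType E) (F : V -> W) : 'Hom(VE, W) := linfun (bc_ext_fun F).

Lemma bc_ext_emb (W : vectType E) (F : V -> W) :
  (forall u v, F (u + v) = F u + F v) -> (forall a v, F (a *: v) = sigma a *: F v) ->
  forall v, bc_ext F (emb v) = F v.
Proof.
move=> FD FZ v; rewrite lfunE /= /bc_ext_fun [v in RHS](coord_vbasis (memvf v)).
have F0 : F 0 = 0 by rewrite -(scale0r (0 : V)) FZ rmorph0 scale0r.
rewrite (big_morph F FD F0).
by apply: eq_bigr => i _; rewrite FZ mxE.
Qed.

Lemma dim_base_change : \dim (fullv : {vspace VE}) = \dim (fullv : {vspace V}).
Proof. by rewrite dimvf /dim /= mul1n. Qed.

End BaseChangeVect.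

Section BaseChangeTensor.
Variables (K E : fieldType) (sigma : {rmorphism K -> E}).
Local Notation emb := (emb sigma).

(** The canonical map into the tensor product of the extensions, expanded along the basis of [U] so
    that no choice of pure tensors enters; [emb2_tens] characterises it. *)
Definition emb2 (U V : vectType K) (t : tensor U V) :
    tensor (base_change sigma U) (base_change sigma V) :=
  \sum_(i < \dim {:U}) tens (emb (vbasis {:U})`_i) (emb (sliceL V (coordf i) t)).

Lemma emb2D (U V : vectType K) (t r : tensor U V) : emb2 (t + r) = emb2 t + emb2 r.
Proof.
rewrite -big_split /=; apply: eq_bigr => i _.
by rewrite linearD /= embD tensDr.
Qed.

Lemma emb2_tens (U V : vectType K) (u : U) (v : V) : emb2 (tens u v) = tens (emb u) (emb v).
Proof.
rewrite [u in RHS](coordf_sum u) emb_sum tens_suml; apply: eq_bigr => i _.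
by rewrite sliceL_tens !embZ tensZr tensZl.
Qed.

Lemma emb2Z (U V : vectType K) a (t : tensor U V) : emb2 (a *: t) = sigma a *: emb2 t.
Proof.
elim/tens_ind: t => [u v|s t IHs IHt].
  by rewrite -tensZl !emb2_tens embZ tensZl.
by rewrite scalerDr !emb2D scalerDr IHs IHt.
Qed.

Definition emb3 (U V W : vectType K) (t : tensor U (tensor V W)) :
    tensor (base_change sigma U) (tensor (base_change sigma V) (base_change sigma W)) :=
  \sum_(i < \dim {:U}) tens (emb (vbasis {:U})`_i) (emb2 (sliceL _ (coordf i) t)).

Lemma emb3D (U V W : vectType K) (t r : tensor U (tensor V W)) :
  emb3 (t + r) = emb3 t + emb3 r.
Proof.
rewrite -big_split /=; apply: eq_bigr => i _.
by rewrite linearD /= emb2D tensDr.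
Qed.

Lemma emb3_tens (U V W : vectType K) (u : U) (t : tensor V W) :
  emb3 (tens u t) = tens (emb u) (emb2 t).
Proof.
rewrite [u in RHS](coordf_sum u) emb_sum tens_suml; apply: eq_bigr => i _.
by rewrite sliceL_tens embZ emb2Z tensZr tensZl.
Qed.

End BaseChangeTensor.

(** * The Hopf algebra structure on the extension *)

Section BaseChangeHopf.
Variables (K E : fieldType) (sigma : {rmorphism K -> E}) (H : hopfAlgType K).
Local Notation emb := (emb sigma).
Local Notation HE := (base_change sigma H).

Definition bc_mul (u v : HE) : HE :=
  bc_ext sigma (fun a => bc_ext sigma (fun b => emb (a * b)) v) u.

Lemma bc_mul_emb a b : bc_mul (emb a) (emb b) = emb (a * b).
Proof.
have E1 x y : bc_ext sigma (fun b => emb (x * b)) (emb y) = emb (x * y).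
  by rewrite bc_ext_emb // => *; rewrite ?mulrDr ?embD -?scalerAr ?embZ.
by rewrite /bc_mul bc_ext_emb // => *; rewrite !E1 ?mulrDl ?embD -?scalerAl ?embZ.
Qed.

Lemma bc_mulDl : left_distributive bc_mul +%R.
Proof. by move=> u v w; rewrite /bc_mul linearD. Qed.

Lemma bc_mulZl a u v : bc_mul (a *: u) v = a *: bc_mul u v.
Proof. exact: linearZ. Qed.

Lemma bc_mulDr : right_distributive bc_mul +%R.
Proof.
move=> u v w; rewrite /bc_mul !lfunE /= /bc_ext_fun -big_split /=.
by apply: eq_bigr => i _; rewrite linearD scalerDr.
Qed.

Lemma bc_mulZr a u v : bc_mul u (a *: v) = a *: bc_mul u v.
Proof.
rewrite /bc_mul !lfunE /= /bc_ext_fun scaler_sumr /=.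
by apply: eq_bigr => i _; rewrite lfunZ !scalerA mulrC.
Qed.

Lemma bc_mulA : associative bc_mul.
Proof.
move=> u v w; elim/base_change_ind: u => [a x|u u' IH IH']; last first.
  by rewrite !bc_mulDl IH IH'.
elim/base_change_ind: v => [b y|v v' IH IH']; last first.
  by rewrite bc_mulDr !bc_mulDl bc_mulDr IH IH'.
elim/base_change_ind: w => [c z|w w' IH IH']; last first.
  by rewrite !bc_mulDr IH IH'.
by rewrite !bc_mulZl !bc_mulZr !bc_mulZl !bc_mul_emb mulrA !scalerA mulrAC.
Qed.

Lemma bc_mul1l : left_id (emb (1 : H)) bc_mul.
Proof.
move=> u; elim/base_change_ind: u => [a x|u u' IH IH']; last by rewrite bc_mulDr IH IH'.
by rewrite bc_mulZr bc_mul_emb mul1r.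
Qed.

Lemma bc_mul1r : right_id (emb (1 : H)) bc_mul.
Proof.
move=> u; elim/base_change_ind: u => [a x|u u' IH IH']; last by rewrite bc_mulDl IH IH'.
by rewrite bc_mulZl bc_mul_emb mulr1.
Qed.

Lemma bc_oner_neq0 : emb (1 : H) != 0 :> HE.
Proof. by rewrite -(emb0 sigma H) (inj_eq (@emb_inj _ _ _ _)) oner_neq0. Qed.

HB.instance Definition _ := GRing.Zmodule_isNzRing.Build HE
  bc_mulA bc_mul1l bc_mul1r bc_mulDl bc_mulDr bc_oner_neq0.

Lemma embM a b : emb (a * b) = emb a * emb b.
Proof. by rewrite -bc_mul_emb. Qed.

Lemma emb1 : emb (1 : H) = (1 : HE). Proof. by []. Qed.

Fact bc_scalerAl (a : E) (u v : HE) : a *: (u * v) = a *: u * v.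
Proof. exact/esym/bc_mulZl. Qed.

HB.instance Definition _ := GRing.Lmodule_isLalgebra.Build E HE bc_scalerAl.

Fact bc_scalerAr (a : E) (u v : HE) : a *: (u * v) = u * (a *: v).
Proof. exact/esym/bc_mulZr. Qed.

HB.instance Definition _ := GRing.Lalgebra_isAlgebra.Build E HE bc_scalerAr.
HB.instance Definition _ := Algebra_isFalgebra.Build E HE.

Definition bc_comul : 'Hom(HE, tensor HE HE) := bc_ext sigma (fun h => emb2 sigma (comul h)).

Lemma bc_comul_emb h : bc_comul (emb h) = emb2 sigma (comul h).
Proof.
rewrite /bc_comul bc_ext_emb // => *; first by rewrite linearD emb2D.
by rewrite lfunZ emb2Z.
Qed.

Definition bc_counit : 'Hom(HE, E^o) := bc_ext sigma (fun h => sigma (counit h : K) : E^o).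

Lemma bc_counit_emb h : bc_counit (emb h) = sigma (counit h : K).
Proof.
rewrite /bc_counit bc_ext_emb // => *; first by rewrite linearD rmorphD.
by rewrite functZ rmorphM.
Qed.

Definition bc_antipode : 'End(HE) := bc_ext sigma (fun h => emb (antipode h)).

Lemma bc_antipode_emb h : bc_antipode (emb h) = emb (antipode h).
Proof.
rewrite /bc_antipode bc_ext_emb // => *; first by rewrite linearD embD.
by rewrite lfunZ embZ.
Qed.

Fact bc_comulA (u : HE) : tassoc HE HE HE (tmap bc_comul \1%VF (bc_comul u)) =
  tmap \1%VF bc_comul (bc_comul u).
Proof.
elim/base_change_ind: u => [a h|u v IHu IHv]; last by rewrite !linearD /= IHu IHv.
rewrite !lfunZ bc_comul_emb; congr (_ *: _).
have -> : tmap \1%VF bc_comul (emb2 sigma (comul h)) = emb3 sigma (tmap \1%VF comul (comul h)).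
  elim/tens_ind: (comul h) => [x y|s t IHs IHt]; last first.
    by rewrite emb2D !linearD /= emb3D IHs IHt.
  by rewrite emb2_tens !tmapE emb3_tens bc_comul_emb !id_lfunE.
rewrite -comulA.
elim/tens_ind: (comul h) => [x y|s t IHs IHt]; last first.
  by rewrite emb2D !linearD /= emb3D IHs IHt.
rewrite emb2_tens !tmapE bc_comul_emb !id_lfunE.
elim/tens_ind: (comul x) => [z w|s t IHs IHt]; last first.
  by rewrite emb2D !tensDl !linearD /= emb3D IHs IHt.
by rewrite emb2_tens !tassocE emb3_tens emb2_tens.
Qed.

Fact bc_counitl (u : HE) :
  tlift (fun a b : HE => (bc_counit a : E) *: b) (bc_comul u) = u.
Proof.
rewrite -[tlift _]/(sliceL HE bc_counit).
elim/base_change_ind: u => [a h|u v IHu IHv]; last by rewrite !linearD /= IHu IHv.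
rewrite !lfunZ bc_comul_emb; congr (_ *: _).
rewrite -[h in RHS]lam_counit lamE.
elim/tens_ind: (comul h) => [x y|s t IHs IHt]; last by rewrite emb2D !linearD /= embD IHs IHt.
by rewrite emb2_tens !sliceL_tens bc_counit_emb embZ.
Qed.

Fact bc_counitr (u : HE) :
  tlift (fun a b : HE => (bc_counit b : E) *: a) (bc_comul u) = u.
Proof.
rewrite -[tlift _]/(sliceR HE bc_counit).
elim/base_change_ind: u => [a h|u v IHu IHv]; last by rewrite !linearD /= IHu IHv.
rewrite !lfunZ bc_comul_emb; congr (_ *: _).
rewrite -[h in RHS]rho_counit rhoE.
elim/tens_ind: (comul h) => [x y|s t IHs IHt]; last by rewrite emb2D !linearD /= embD IHs IHt.
by rewrite emb2_tens !sliceR_tens bc_counit_emb embZ.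
Qed.

HB.instance Definition _ := hasComul.Build E HE bc_comulA bc_counitl bc_counitr.

Lemma comul_emb h : comul (emb h) = emb2 sigma (comul h).
Proof. exact: bc_comul_emb. Qed.

Lemma counit_emb h : (counit (emb h) : E) = sigma (counit h : K).
Proof. exact: bc_counit_emb. Qed.

Fact bc_comulM (u v : HE) : comul (u * v) = tmul (comul u) (comul v).
Proof.
elim/base_change_ind: u => [a x|u u' IH IH']; last first.
  by rewrite mulrDl !linearD /= IH IH' tmulDl.
elim/base_change_ind: v => [b y|v v' IH IH']; last first.
  by rewrite mulrDr !linearD /= IH IH' tmulDr.
rewrite -scalerAl -scalerAr !lfunZ tmulZl tmulZr -embM !comul_emb comulM.
congr (_ *: (_ *: _)).
elim/tens_ind: (comul x) => [z w|s t IHs IHt]; last first.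
  by rewrite tmulDl !emb2D tmulDl IHs IHt.
elim/tens_ind: (comul y) => [z' w'|s t IHs IHt]; last first.
  by rewrite tmulDr !emb2D tmulDr IHs IHt.
by rewrite tmulE !emb2_tens tmulE !embM.
Qed.

Fact bc_comul1 : comul (1 : HE) = tens (1 : HE) (1 : HE).
Proof. by rewrite -emb1 comul_emb comul1 emb2_tens. Qed.

Fact bc_counitM (u v : HE) : (counit (u * v) : E) = counit u * counit v.
Proof.
elim/base_change_ind: u => [a x|u u' IH IH']; last first.
  by rewrite mulrDl !linearD /= IH IH' mulrDl.
elim/base_change_ind: v => [b y|v v' IH IH']; last first.
  by rewrite mulrDr !linearD /= IH IH' mulrDr.
rewrite -scalerAl -scalerAr !functZ -embM !counit_emb counitM rmorphM.
by rewrite mulrACA !mulrA.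
Qed.

Fact bc_counit1 : counit (1 : HE) = 1.
Proof. by rewrite -emb1 counit_emb counit1 rmorph1. Qed.

Fact bc_antipodel (u : HE) :
  tlift (fun a b : HE => bc_antipode a * b) (comul u) = (counit u : E) *: (1 : HE).
Proof.
have lin_m : (forall v, linear ((fun a b : HE => bc_antipode a * b)^~ v)) /\
     (forall u, linear ((fun a b : HE => bc_antipode a * b) u)).
  split=> z e x y; first by rewrite linearP mulrDl scalerAl.
  by rewrite mulrDr scalerAr.
elim/base_change_ind: u => [a h|u v IHu IHv]; last by rewrite !linearD /= IHu IHv scalerDl.
rewrite !lfunZ comul_emb counit_emb -scalerA; congr (_ *: _).
rewrite -emb1 -embZ -antipodel.
elim/tens_ind: (comul h) => [x y|s t IHs IHt]; last by rewrite emb2D !linearD /= embD IHs IHt.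
rewrite emb2_tens !tlift_tens; first by rewrite bc_antipode_emb embM.
- by move=> z e v w; rewrite linearP mulrDl scalerAl.
- by move=> z e v w; rewrite mulrDr scalerAr.
- by case: lin_m.
- by case: lin_m.
Qed.

Fact bc_antipoder (u : HE) :
  tlift (fun a b : HE => a * bc_antipode b) (comul u) = (counit u : E) *: (1 : HE).
Proof.
have lin_m : (forall v, linear ((fun a b : HE => a * bc_antipode b)^~ v)) /\
     (forall u, linear ((fun a b : HE => a * bc_antipode b) u)).
  split=> z e x y; first by rewrite mulrDl scalerAl.
  by rewrite linearP mulrDr scalerAr.
elim/base_change_ind: u => [a h|u v IHu IHv]; last by rewrite !linearD /= IHu IHv scalerDl.
rewrite !lfunZ comul_emb counit_emb -scalerA; congr (_ *: _).
rewrite -emb1 -embZ -antipoder.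
elim/tens_ind: (comul h) => [x y|s t IHs IHt]; last by rewrite emb2D !linearD /= embD IHs IHt.
rewrite emb2_tens !tlift_tens; first by rewrite bc_antipode_emb embM.
- by move=> z e v w; rewrite mulrDl scalerAl.
- by move=> z e v w; rewrite linearP mulrDr scalerAr.
- by case: lin_m.
- by case: lin_m.
Qed.

HB.instance Definition _ := Coalgebra_isHopf.Build E HE
  bc_comulM bc_comul1 bc_counitM bc_counit1 bc_antipodel bc_antipoder.

Definition bc_hopf : hopfAlgType E := HE.

Lemma antipode_emb h : antipode (emb h) = emb (antipode h).
Proof. exact: bc_antipode_emb. Qed.

End BaseChangeHopf.

(** * Traces computed in dual families *)

Section Trace.
Variables (K : fieldType) (V : vectType K).

(** Cyclicity of the trace, by exchanging two sums. It frees traces from the library basis: group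
    elements, monomials or the image of a basis under [emb] may index them instead. *)
Lemma lftrace_dual (I : finType) (x : I -> V) (phi : I -> 'Hom(V, K^o)) (f : 'End(V)) :
  (forall v, v = \sum_i (phi i v : K) *: x i) -> lftrace f = \sum_i (phi i (f (x i)) : K).
Proof.
move=> dual; rewrite /lftrace /mxtrace.
transitivity (\sum_(i < \dim {:V}) (coordf i (f (vbasis {:V})`_i) : K)).
  by apply: eq_bigr => i _; rewrite mxE /= mxE vecof_delta coordfE.
transitivity (\sum_(i < \dim {:V}) \sum_j (phi j (vbasis {:V})`_i : K) * (coordf i (f (x j)) : K)).
  apply: eq_bigr => i _; rewrite {1}(dual (vbasis {:V})`_i) !linear_sum /=.
  by apply: eq_bigr => j _; rewrite lfunZ functZ.
rewrite exchange_big; apply: eq_bigr => j _ /=.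
rewrite {2}(coordf_sum (f (x j))) linear_sum; apply: eq_bigr => i _ /=.
by rewrite functZ mulrC.
Qed.

Lemma dual_family (I : finType) (x : I -> V) : (forall v, v \in <<codom x>>%VS) ->
  #|I| = \dim {:V} -> exists phi : I -> 'Hom(V, K^o),
    (forall v, v = \sum_i (phi i v : K) *: x i) /\
    (forall i j, phi i (x j) = (i == j)%:R :> K).
Proof.
move=> sp dI; pose X := codom_tuple x.
have bX : basis_of fullv X.
  rewrite basisEdim; apply/andP; split; first by apply/subvP => v _; apply: sp.
  by rewrite size_tuple dI.
have Xi i : X`_(enum_rank i) = x i by rewrite nth_codom enum_rankK.
exists (fun i => linfun (coord X (enum_rank i) : V -> K^o)); split=> [v|i j].
  rewrite {1}(coord_basis bX (memvf v)) (reindex enum_rank) /=; last first.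
    by apply: onW_bij; apply: enum_rank_bij.
  by apply: eq_bigr => i _; rewrite Xi lfunE.
by rewrite lfunE /= -Xi coord_free ?(basis_free bX) // (inj_eq enum_rank_inj) eq_sym.
Qed.

End Trace.

(** * Flags of left coideals *)

Section Flags.
Variables (K : fieldType) (H : hopfAlgType K).
Implicit Types (s : seq H) (r : seq (H * H)) (U W : {vspace H}).

(* A triangular basis for the left coaction, listed from the top down. *)
Fixpoint flag s r : Prop :=
  if r is (u, g) :: r' then
    [/\ g \in s, forall f, lam f u - (f g : K) *: u \in <<unzip1 r'>>%VS & flag s r']
  else True.

Lemma flag_lam_stable s r : flag s r -> lam_stable <<unzip1 r>>%VS.
Proof.
elim: r => [|[u g] r IHr] /=.
  by move=> _ f v; rewrite span_nil memv0 => /eqP ->; rewrite linear0 mem0v.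
move=> [gs ug /IHr rl] f v; rewrite span_cons => /memv_addP[_ /vlineP[a ->] [w wr ->]].
rewrite linearD /= memvD //; last by apply/(subvP (addvSr _ _))/rl.
rewrite lfunZ memvZ // -[lam f u](subrK ((f g : K) *: u)) memvD //.
  by apply/(subvP (addvSr _ _)).
by apply/(subvP (addvSl _ _)); rewrite memvZ // memv_line.
Qed.

Lemma left_pointed_flag s : left_pointed s ->
  exists2 r, flag s r & <<unzip1 r>>%VS = fullv.
Proof.
move=> spl; have : flag s [::] by [].
have [n] := ubnP (\dim {:H} - \dim <<unzip1 ([::] : seq (H * H))>>%VS)%N.
elim: n [::] => // n IHn r ltn fr.
have rl := flag_lam_stable fr.
have [full|nfull] := eqVneq <<unzip1 r>>%VS fullv; first by exists r.
have fl : lam_stable (fullv : {vspace H}) by move=> *; rewrite memvf.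
have [v [g [_ vr gs vg]]] := spl _ _ rl fl (subvf _) nfull.
apply: (IHn ((v, g) :: r)) => //; rewrite -ltnS; apply: leq_trans ltn; rewrite ltnS.
have lt : (\dim <<unzip1 r>>%VS < \dim <<unzip1 ((v, g) :: r)>>%VS)%N.
  rewrite /= span_cons ltn_neqAle dimvS ?addvSr // andbT.
  apply: contra vr => /eqP E.
  have /eqP -> : <<unzip1 r>>%VS == (<[v]> + <<unzip1 r>>)%VS.
    by rewrite eqEdim addvSr E leqnn.
  by apply/(subvP (addvSl _ _))/memv_line.
by rewrite ltn_sub2l // (leq_trans lt) // dimvS ?subvf.
Qed.

(** Among the tails of the flag, take the shortest whose span plus [U] still contains some w in [W]
    outside [U]. Its top label g gives the eigenvalue: the difference [lam f w - f g *: w] stays in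
    [W] and falls into the next tail plus [U], hence into [U]. *)
Lemma flag_left_pointed s r : flag s r -> <<unzip1 r>>%VS = fullv -> left_pointed s.
Proof.
move=> fr full U W Ul Wl UW neU.
have [w wW wU] : exists2 w, w \in W & w \notin U.
  by apply/subvPn; apply: contra neU => WU; rewrite eqEsubv UW WU.
have : w \in (U + <<unzip1 r>>)%VS by rewrite full (subvP (addvSr _ _)) ?memvf.
elim: r {full} fr w wW wU => [|[u g] r IHr] /=.
  by move=> _ w _ wU; rewrite span_nil addv0 (negPf wU).
move=> [gs ug fr] w wW wU wr.
case: (classic (exists w', [/\ w' \in W, w' \notin U & w' \in (U + <<unzip1 r>>)%VS])).
  by case=> w' [w'W w'U w'r]; apply: (IHr fr w').
move=> no; exists w, g; split=> // f; apply: contraT => nU; case: no.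
exists (lam f w - (f g : K) *: w); split=> //; first by rewrite memvB ?memvZ ?Wl.
case/memv_addP: wr => x xU [z]; rewrite span_cons.
case/memv_addP=> _ /vlineP[a ->] [v vr ->] ->.
pose D := (lam f - (f g : K) *: \1)%VF.
have DE h : lam f h - (f g : K) *: h = D h.
  by rewrite add_lfunE opp_lfunE scale_lfunE id_lfunE.
rewrite DE linearD memv_add //=; first by rewrite -DE memvB ?memvZ ?Ul.
rewrite linearD memvD //=; first by rewrite lfunZ memvZ // -DE.
by rewrite -DE memvB ?memvZ ?(flag_lam_stable fr).
Qed.

End Flags.

(** * Transfer of pointedness, indicators and commutativity *)

Section BaseChangeTransfer.
Variables (K E : fieldType) (sigma : {rmorphism K -> E}) (H : hopfAlgType K).
Local Notation HE := (bc_hopf sigma H).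
Local Notation emb := (@emb K E sigma H : H -> HE).

Lemma grouplike_emb (g : H) : grouplike g -> grouplike (emb g).
Proof.
move=> gG; apply/andP; rewrite comul_emb counit_emb grouplike_comul //.
by rewrite grouplike_counit // emb2_tens rmorph1.
Qed.

Lemma embV (g : H) : grouplike g -> emb g^-1 = (emb g)^-1.
Proof.
move=> gG; have gEU := grouplike_unit (grouplike_emb gG).
by apply: (mulrI gEU); rewrite -embM !mulrV ?emb1 // grouplike_unit.
Qed.

Lemma lam_emb (f : 'Hom(HE, E^o)) (h : H) :
  lam f (emb h) = \sum_(i < \dim {:H}) (f (emb (vbasis {:H})`_i) : E) *: emb (lam (coordf i) h).
Proof.
rewrite lamE comul_emb /emb2 linear_sum; apply: eq_bigr => i _ /=.
by rewrite sliceL_tens -lamE.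
Qed.

Lemma emb_span (X : seq H) h : h \in <<X>>%VS -> emb h \in <<map emb X>>%VS.
Proof.
move=> hX; rewrite (coord_span (X := in_tuple X) hX) emb_sum memv_suml // => i _.
by rewrite embZ memvZ // memv_span // map_f // mem_nth.
Qed.

Lemma flag_emb (s : seq H) (r : seq (H * H)) : flag s r ->
  flag (map emb s) [seq (emb ug.1, emb ug.2) | ug <- r].
Proof.
elim: r => [|[u g] r IHr] //= [gs ug /IHr fr]; split=> //; first exact: map_f.
move=> f; have -> : unzip1 [seq (emb ug.1, emb ug.2) | ug <- r] = map emb (unzip1 r).
  by rewrite /unzip1 -!map_comp.
have -> : lam f (emb u) - (f (emb g) : E) *: emb u = \sum_(i < \dim {:H})
    (f (emb (vbasis {:H})`_i) : E) *: emb (lam (coordf i) u - (coordf i g : K) *: u).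
  have -> : (f (emb g) : E) = \sum_(i < \dim {:H})
      (f (emb (vbasis {:H})`_i) : E) * sigma (coordf i g : K).
    rewrite {1}(coordf_sum g) emb_sum linear_sum; apply: eq_bigr => i _ /=.
    by rewrite embZ functZ mulrC.
  rewrite lam_emb scaler_suml -sumrB; apply: eq_bigr => i _.
  by rewrite embD embN embZ scalerBr scalerA.
by rewrite memv_suml // => i _; rewrite memvZ // emb_span.
Qed.

(** The relations of a flag are linear and extend to the larger field, whereas a subcoalgebra over
    [E] need not come from one of [H]; this is the reason for the detour through flags. *)
Lemma left_pointed_emb (s : seq H) : left_pointed s -> left_pointed (map emb s).
Proof.
move=> /left_pointed_flag[r fr full]; apply: (flag_left_pointed (flag_emb fr)).
have -> : unzip1 [seq (emb ug.1, emb ug.2) | ug <- r] = map emb (unzip1 r).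
  by rewrite /unzip1 -!map_comp.
apply/eqP; rewrite eqEsubv subvf; apply/subvP => u _; rewrite (base_change_sum u) memv_suml // => i _.
by rewrite memvZ // emb_span // full memvf.
Qed.

Lemma sweedler_emb n (h : H) : sweedler HE n (emb h) = emb (sweedler H n h).
Proof.
elim: n h => [|n IHn] h.
  by rewrite !sweedler0 counit_emb embZ emb1.
rewrite !sweedlerS !convE comul_emb.
elim/tens_ind: (comul h) => [x y|s t IHs IHt]; last by rewrite emb2D !linearD /= embD IHs IHt.
by rewrite emb2_tens !convt_tens IHn !id_lfunE embM.
Qed.

Lemma indicator_emb n : indicator HE n = sigma (indicator H n).
Proof.
pose x (i : 'I_(\dim {:H})) := (vbasis {:H})`_i.
rewrite /indicator (@lftrace_dual _ _ _ x (fun i => coordf i)); last exact: coordf_sum.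
pose phi (i : 'I_(\dim {:H})) : 'Hom(HE, E^o) := bc_ext sigma (fun h => sigma (coordf i h : K) : E^o).
have phiE i h : (phi i (emb h) : E) = sigma (coordf i h : K).
  rewrite /phi bc_ext_emb // => *; first by rewrite linearD rmorphD.
  by rewrite functZ rmorphM.
rewrite (@lftrace_dual _ _ _ (fun i => emb (x i)) phi).
  rewrite rmorph_sum; apply: eq_bigr => i _.
  by rewrite !comp_lfunE sweedler_emb antipode_emb phiE.
move=> v; elim/(@base_change_ind _ _ sigma H): v => [a h|u v IHu IHv].
  rewrite {1}(coordf_sum h) emb_sum scaler_sumr; apply: eq_bigr => i _.
  by rewrite embZ functZ phiE scalerA.
rewrite {1}IHu {1}IHv -big_split; apply: eq_bigr => i _.
by rewrite linearD scalerDl.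
Qed.

Lemma commutative_emb : commutative_alg HE <-> commutative_alg H.
Proof.
split=> cH x y; first by apply: (@emb_inj _ _ sigma); rewrite !embM cH.
elim/(@base_change_ind _ _ sigma H): x => [a x|u v IHu IHv]; last by rewrite mulrDl mulrDr IHu IHv.
elim/(@base_change_ind _ _ sigma H): y => [b y|u v IHu IHv]; last by rewrite mulrDl mulrDr IHu IHv.
by rewrite -!scalerAl -!scalerAr -!embM cH !scalerA mulrC.
Qed.

End BaseChangeTransfer.

(** * Eigenvectors after extension of scalars *)

Lemma exists_irreducible_factor (K : fieldType) (p : {poly K}) : (1 < size p)%N ->
  exists2 q : {poly K}, irreducible_poly q & q %| p.
Proof.
have [n] := ubnP (size p); elim: n p => // n IHn p ltn p1.
case: (classic (irreducible_poly p)) => [pi|npi]; first by exists p; rewrite ?dvdpp.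
have p0 : p != 0 by rewrite -size_poly_gt0 ltnW.
case: (classic (exists q : {poly K}, [/\ size q != 1%N, q %| p & ~~ (q %= p)])) => [[q [q1 qp nqp]]|no].
  have q0 : q != 0 by apply: contraNneq p0 => q0; move: qp; rewrite q0 dvd0p.
  have ltq : (size q < size p)%N.
    by rewrite ltn_neqAle dvdp_leq // andbT; apply: contra nqp => /eqP s; rewrite -dvdp_size_eqp // s.
  have [||r ri rq] := IHn q; last by exists r => //; apply: dvdp_trans qp.
    by rewrite -ltnS (leq_trans _ ltn).
  by rewrite ltn_neqAle eq_sym q1 size_poly_gt0.
case: npi; split=> // q q1 qp; apply: contraT => nqp.
by case: no; exists q.
Qed.

Lemma exists_root_extension (K : fieldType) (p : {poly K}) : (1 < size p)%N ->
  exists (E : fieldType) (sigma : {rmorphism K -> E}) (z : E), root (map_poly sigma p) z.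
Proof.
move=> /exists_irreducible_factor[q qi qp].
have [L _ [z qz _]] := irredp_FAdjoin qi.
exists L, (in_alg L), z; rewrite -dvdp_XsubCl; rewrite -dvdp_XsubCl in qz.
by apply: dvdp_trans qz _; rewrite dvdp_map.
Qed.

Section Eigenvector.
Variables (K : fieldType) (V : vectType K) (T : 'End(V)) (U : {vspace V}) (y : V).
Hypothesis yU : y \notin U.

Let W n : {vspace V} := (U + \sum_(i < n) <[iter i T y]>)%VS.

Let WP n v : reflect (exists2 q : nat -> K,
  v - \sum_(i < n) q i *: iter i T y \in U & True) (v \in W n).
Proof.
apply: (iffP memv_addP) => [[u uU [w /memv_sumP[x xl ->] ->]]|[q qU _]].
  have /fin_all_exists[c cE] (i : 'I_n) : exists c, x i = c *: iter i T y.
    by have /vlineP[c ->] := xl i isT; exists c.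
  exists (fun i => oapp c 0 (insub i)) => //; rewrite -addrA -sumrB big1 ?addr0 // => i _.
  by rewrite valK /= cE subrr.
exists (v - \sum_(i < n) q i *: iter i T y) => //.
exists (\sum_(i < n) q i *: iter i T y); last by rewrite subrK.
by apply: memv_sumr => i _; apply: memvZ; apply: memv_line.
Qed.

(** Let [mu] be the monic polynomial of least degree [a] with mu(T) y in [U], [theta] a root of it
    in an extension, and [nu] the quotient of [mu] by X - theta. Then v = nu(T) y is not in the
    extended [U], having degree a - 1, while (T - theta) v = mu(T) y is. The extension of [T] is not
    formed; its value at v is written out with [iter i.+1 T y]. *)
Lemma exists_eigenvector_extension :
  exists (E : fieldType) (sigma : {rmorphism K -> E}) (theta : E) (n : nat) (c : 'I_n -> E),
    let UE := <<map (@emb K E sigma V) (vbasis U)>>%VS in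
    let v := \sum_(i < n) c i *: emb sigma (iter i T y) in
    v \notin UE /\ \sum_(i < n) c i *: emb sigma (iter i.+1 T y) - theta *: v \in UE.
Proof.
have exa : exists a, iter a T y \in W a.
  apply: NNPP => no.
  have dW n : (n <= \dim (W n))%N.
    elim: n => // n IHn; apply: leq_ltn_trans IHn _.
    have sub : (W n <= W n.+1)%VS by rewrite /W big_ord_recr addvA addvSl.
    rewrite ltn_neqAle dimvS // andbT; apply/negP => /eqP E; apply: no; exists n.
    have /eqP -> : W n == W n.+1 by rewrite eqEdim sub E leqnn.
    by rewrite /W big_ord_recr addvA; apply: (subvP (addvSr _ _)); apply: memv_line.
  have := leq_trans (dW (\dim {:V}).+1) (dimvS (subvf _)).
  by rewrite ltnn.
case: (ex_minnP exa) => a ya mina.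
have a0 : (0 < a)%N.
  rewrite lt0n; apply: contra yU => /eqP a0; move: ya; rewrite a0 /W big_ord0 addv0.
  by [].
have /WP[q qU _] := ya.
pose mu : {poly K} := 'X^a - \poly_(i < a) q i.
have smu : size mu = a.+1.
  by rewrite /mu size_polyDl size_polyXn // size_polyN ltnS size_poly.
have [|E [sigma [theta rt]]] := @exists_root_extension K mu; first by rewrite smu.
have [nu nuE] := factor_theorem _ _ rt.
have snu : size nu = a.
  have nu0 : nu != 0.
    apply/eqP => nu0; move: nuE; rewrite nu0 mul0r => /(congr1 (fun r => size (r : {poly E}))).
    by rewrite size_map_poly size_poly0 smu.
  have := congr1 (fun r => size (r : {poly E})) nuE.
  rewrite size_map_poly smu size_Mmonic ?monicXsubC // size_XsubC addn2 /=.
  by case.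
exists E, sigma, theta, a, (fun i => nu`_i) => UE v.
have embU x : x \in U -> emb sigma x \in UE.
  move=> xU; rewrite (coord_vbasis xU) emb_sum memv_suml // => i _.
  by rewrite embZ memvZ // memv_span // map_f // mem_nth ?size_tuple.
split.
  have nW : iter a.-1 T y \notin W a.-1.
    by apply/negP => /mina; rewrite leqNgt prednK ?leqnn.
  (* [psi] reads off the coefficient of T^(a-1) y; at v this is the leading coefficient of [nu],
     which is nonzero. *)
  have [psi psiW psiy] := separating_functional nW.
  pose psiE := bc_ext sigma (fun h => sigma (psi h : K) : E^o).
  have psiEE h : (psiE (emb sigma h) : E) = sigma (psi h : K).
    rewrite /psiE bc_ext_emb // => *; first by rewrite linearD rmorphD.
    by rewrite functZ rmorphM.
  have psi_lt i : (i < a.-1)%N -> psi (iter i T y) = 0.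
    move=> lt; apply: psiW; apply: (subvP (addvSr _ _)).
    by rewrite (bigD1 (Ordinal lt)) //=; apply: (subvP (addvSl _ _)); apply: memv_line.
  have psiv : (psiE v : E) = nu`_a.-1.
    have lta : (a.-1 < a)%N by rewrite ltn_predL.
    rewrite /v linear_sum (bigD1 (Ordinal lta)) //=.
    rewrite functZ psiEE psiy rmorph1 mulr1 big1 ?addr0 // => i ia.
    rewrite functZ psiEE psi_lt ?rmorph0 ?mulr0 //.
    by rewrite ltn_neqAle -ltnS prednK // ltn_ord andbT.
  apply/negP => vUE; have : (psiE v : E) = 0.
    have /subvP/(_ _ vUE) : (UE <= lker psiE)%VS; last by rewrite memv_ker => /eqP.
    apply/span_subvP => _ /mapP[x xU ->].
    rewrite memv_ker; apply/eqP; rewrite psiEE psiW ?rmorph0 //.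
    by apply: (subvP (addvSl _ _)); apply: vbasis_mem.
  rewrite psiv => /eqP; rewrite -snu -lead_coefE lead_coef_eq0 -size_poly_eq0 snu.
  by rewrite -leqn0 leqNgt a0.
suff -> : \sum_(i < a) nu`_i *: emb sigma (iter i.+1 T y) - theta *: v =
    emb sigma (iter a T y - \sum_(i < a) q i *: iter i T y) by apply: embU.
have -> : iter a T y - \sum_(i < a) q i *: iter i T y = \sum_(i < a.+1) mu`_i *: iter i T y.
  rewrite big_ord_recr /= [RHS]addrC; congr (_ + _).
    by rewrite coefB coefXn coef_poly ltnn eqxx subr0 scale1r.
  rewrite -sumrN; apply: eq_bigr => i _; rewrite coefB coefXn coef_poly ltn_ord.
  by rewrite (ltn_eqF (ltn_ord i)) sub0r scaleNr.
rewrite emb_sum.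
(* Coefficientwise, mu_i = nu_(i-1) - theta nu_i; the boundary terms nu_(-1) and nu_a are 0. *)
under [RHS]eq_bigr => i _ do
  rewrite embZ -coef_map nuE mulrBr coefB coefMX coefMC scalerBl.
rewrite sumrB big_ord_recl /= scale0r add0r; congr (_ - _).
rewrite big_ord_recr /= nth_default ?snu // mul0r scale0r addr0 /v scaler_sumr.
by apply: eq_bigr => i _; rewrite scalerA mulrC.
Qed.

End Eigenvector.

(** * Group algebras *)

Section GroupOfGrouplikes.
Variables (K : fieldType) (H : hopfAlgType K) (s : seq H).
Hypothesis us : uniq s.
Hypothesis sG : forall g, (g \in s) = grouplike g.

Lemma grouplike_group : exists (gT : finGroupType) (e : gT -> H),
  [/\ injective e, #|gT| = size s, {morph e : x y / (x * y)%g >-> x * y},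
      forall x, grouplike (e x) & forall g, grouplike g -> exists x, g = e x].
Proof.
pose T : finType := seq_sub s.
have valG (x : T) : grouplike (ssval x) by rewrite -sG ssvalP.
have mulG (x y : T) : ssval x * ssval y \in s by rewrite sG grouplikeM.
have oneG : 1 \in s by rewrite sG grouplike1.
have invG (x : T) : (ssval x)^-1 \in s by rewrite sG grouplikeV.
pose mul (x y : T) : T := SeqSub (mulG x y).
pose one : T := SeqSub oneG.
pose inv (x : T) : T := SeqSub (invG x).
have mA : associative mul by move=> x y z; apply: val_inj; rewrite /= mulrA.
have m1 : left_id one mul by move=> x; apply: val_inj; rewrite /= mul1r.
have mV : left_inverse one inv mul.
  by move=> x; apply: val_inj; rewrite /= mulVr // grouplike_unit.
pose gT : finGroupType := HB.pack (seq_sub s) (Finite_isGroup.Build T mA m1 mV).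
exists gT, (fun x : gT => ssval (x : seq_sub s)); split.
- exact: val_inj.
- by rewrite -(card_seq_sub us).
- by [].
- exact: valG.
- by move=> g; rewrite -sG => gs; exists (SeqSub gs).
Qed.

End GroupOfGrouplikes.

Section GrouplikeEmbedding.
Variables (K : fieldType) (H : hopfAlgType K) (gT : finGroupType) (e : gT -> H).
Hypothesis eM : {morph e : x y / (x * y)%g >-> x * y}.
Hypothesis eG : forall x, grouplike (e x).

Lemma grouplike_morph1 : e 1%g = 1.
Proof.
have eU := grouplike_unit (eG 1%g).
by apply: (mulrI eU); rewrite -eM mulg1 mulr1.
Qed.

Lemma grouplike_morphX x n : e (x ^+ n)%g = e x ^+ n.
Proof.
elim: n => [|n IHn]; first by rewrite expg0 expr0 grouplike_morph1.
by rewrite expgS exprS eM IHn.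
Qed.

Lemma grouplike_morphV x : e (x^-1)%g = (e x)^-1.
Proof.
have eU := grouplike_unit (eG x).
by apply: (mulrI eU); rewrite -eM mulgV mulrV // grouplike_morph1.
Qed.

End GrouplikeEmbedding.

Section GroupAlgebra.
Variables (K : fieldType) (H : hopfAlgType K).

Lemma sweedler_grouplike n (g : H) : grouplike g -> sweedler H n g = g ^+ n.
Proof.
move=> gG; elim: n => [|n IHn].
  by rewrite sweedler0 grouplike_counit // scale1r expr0.
by rewrite sweedlerS convE grouplike_comul // convt_tens IHn id_lfunE exprSr.
Qed.

Variables (gT : finGroupType) (e : gT -> H).
Hypothesis e_inj : injective e.
Hypothesis eM : {morph e : x y / (x * y)%g >-> x * y}.
Hypothesis eG : forall x, grouplike (e x).
Hypothesis cardT : #|gT| = \dim {:H}.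

Let e_span v : v \in <<codom e>>%VS.
Proof.
suff -> : <<codom e>>%VS = fullv by rewrite memvf.
apply/eqP; rewrite eqEdim subvf /= -cardT -(size_codom e).
have fe : free (codom e).
  apply: grouplike_free; first by rewrite map_inj_uniq ?enum_uniq.
  by apply/allP => _ /codomP[x ->].
by have := fe; rewrite /free => /eqP ->.
Qed.

(** On a group-like g the operator S P_(n-1) takes the value g^(1-n), so it permutes no basis vector
    onto itself unless g^n = 1: the trace counts these g. *)
Lemma group_indicator n : (0 < n)%N ->
  indicator H n = #|[set x : gT | (x ^+ n == 1)%g]|%:R.
Proof.
move=> n0; have [phi [phid phie]] := dual_family e_span cardT.
rewrite /indicator (lftrace_dual _ phid) -sum1_card natr_sum.
rewrite [RHS]big_mkcond /=; apply: eq_bigr => x _.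
rewrite comp_lfunE sweedler_grouplike // antipode_grouplike; last exact: grouplikeX.
rewrite -grouplike_morphX // -grouplike_morphV // phie inE.
have -> : (x == (x ^+ n.-1)^-1)%g = (x ^+ n == 1)%g.
  by rewrite eq_mulgV1 invgK -expgS prednK.
by case: ifP.
Qed.

Lemma group_commutative : commutative_alg H <-> abelian [set: gT].
Proof.
split=> [cH|/centsP ab x y].
  apply/centsP => x _ y _; apply: e_inj; by rewrite !eM cH.
rewrite (coord_span (X := codom_tuple e) (e_span x)) mulr_suml mulr_sumr.
apply: eq_bigr => i _; rewrite -scalerAl -scalerAr; congr (_ *: _).
rewrite (coord_span (X := codom_tuple e) (e_span y)) mulr_suml mulr_sumr.
apply: eq_bigr => j _; rewrite -scalerAl -scalerAr; congr (_ *: _).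
by rewrite !nth_codom -!eM ab.
Qed.

Lemma group_cocommutative : cocommutative H.
Proof.
move=> h; rewrite (coord_span (X := codom_tuple e) (e_span h)) !linear_sum.
apply: eq_bigr => i _ /=; rewrite !lfunZ nth_codom grouplike_comul // tswapE.
by [].
Qed.

End GroupAlgebra.

(** * Cyclic groups of group-likes *)

Section SpanBaseChange.
Variables (K E : fieldType) (sigma : {rmorphism K -> E}) (H : hopfAlgType K).
Local Notation HE := (bc_hopf sigma H).
Local Notation emb := (@emb K E sigma H : H -> HE).

Lemma span_emb_vbasis (X : seq H) :
  <<map emb (vbasis <<X>>)>>%VS = <<map emb X>>%VS.
Proof.
apply/eqP; rewrite eqEsubv; apply/andP; split; apply/span_subvP => _ /mapP[x xX ->].
  by apply: emb_span; apply: vbasis_mem.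
by apply: emb_span; rewrite (span_basis (vbasisP _)) memv_span.
Qed.

Lemma closed_grouplikes_emb (s : seq H) : closed_grouplikes s -> closed_grouplikes (map emb s).
Proof.
move=> [sG s1 sM sV]; split=> [_ /mapP[g gs ->]||_ _ /mapP[g gs ->] /mapP[h hs ->]|_ /mapP[g gs ->]].
- by apply: grouplike_emb; apply: sG.
- by rewrite -(emb1 sigma) map_f.
- by rewrite -embM map_f ?sM.
- by rewrite -embV ?sG // map_f ?sV.
Qed.

End SpanBaseChange.

Section CyclicGrouplikes.
Variables (K : fieldType) (H : hopfAlgType K) (s : seq H).
Hypothesis us : uniq s.
Hypothesis sG : forall g, (g \in s) = grouplike g.
Hypothesis spl : left_pointed s.
Hypothesis spr : right_pointed s.
Variables (x : H) (r : nat).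
Hypothesis xG : grouplike x.
Hypothesis xr : x ^+ r = 1.
Hypothesis xgen : forall g : H, grouplike g -> exists i, g = x ^+ i.
Hypothesis nS : <<s>>%VS != fullv.

(** [T] is conjugation by [x]. The group-like g of the skew-primitive y is a power of [x], hence
    fixed by [T], so all iterates of y, and any combination of them over [E], are skew-primitive for
    the same g. *)
Lemma exists_skew_eigenvector :
  exists (E : fieldType) (sigma : {rmorphism K -> E}) (theta : E) (i : nat)
      (v : bc_hopf sigma H),
    let xE : bc_hopf sigma H := emb sigma x in
    let L := <<map (@emb _ _ sigma H : H -> bc_hopf sigma H) s>>%VS in
    [/\ v \notin L, comul v = tens v 1 + tens (xE ^+ i) v,
      xE * v - theta *: (v * xE) \in L & theta ^+ r = 1].
Proof.
have [y [g [yS gG dy]]] := exists_exact_skew_primitive sG spl spr us nS.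
have [i gx] := xgen gG.
have xU := grouplike_unit xG; have xVG := grouplikeV xG.
pose T : 'End(H) := (amulr (x^-1)%R \o amull x)%VF.
have TE h : T h = x * h * x^-1 by rewrite comp_lfunE !lfunE.
have gcomm : x * g * x^-1 = g by rewrite gx -exprS exprSr mulrK.
have dT n : comul (iter n T y) = tens (iter n T y) 1 + tens g (iter n T y).
  elim: n => [|n IHn] //; rewrite iterS TE !comulM IHn (grouplike_comul xG) (grouplike_comul xVG).
  by rewrite tmulDr tmulDl !tmulE mulr1 mulrV // -[in RHS]gcomm.
have TX n h : iter n T h = x ^+ n * h * (x^-1) ^+ n.
  elim: n => [|n IHn]; first by rewrite !expr0 mul1r mulr1.
  by rewrite iterS IHn TE exprS exprSr !mulrA.
have Tr h : iter r T h = h by rewrite TX exprVn xr invr1 mul1r mulr1.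
have [E [sigma [theta [n [c]]]]] := exists_eigenvector_extension T yS.
rewrite span_emb_vbasis.
set v0 := \sum_(j < n) _; set L := <<_>>%VS; set w0 := \sum_(j < n) _ => -[vL wL].
pose HE := bc_hopf sigma H.
pose xE : HE := emb sigma x; pose v : HE := v0.
have eM (a b : H) : (emb sigma (a * b) : HE) = (emb sigma a : HE) * emb sigma b by exact: embM.
have xEG : grouplike xE by apply: grouplike_emb.
have xEU := grouplike_unit xEG.
have xEV : (emb sigma x^-1 : HE) = xE^-1.
  by apply: (mulrI xEU); rewrite -eM !mulrV // emb1.
have xEX j : (emb sigma (x ^+ j) : HE) = xE ^+ j.
  by elim: j => [|j IHj]; rewrite ?expr0 ?emb1 // !exprS eM IHj.
have w0E : (w0 : HE) = xE * v * xE^-1.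
  rewrite /w0 /v /v0 mulr_sumr mulr_suml; apply: eq_bigr => j _.
  by rewrite iterS TE !eM xEV -scalerAr -scalerAl.
have xEL : xE \in (L : {vspace HE}) by rewrite memv_span // map_f // sG.
have sC : closed_grouplikes s.
  split=> [h||h h'|h]; rewrite ?sG //; [exact: grouplike1 | exact: grouplikeM | exact: grouplikeV].
have LM : stabilizes (L : {vspace HE}) L by apply/span_stabilizes/closed_grouplikes_emb.
have xEVL : xE^-1 \in (L : {vspace HE}).
  by rewrite -xEV memv_span // map_f // sG grouplikeV.
pose TH h := xE * h * xE^-1.
have wL' : TH v - theta *: v \in (L : {vspace HE}) by rewrite /TH -w0E.
have THL a : a \in (L : {vspace HE}) -> TH a \in (L : {vspace HE}).
  by move=> aL; rewrite /TH !LM.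
have THB a b : TH (a - b) = TH a - TH b by rewrite /TH mulrBr mulrBl.
have THZ a b : TH (a *: b) = a *: TH b by rewrite /TH -scalerAr -scalerAl.
have THX j : iter j TH v - theta ^+ j *: v \in (L : {vspace HE}).
  elim: j => [|j IHj]; first by rewrite expr0 scale1r subrr mem0v.
  rewrite iterS -(subrK (TH (theta ^+ j *: v)) (TH _)) -THB -addrA memvD ?THL //.
  by rewrite THZ exprSr -scalerA -scalerBr memvZ.
have THE j h : iter j TH h = xE ^+ j * h * (xE^-1) ^+ j.
  elim: j => [|j IHj]; first by rewrite !expr0 mul1r mulr1.
  by rewrite iterS IHj /TH exprS exprSr !mulrA.
have xEr : xE ^+ r = 1 by rewrite -xEX xr emb1.
exists E, sigma, theta, i, v; split=> //.
- rewrite /v /v0 linear_sum.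
  have -> : tens (\sum_(j < n) c j *: (emb sigma (iter j T y) : HE)) (1 : HE) =
      \sum_(j < n) c j *: tens (emb sigma (iter j T y) : HE) (1 : HE).
    by rewrite tens_suml; apply: eq_bigr => j _; rewrite tensZl.
  rewrite tens_sumr -big_split; apply: eq_bigr => j _ /=.
  rewrite lfunZ comul_emb dT emb2D !emb2_tens tensZr -scalerDr emb1.
  by rewrite gx xEX.
- by have := LM _ _ wL' xEL; rewrite mulrBl /TH mulrVK // -scalerAl.
(* The r-th power of the conjugation is the identity, so (1 - theta^r) v lies in [L] although v does
   not. *)
have := THX r; rewrite THE exprVn xEr invr1 mul1r mulr1 -{1}[v]scale1r -scalerBl => tv.
apply/eqP; rewrite eq_sym -subr_eq0; apply: contraT => t1.
by case/negP: vL; rewrite -/v -[v]scale1r -(mulVf t1) -scalerA memvZ.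
Qed.

End CyclicGrouplikes.

Section CyclicAdjunction.
Variables (K : fieldType) (H : hopfAlgType K) (s : seq H).
Hypothesis sC : closed_grouplikes s.
Hypothesis spl : left_pointed s.
Variables (x v : H) (theta : K) (i : nat).
Hypothesis xs : x \in s.
Hypothesis sx : forall g, g \in s -> exists j, g = x ^+ j.
Hypothesis theta0 : theta != 0.
Hypothesis vS : v \notin <<s>>%VS.
Hypothesis dv : comul v = tens v 1 + tens (x ^+ i) v.
Hypothesis xv : x * v - theta *: (v * x) \in <<s>>%VS.

Let L := <<s>>%VS.
Let LL := span_stabilizes sC.

Let xXs j : x ^+ j \in s.
Proof. by elim: j => [|j IHj]; rewrite ?expr0 ?(cg_one sC) // exprS (cg_mul sC). Qed.

Lemma skew_commute j : v * x ^+ j - theta^-1 ^+ j *: (x ^+ j * v) \in L.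
Proof.
have L1 a : a \in s -> a \in L by move=> aS; apply: memv_span.
have vx : v * x - theta^-1 *: (x * v) \in L.
  rewrite -[v * x]scale1r -(mulVf theta0) -scalerA -scalerBr memvZ //.
  by rewrite -memvN opprB.
elim: j => [|j IHj]; first by rewrite !expr0 mulr1 mul1r scale1r subrr mem0v.
rewrite exprSr mulrA -(subrK (theta^-1 ^+ j *: (x ^+ j * v) * x) (v * x ^+ j * x)).
rewrite -mulrBl -addrA memvD //; first by apply: LL => //; apply: L1.
rewrite exprSr -scalerA -scalerAl -scalerBr memvZ //.
by rewrite -!mulrA scalerAr -mulrBr LL // L1.
Qed.

(** [adjunction] with c = 0 and g = x^i. Modulo the group algebra, moving v to the right past one
    [x] costs theta^(-1), whence z = theta^(-i). *)
Lemma cyclic_adjunction : exists m, [/\ (1 < m)%N, \sum_(j < m) (theta^-1 ^+ i) ^+ j = 0,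
  coideal_subalg s (powers L v m), \dim (powers L v m) = (m * \dim L)%N &
  forall j, (j < m)%N -> v ^+ j \notin powers L v j] /\ v ^+ m \in powers L v m.
Proof.
have xiG : grouplike (x ^+ i) by apply: (cg_grouplike sC).
apply: (@adjunction _ _ s (cg_grouplike sC) spl L (span_coideal_subalg sC)
  (span_rho_stable sC) v (x ^+ i) 0 _ vS xiG).
- exact: memv_span.
- by apply: memv_span; apply: (cg_inv sC).
- exact: mem0v.
- by rewrite addr0.
- move=> a aL; rewrite (coord_span (X := in_tuple s) aL).
  elim/big_ind: _ => [|a1 a2 [b1 [d1 [b1L d1L E1]]] [b2 [d2 [b2L d2L E2]]]|j _].
  + by exists 0, 0; rewrite mem0v mulr0 mul0r addr0.
  + exists (b1 + b2), (d1 + d2); rewrite !memvD //; split=> //.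
    by rewrite mulrDr E1 E2 mulrDl addrACA.
  have gs : (in_tuple s)`_j \in s by rewrite mem_nth.
  have [n ->] := sx gs; set c := coord _ _ _.
  exists (c *: (theta^-1 ^+ n *: x ^+ n)), (c *: (v * x ^+ n - theta^-1 ^+ n *: (x ^+ n * v))).
  split; first by rewrite !memvZ ?memv_span.
    by rewrite memvZ ?skew_commute.
  by rewrite -scalerAr -!scalerAl -scalerDr addrC subrK.
- exact: skew_commute.
Qed.

End CyclicAdjunction.

(** * Arithmetic in characteristic p *)

Section ModP.
Variables (K : fieldType) (p : nat).
Hypothesis pK : p \in [pchar K].

Lemma pchar_unity (z : K) : z ^+ p = 1 -> z = 1.
Proof.
have p_pr := pcharf_prime pK.
move=> zp; apply/eqP; rewrite -subr_eq0.
have : (z - 1) ^+ p == 0.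
  by rewrite -!(pFrobenius_autE pK) rmorphB rmorph1 /= pFrobenius_autE zp subrr.
by rewrite expf_eq0 => /andP[].
Qed.

Lemma sum_one_pchar m : \sum_(j < m) (1 : K) ^+ j = 0 -> (p %| m)%N.
Proof.
under eq_bigr => j _ do rewrite expr1n.
by rewrite sumr_const card_ord => /eqP; rewrite -(dvdn_pcharf pK).
Qed.

Lemma pchar_rmorph (E : fieldType) (sigma : {rmorphism K -> E}) : p \in [pchar E].
Proof. by rewrite (fmorph_pchar sigma). Qed.

End ModP.

Lemma not_p2_dvd (p q m : nat) : prime p -> prime q -> q != p -> (p %| m)%N ->
  (m * p %| p * q)%N -> False.
Proof.
move=> p_pr q_pr neq pm; rewrite mulnC dvdn_pmul2l ?prime_gt0 // => mq.
have : (p %| q)%N by apply: dvdn_trans mq.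
by rewrite dvdn_prime2 // eq_sym (negPf neq).
Qed.

(** * Excluding a group of p group-likes *)

Section OrderP.
Variables (p q : nat) (K : fieldType) (H : hopfAlgType K) (s : seq H).
Hypotheses (p_pr : prime p) (q_pr : prime q) (neq_qp : q != p) (pK : p \in [pchar K]).
Hypothesis dimH : \dim {:H} = (p * q)%N.
Hypothesis us : uniq s.
Hypothesis sG : forall g, (g \in s) = grouplike g.
Hypothesis spl : left_pointed s.
Hypothesis spr : right_pointed s.

Let sC := grouplikes_closed sG.

Lemma dim_span_grouplikes : \dim <<s>>%VS = size s.
Proof.
have := grouplike_free us (introT allP (fun g gs => etrans (esym (sG g)) gs)).
by rewrite /free => /eqP.
Qed.

Lemma dim_span_emb_grouplikes (E : fieldType) (sigma : {rmorphism K -> E}) :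
  \dim <<map (@emb _ _ sigma H : H -> bc_hopf sigma H) s>>%VS = size s.
Proof.
rewrite -(size_map (@emb _ _ sigma H : H -> bc_hopf sigma H) s).
apply/eqP; apply: grouplike_free; first by rewrite map_inj_uniq //; exact: emb_inj.
by apply/allP => g /(cg_grouplike (closed_grouplikes_emb sigma sC)).
Qed.

Lemma prime_grouplikes_generator r : prime r -> size s = r ->
  exists x, [/\ grouplike x, x ^+ r = 1, forall g : H, grouplike g -> exists i, g = x ^+ i &
    forall i, x ^+ i = 1 -> (r %| i)%N].
Proof.
move=> r_pr sr; have [gT [e [e_inj cT eM eG ge]]] := grouplike_group us sG.
have [y oy yg] := prime_order_generator r_pr (etrans cT sr).
exists (e y); split=> //.
- rewrite -grouplike_morphX // -oy expg_order; exact: grouplike_morph1.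
- move=> g /ge[z ->]; have [i ->] := yg z; exists i; exact: grouplike_morphX.
- move=> i; rewrite -grouplike_morphX // -(grouplike_morph1 eM eG) => /e_inj/eqP.
  by rewrite -order_dvdn oy.
Qed.

Lemma size_grouplikes_neq_p : size s <> p.
Proof.
move=> sp; have [x [xG xp xgen _]] := prime_grouplikes_generator p_pr sp.
have nS : <<s>>%VS != fullv.
  apply/eqP => S; have := dim_span_grouplikes; rewrite S dimH sp => /eqP.
  by rewrite -{2}[p]muln1 eqn_pmul2l ?prime_gt0 // => /eqP q1; move: q_pr; rewrite q1.
have [E [sigma [theta [i [v [vL dv xv tp]]]]]] :=
  exists_skew_eigenvector us sG spl spr xG xp xgen nS.
have pE := pchar_rmorph pK sigma.
have t1 := pchar_unity pE tp.
have sxE : forall g, g \in map (@emb _ _ sigma H : H -> bc_hopf sigma H) s -> exists j, g = (emb sigma x : bc_hopf sigma H) ^+ j.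
  move=> _ /mapP[g gs ->]; have [j ->] := xgen g (etrans (esym (sG g)) gs).
  exists j; elim: j => [|j IHj]; rewrite ?expr0 ?emb1 // !exprS.
  by rewrite -IHj -[RHS]embM.
have xs : (emb sigma x : bc_hopf sigma H) \in map (@emb _ _ sigma H : H -> bc_hopf sigma H) s.
  by rewrite map_f // sG.
have [|m [[m1 m0 mc md _] _]] := @cyclic_adjunction _ _ _ (closed_grouplikes_emb sigma sC)
  (left_pointed_emb (sigma := sigma) spl) _ v theta i xs sxE _ vL dv xv.
  by rewrite t1 oner_neq0.
move: m0; rewrite t1 invr1 expr1n => /(sum_one_pchar pE) pm.
have := coideal_subalg_dim (cg_grouplike (closed_grouplikes_emb sigma sC)) (left_pointed_emb (sigma := sigma) spl) mc.
rewrite md dim_base_change dimH.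
rewrite dim_span_emb_grouplikes sp.
exact: not_p2_dvd.
Qed.

End OrderP.

(** * Hopf algebras without non-trivial group-likes *)

Section TensorRing.
Variables (K : fieldType) (A B : falgType K).

(* An alias of [tensor A B] on which [tmul] is a ring product, so that the
   binomial formula for commuting elements applies. *)
Definition tensor_ring : Type := tensor A B.
HB.instance Definition _ := GRing.Zmodule.on tensor_ring.

HB.instance Definition _ := GRing.Zmodule_isPzRing.Build tensor_ring
  (@tmulA K A B) (@tmul1l K A B) (@tmul1r K A B) (@tmulDl K A B) (fun r s t => @tmulDr K A B r s t).

Lemma tens_expr (a : A) (b : B) n :
  (tens a b : tensor_ring) ^+ n = tens (a ^+ n) (b ^+ n).
Proof.
elim: n => [|n IHn]; first by rewrite !expr0.
by rewrite !exprS IHn -[LHS]/(tmul _ _) tmulE.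
Qed.

End TensorRing.

Section Binomial.
Variables (K : fieldType) (H : hopfAlgType K).

Lemma comul_expr (h : H) n : comul (h ^+ n) = (comul h : tensor_ring H H) ^+ n.
Proof.
elim: n => [|n IHn]; first by rewrite !expr0 comul1.
by rewrite !exprS comulM IHn.
Qed.

Lemma comul_binomial (y g : H) n : comul y = tens y 1 + tens g y -> g * y = y * g ->
  comul (y ^+ n) = \sum_(i < n.+1) tens (y ^+ (n - i) * g ^+ i) (y ^+ i) *+ 'C(n, i).
Proof.
move=> dy gy; rewrite comul_expr dy.
rewrite [LHS](@exprDn_comm (tensor_ring H H) (tens y 1) (tens g y)); last first.
  by rewrite /GRing.comm -[LHS]/(tmul _ _) -[RHS]/(tmul _ _) !tmulE gy mul1r mulr1.
apply: eq_bigr => i _; congr (_ *+ _).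
by rewrite !tens_expr expr1n -[LHS]/(tmul _ _) tmulE mul1r.
Qed.

End Binomial.

(** Cancel one factor p between p! C(pq, p) and the falling factorial of pq. What remains on the
    right is q times the factors pq - i with 0 < i < p, none of which is divisible by p. *)
Lemma prime_ndvd_bin (p q : nat) : prime p -> prime q -> q != p -> ~~ (p %| 'C(p * q, p))%N.
Proof.
move=> p_pr q_pr neq; have p0 := prime_gt0 p_pr; have q0 := prime_gt0 q_pr.
apply/negP => pC; have := bin_ffact (p * q) p.
have -> : (p`! = p * p.-1`!)%N by rewrite -[in LHS](prednK p0) factS prednK.
have -> : ((p * q) ^_ p = p * (q * ((p * q).-1 ^_ p.-1)))%N.
  by rewrite -{2}(prednK p0) ffactnS mulnA.
rewrite mulnCA => /eqP; rewrite eqn_pmul2l // => /eqP E.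
have : (p %| q * ((p * q).-1 ^_ p.-1))%N by rewrite -E dvdn_mulr.
rewrite Euclid_dvdM // dvdn_prime2 // eq_sym (negPf neq) /= ffact_prod.
rewrite Euclid_dvd_prod // big_orE => /existsP[i /=]; have ip : (i.+1 < p)%N by have := ltn_ord i; rewrite -ltnS prednK.
have -> : ((p * q).-1 - i = p * q - i.+1)%N by rewrite -subn1 -subnDA add1n.
rewrite dvdn_subr ?dvdn_mulr //; first by rewrite gtnNdvd.
by rewrite (leq_trans (ltnW ip)) // leq_pmulr.
Qed.

(** * Extension of scalars for subspaces *)

Section SubspaceBaseChange.
Variables (K E : fieldType) (sigma : {rmorphism K -> E}) (H : hopfAlgType K).
Local Notation HE := (bc_hopf sigma H).
Local Notation emb := (@emb K E sigma H : H -> HE).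
Implicit Types (U L : {vspace H}).

Definition bc_sub U : {vspace HE} := <<map emb (vbasis U)>>%VS.

Lemma bc_sub_emb U u : u \in U -> emb u \in bc_sub U.
Proof. by move=> uU; apply: emb_span; rewrite (span_basis (vbasisP _)). Qed.

Lemma bc_sub_ind U (P : HE -> Prop) : P 0 -> (forall v w, P v -> P w -> P (v + w)) ->
  (forall a u, u \in U -> P (a *: emb u)) -> forall v, v \in bc_sub U -> P v.
Proof.
move=> P0 PD Pe v vU; rewrite (coord_span (X := in_tuple (map emb (vbasis U))) vU).
elim/big_ind: _ => // i _.
have : (in_tuple (map emb (vbasis U)))`_i \in map emb (vbasis U) by rewrite mem_nth.
by case/mapP=> u uU ->; apply/Pe/vbasis_mem.
Qed.

Lemma rho_emb (f : 'Hom(HE, E^o)) (h : H) :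
  rho f (emb h) = \sum_(i < \dim {:H}) (f (emb (vbasis {:H})`_i) : E) *: emb (rho (coordf i) h).
Proof.
rewrite rhoE comul_emb [comul h]tens_sliceR.
rewrite (big_morph _ (@emb2D _ _ sigma _ _) (_ : emb2 sigma (0 : tensor H H) = 0)); last first.
  by rewrite -(scale0r (0 : tensor H H)) emb2Z rmorph0 scale0r.
rewrite linear_sum; apply: eq_bigr => i _ /=.
by rewrite emb2_tens sliceR_tens -rhoE.
Qed.

Lemma bc_sub_lam U : lam_stable U -> lam_stable (bc_sub U).
Proof.
move=> Ul f; apply: bc_sub_ind => [|v w vU wU|a u uU].
- by rewrite linear0 mem0v.
- by rewrite linearD memvD.
by rewrite lfunZ lam_emb memvZ // memv_suml // => i _; rewrite memvZ // bc_sub_emb ?Ul.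
Qed.

Lemma bc_sub_rho U : rho_stable U -> rho_stable (bc_sub U).
Proof.
move=> Ul f; apply: bc_sub_ind => [|v w vU wU|a u uU].
- by rewrite linear0 mem0v.
- by rewrite linearD memvD.
by rewrite lfunZ rho_emb memvZ // memv_suml // => i _; rewrite memvZ // bc_sub_emb ?Ul.
Qed.

Lemma bc_sub_stab L U : stabilizes L U -> stabilizes (bc_sub L) (bc_sub U).
Proof.
move=> LU a u aL uU; elim/bc_sub_ind: a / aL => [|v w IHv IHw|a b bL].
- by rewrite mul0r mem0v.
- by rewrite mulrDl memvD.
elim/bc_sub_ind: u / uU => [|v w IHv IHw|c d dU].
- by rewrite mulr0 mem0v.
- by rewrite mulrDr memvD.
by rewrite -scalerAl -scalerAr -embM !memvZ // bc_sub_emb ?LU.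
Qed.

Lemma bc_sub_tensv L U t : t \in tensv L U -> emb2 sigma t \in tensv (bc_sub L) (bc_sub U).
Proof.
move=> tL; elim/tensv_ind: t / tL => [a b aL bU|t r IHt IHr]; last by rewrite emb2D memvD.
by rewrite emb2_tens tens_mem ?bc_sub_emb.
Qed.

Lemma dim_bc_sub U : \dim (bc_sub U) = \dim U.
Proof.
pose X := vbasis U; have fX : free X := basis_free (vbasisP U).
suff fE : free [tuple of map emb X] by exact: etrans (eqP fE) (etrans (size_map _ _) (size_tuple _)).
apply/freeP => c c0 i.
pose psi : 'Hom(HE, E^o) := bc_ext sigma (fun h => sigma (coord X i h) : E^o).
have psiE h : (psi (emb h) : E) = sigma (coord X i h).
  rewrite /psi bc_ext_emb // => *; first by rewrite linearD rmorphD.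
  by rewrite linearZ rmorphM.
have XE (j : 'I_(\dim U)) : [tuple of map emb X]`_j = emb X`_j.
  by apply: nth_map; rewrite size_tuple ltn_ord.
have := congr1 psi c0; rewrite linear0 linear_sum (bigD1 i) //= big1 => [|j ji].
  by rewrite addr0 XE functZ psiE coord_free // eqxx rmorph1 mulr1.
by rewrite XE functZ psiE coord_free // (negPf ji) rmorph0 mulr0.
Qed.

Lemma bc_sub_coideal (s : seq H) L : (forall g, g \in s -> grouplike g) ->
  coideal_subalg s L -> coideal_subalg (map emb s) (bc_sub L).
Proof.
move=> sG [Ll LL L1 Lg LV].
split; first exact: bc_sub_lam.
- exact: bc_sub_stab.
- by rewrite -(emb1 sigma) bc_sub_emb.
- by move=> _ /mapP[g gs ->]; rewrite bc_sub_emb ?Lg.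
- by move=> _ /mapP[g gs ->]; rewrite -embV ?sG // bc_sub_emb ?LV.
Qed.

End SubspaceBaseChange.

(** * A primitive element generating a subalgebra of dimension p *)

Section Connected.
Variables (p q : nat) (K : fieldType) (H : hopfAlgType K).
Hypotheses (p_pr : prime p) (q_pr : prime q) (neq_qp : q != p) (pK : p \in [pchar K]).
Hypothesis dimH : \dim {:H} = (p * q)%N.
Let s : seq H := [:: 1].
Hypothesis sG : forall g, (g \in s) = grouplike g.
Hypothesis spl : left_pointed s.
Hypothesis spr : right_pointed s.

Let sC := grouplikes_closed sG.

Let spanP a : a \in <<s>>%VS -> exists c : K, a = c *: 1.
Proof. by rewrite span_seq1 => /vlineP. Qed.

Let grouplike_eq1 (g : H) : grouplike g -> g = 1.
Proof. by rewrite -sG inE => /eqP. Qed.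

(** Adjoining a primitive x to the scalars gives dimension m with p dividing m and m dividing pq, so
    m is p or pq. The value pq is excluded because C(pq, p) is nonzero in k. The last clause is an
    induction principle: [P] is spanned by powers of x. *)
Lemma primitive_subalgebra : exists x (P : {vspace H}),
  [/\ comul x = tens x 1 + tens 1 x, coideal_subalg s P, rho_stable P,
      \dim P = p & (x \in P) /\ (forall Q : H -> Prop, (forall a b, Q a -> Q b -> Q (a + b)) ->
        (forall c i, Q (c *: x ^+ i)) -> forall a, a \in P -> Q a)].
Proof.
have nS : <<s>>%VS != fullv.
  apply/eqP => S; have := dim_vline (1 : H); rewrite oner_neq0 -span_seq1 S dimH => /eqP.
  by rewrite muln_eq1 => /andP[/eqP p1]; move: p_pr; rewrite p1.
have [x [g [xS gG dx]]] := exists_exact_skew_primitive sG spl spr (isT : uniq s) nS.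
rewrite (grouplike_eq1 gG) in dx; exists x.
have [||||||m [[m1 m0 mc md mx] xm]] := @adjunction _ _ s (cg_grouplike sC) spl _
  (span_coideal_subalg sC) (span_rho_stable sC) x 1 0 1 xS (grouplike1 H).
- exact: csub_one (span_coideal_subalg sC).
- by rewrite invr1; exact: csub_one (span_coideal_subalg sC).
- exact: mem0v.
- by rewrite addr0.
- move=> a aS; exists a, 0; rewrite mem0v addr0; split=> //.
  by have [c ->] := spanP aS; rewrite -scalerAl -scalerAr mulr1 mul1r.
- by rewrite mulr1 scale1r mul1r subrr mem0v.
have pm := sum_one_pchar pK m0.
have d1 : \dim <<s>>%VS = 1%N by rewrite span_seq1 dim_vline oner_neq0.
have := coideal_subalg_dim (cg_grouplike sC) spl mc; rewrite md d1 muln1 dimH => mpq.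
have dxn n : comul (x ^+ n) = \sum_(i < n.+1) tens (x ^+ (n - i)) (x ^+ i) *+ 'C(n, i).
  rewrite (comul_binomial n dx); last by rewrite mul1r mulr1.
  by apply: eq_bigr => i _; rewrite expr1n mulr1.
have pind n (Q : H -> Prop) : (forall a b, Q a -> Q b -> Q (a + b)) ->
    (forall c i, (i < n)%N -> Q (c *: x ^+ i)) -> Q 0 -> forall a, a \in powers <<s>> x n -> Q a.
  move=> QD Qx Q0 a; apply: powers_ind => // b i /spanP[c ->] lt.
  by rewrite -scalerAl mul1r; apply: Qx.
have xpow n i : (i < n)%N -> x ^+ i \in powers <<s>> x n.
  by move=> lt; apply: (@expy_powers _ _ s) => //; apply: span_coideal_subalg.
have pow_le i j : (i <= j)%N -> (powers <<s>> x i <= powers <<s>> x j)%VS by apply: powers_le.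
have mp : m = p.
  have [d dE] := dvdnP pm.
  have : (d %| q)%N by move: mpq; rewrite dE mulnC dvdn_pmul2l ?prime_gt0.
  case/primeP: q_pr => _ /[apply] /orP[/eqP d1'|/eqP dq]; first by rewrite dE d1' mul1n.
  have mE : m = (p * q)%N by rewrite dE dq mulnC.
  have ltpm : (p < m)%N by rewrite mE ltn_Pmulr ?prime_gt1 ?prime_gt0.
  (* [phi] is 1 at x^p and 0 at lower powers, so [lam phi] acts like a divided p-th derivative: x^n
     goes to C(n, p) x^(n-p) plus lower terms. Applied to the reduction of x^m to lower powers, it
     would reduce x^(m-p) as well, against the minimality of m. *)
  have [phi phi0 phip] := separating_functional (mx p ltpm).
  have lam0 n i : (n - i < p)%N -> (phi (x ^+ (n - i)) : K) = 0.
    by move=> lt; apply: phi0; apply: xpow.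
  have lamE' n : lam phi (x ^+ n) =
      \sum_(i < n.+1) ((phi (x ^+ (n - i)) : K) *: x ^+ i) *+ 'C(n, i).
    rewrite lamE dxn linear_sum; apply: eq_bigr => i _ /=.
    by rewrite linearMn /= sliceL_tens.
  have lamx n : (p <= n)%N ->
      lam phi (x ^+ n) - x ^+ (n - p) *+ 'C(n, p) \in powers <<s>> x (n - p).
    move=> le; have lt : (n - p < n.+1)%N by rewrite ltnS leq_subr.
    rewrite lamE' (bigD1 (Ordinal lt)) //= subKn // phip scale1r bin_sub //.
    rewrite addrAC subrr add0r memv_suml // => i.
    rewrite -val_eqE /= neq_ltn => /orP[lti|gti].
      by rewrite rpredMn // memvZ // xpow.
    rewrite lam0 ?scale0r ?mul0rn ?mem0v //.
    by have := prime_gt0 p_pr; lia.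
  have lam_lt n : (n < p)%N -> lam phi (x ^+ n) = 0.
    move=> lt; rewrite lamE' big1 // => i _.
    by rewrite lam0 ?scale0r ?mul0rn // (leq_ltn_trans (leq_subr _ _)).
  have lamm u : u \in powers <<s>> x m -> lam phi u \in powers <<s>> x (m - p).
    apply: (pind m (fun u => lam phi u \in _)) => [a b aP bP|c i lt|]; last by rewrite linear0 mem0v.
      by rewrite linearD memvD.
    rewrite lfunZ memvZ //; have [ltip|le] := ltnP i p; first by rewrite lam_lt ?mem0v.
    rewrite -[lam _ _](subrK (x ^+ (i - p) *+ 'C(i, p))) memvD //.
      by apply: subvP (lamx _ le); apply: pow_le; rewrite leq_sub2r // ltnW.
    by rewrite rpredMn // xpow // ltn_sub2r.
  have := memvB (lamm _ xm) (lamx _ (ltnW ltpm)); rewrite opprB addrCA subrr addr0.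
  rewrite -scaler_nat => /(memvZ ('C(m, p)%:R)^-1); rewrite scalerA mulVf ?scale1r.
    by move=> xmp; have := mx (m - p)%N; rewrite xmp ltn_subrL prime_gt0 // (ltn_trans _ ltpm) ?prime_gt0 // => /(_ isT).
  by rewrite -(dvdn_pcharf pK) mE prime_ndvd_bin.
rewrite mp in mc md; exists (powers <<s>> x p); split=> //.
- move=> f u; apply: (pind p (fun u => rho f u \in _)) => [a b aP bP|c i lt|]; last by rewrite linear0 mem0v.
    by rewrite linearD memvD.
  rewrite lfunZ memvZ // rhoE dxn linear_sum memv_suml // => j _ /=.
  rewrite linearMn /= sliceR_tens rpredMn // memvZ // xpow //.
  by rewrite (leq_ltn_trans (leq_subr _ _)).
- by rewrite md d1 muln1.
split; first by rewrite -[x]expr1 xpow // prime_gt1.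
move=> Q QD Qx a aP; apply: (pind p Q) aP => //.
by have := Qx 0 0%N; rewrite scale0r.
Qed.

End Connected.

Lemma cancel_commutator (V : zmodType) (a b c d a' d' : V) :
  a + b + (c + d) - (a' + c + (b + d')) - (a - a') - (d - d') = 0.
Proof.
rewrite !opprD !opprK [LHS](AC ((2*2)*(2*2)*2*2) ((1*9)*(2*7)*(3*6)*(4*11)*(5*10)*(8*12))).
by rewrite /= !subrr [- a' + _]addrC [- d' + _]addrC !subrr !addr0.
Qed.

Lemma add_subr2 (V : zmodType) (a b c : V) : a + b + (c - a - b) = c.
Proof. by rewrite -[c - a - b]addrA -opprD [LHS]addrC subrK. Qed.

Lemma sub_subACK (V : zmodType) (a b c : V) : a - c - (a - b - c) = b.
Proof. by rewrite [a - b - c]addrAC opprB [LHS]addrC subrK. Qed.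

Section NotConnected.
Variables (p q : nat) (K : fieldType) (H : hopfAlgType K).
Hypotheses (p_pr : prime p) (q_pr : prime q) (neq_qp : q != p) (pK : p \in [pchar K]).
Hypothesis dimH : \dim {:H} = (p * q)%N.
Let s : seq H := [:: 1].
Hypothesis sG : forall g, (g \in s) = grouplike g.
Hypothesis spl : left_pointed s.
Hypothesis spr : right_pointed s.

(** Let [T] be ad x, where L = k[x] has dimension p, and y skew-primitive modulo [L]. One
    application of [T] already makes y primitive, so the error terms of all iterates stay in L (x)
    L, and so does that of an eigenvector v of [T] modulo [L]. With g = z = 1, adjoining v produces
    a dimension divisible by p^2. *)
Lemma not_connected : False.
Proof.
have sC := grouplikes_closed sG.
have [x [L [dx Lc Lr dL [xL Lind]]]] :=
  primitive_subalgebra p_pr q_pr neq_qp pK dimH sG spl spr.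
have [Ll LL L1 _ _] := Lc.
have nL : L != fullv.
  apply/eqP => LE; move: dL; rewrite LE dimH => /eqP.
  by rewrite -{2}[p]muln1 eqn_pmul2l ?prime_gt0 // => /eqP q1; move: q_pr; rewrite q1.
have [y [g [c0 [yL gG c0L dy]]]] := exists_skew_primitive sG spl spr Lc Lr nL.
have g1 : g = 1 by move: gG; rewrite -sG inE => /eqP.
rewrite {}g1 {g gG} in dy.
have xcomm a : a \in L -> x * a = a * x.
  move=> aL; elim/Lind: a / aL => [a b aE bE|c i]; first by rewrite mulrDl mulrDr aE bE.
  by rewrite -scalerAl -scalerAr -exprS exprSr.
pose T : 'End(H) := (amull x - amulr x)%VF.
have TE h : T h = x * h - h * x by rewrite add_lfunE opp_lfunE !lfunE.
pose prim (h : H) := comul h - tens h 1 - tens 1 h.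
have primE h : tens h 1 + tens 1 h + prim h = comul h.
  exact: add_subr2.
(* Delta(x) lies in L (x) L, which is commutative, so the commutator with it kills the error term of
   h. *)
have primT h : prim h \in tensv L L -> prim (T h) = 0.
  move=> hL; have Tc (t : tensor H H) : t \in tensv L L ->
      tmul (comul x) t = tmul t (comul x).
    move=> tL; elim/tensv_ind: t / tL => [a b aL bL|t r IHt IHr]; last by rewrite tmulDl tmulDr IHt IHr.
    by rewrite dx tmulDl tmulDr !tmulE !mul1r !mulr1 (xcomm a) ?(xcomm b).
  pose A := tens h (1 : H) + tens (1 : H) h.
  have E1 : comul (T h) = tmul (comul x) A - tmul A (comul x).
    rewrite TE (linearB comul) /= !comulM -(primE h) -/A.
    rewrite (tmulDr (comul x) A) (tmulDl A) (Tc _ hL) opprD addrACA.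
    by rewrite subrr addr0.
  have E2 : tmul (comul x) A = tens (x * h) 1 + tens x h + (tens h x + tens 1 (x * h)).
    rewrite dx /A tmulDl !tmulDr !tmulE.
    by rewrite !mul1r !mulr1.
  have E3 : tmul A (comul x) = tens (h * x) 1 + tens h x + (tens x h + tens 1 (h * x)).
    rewrite dx /A tmulDl !tmulDr !tmulE.
    by rewrite !mul1r !mulr1.
  rewrite /prim E1 E2 E3 TE tensDl tensNl tensDr tensNr.
  exact: cancel_commutator.
have primTn n : prim (iter n T y) \in tensv L L.
  elim: n => [|n IHn]; last by rewrite iterS primT ?mem0v.
  by rewrite /prim /= dy -addrA -opprD addrC addKr.
have [E [sigma [theta [n [c [vL wL]]]]]] := exists_eigenvector_extension T yL.
pose HE := bc_hopf sigma H.
pose eb : H -> HE := @emb K E sigma H.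
pose LE : {vspace HE} := bc_sub sigma L.
pose v : HE := \sum_(i < n) c i *: eb (iter i T y).
have {}vL : v \notin LE by exact: vL.
pose X : HE := eb x.
have ebM a b : eb (a * b) = eb a * eb b by exact: embM.
have {}wL : X * v - v * X - theta *: v \in LE.
  suff <- : \sum_(i < n) c i *: eb (iter i.+1 T y) = X * v - v * X by exact: wL.
  rewrite /v mulr_sumr mulr_suml -sumrB; apply: eq_bigr => i _.
  rewrite iterS TE [eb _]embD embN -scalerAr -scalerAl -scalerBr; congr (_ *: (_ - _)); exact: ebM.
have LEc : coideal_subalg (map eb s) LE by apply: bc_sub_coideal (cg_grouplike sC) Lc.
have [LEl LELE LE1 _ _] := LEc.
have XL : X \in LE by apply: bc_sub_emb.
have [d dLE dv] : exists2 d, d \in tensv LE LE & comul v = tens v 1 + tens 1 v + d.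
  exists (\sum_(i < n) c i *: emb2 sigma (prim (iter i T y))).
    by rewrite memv_suml // => i _; rewrite memvZ // bc_sub_tensv.
  rewrite /v linear_sum tens_suml tens_sumr -!big_split; apply: eq_bigr => i _ /=.
  rewrite lfunZ comul_emb tensZl tensZr -!scalerDr; congr (_ *: _).
  have -> : (1 : HE) = eb 1 by [].
  by rewrite -!emb2_tens -!emb2D primE.
have vX a : a \in LE -> exists b e, [/\ b \in LE, e \in LE & v * a = b * v + e].
  move=> aLE; elim/bc_sub_ind: a / aLE => [|a1 a2 [b1 [d1 [b1L d1L E1]]] [b2 [d2 [b2L d2L E2]]]|k a aL].
  - by exists 0, 0; rewrite mem0v mulr0 mul0r addr0.
  - exists (b1 + b2), (d1 + d2); rewrite !memvD //; split=> //.
    by rewrite mulrDr E1 E2 mulrDl addrACA.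
  elim/Lind: a / aL => [a1 a2 [b1 [d1 [b1L d1L E1]]] [b2 [d2 [b2L d2L E2]]]|k' i].
    exists (b1 + b2), (d1 + d2); rewrite !memvD //; split=> //.
    by rewrite embD scalerDr mulrDr E1 E2 mulrDl addrACA.
  suff [b [e [bL eL E1]]] : exists b e, [/\ b \in LE, e \in LE & v * X ^+ i = b * v + e].
    exists ((k * sigma k') *: b), ((k * sigma k') *: e); rewrite !memvZ //; split=> //.
    rewrite embZ scalerA -scalerAr -scalerAl -scalerDr -E1; congr (_ *: (_ * _)).
    by elim: i {E1} => [|i IHi]; rewrite ?expr0 // !exprS -IHi -ebM.
  elim: i => [|i [b [e [bL eL IHi]]]].
    by exists 1, 0; rewrite expr0 mulr1 mul1r addr0 mem0v.
  pose w := X * v - v * X - theta *: v.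
  (* The eigenvalue relation, solved for v X: it shows how v moves past powers of X, at the price of
     shifting X by theta. *)
  have vXE : v * X = (X - theta%:A) * v - w.
    by rewrite /w mulrBl mulr_algl sub_subACK.
  exists (b * (X - theta%:A)), (e * X - b * w); split.
  - by rewrite LELE // memvB // memvZ.
  - by rewrite memvB ?LELE.
  by rewrite exprSr mulrA IHi mulrDl -mulrA vXE mulrBr mulrA addrAC addrA.
have [||m [[m1 m0 mc md _] _]] := @adjunction _ _ (map eb s)
  (cg_grouplike (closed_grouplikes_emb sigma sC)) (left_pointed_emb (sigma := sigma) spl) LE LEc
  (bc_sub_rho Lr) v 1 d 1 vL (grouplike1 HE) LE1 _ dLE dv vX.
- by rewrite invr1.
- by rewrite mulr1 scale1r mul1r subrr mem0v.
have pE := pchar_rmorph pK sigma; have pm := sum_one_pchar pE m0.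
have := coideal_subalg_dim (cg_grouplike (closed_grouplikes_emb sigma sC))
  (left_pointed_emb (sigma := sigma) spl) mc.
by rewrite md dim_base_change dimH dim_bc_sub dL; apply: not_p2_dvd.
Qed.

End NotConnected.

(** * Group-likes of order q *)

Section AntipodeSkewPrimitive.
Variables (K : fieldType) (H : hopfAlgType K).

Lemma conv_antipodel (h : H) : conv (antipode : 'End(H)) \1 h = (counit h : K) *: 1.
Proof.
rewrite convE -antipodel.
elim/tens_ind: (comul h) => [a b|s t IHs IHt]; last by rewrite !linearD /= IHs IHt.
rewrite convt_tens id_lfunE tlift_tens // => z e x y.
  by rewrite linearP mulrDl scalerAl.
by rewrite mulrDr scalerAr.
Qed.

Lemma convt_antipode_mulr (g : H) (t : tensor H H) :
  convt (antipode \o amulr g)%VF \1 t * g = convt antipode \1 (tmul t (tens g g)).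
Proof.
elim/tens_ind: t => [a b|s t IHs IHt]; last by rewrite tmulDl !linearD /= mulrDl IHs IHt.
by rewrite tmulE !convt_tens !id_lfunE comp_lfunE lfunE /= mulrA.
Qed.

Lemma conv_antipode_grouplike (g h : H) : grouplike g ->
  conv (antipode \o amulr g)%VF \1 h = (counit h : K) *: g^-1.
Proof.
move=> gG; have gU := grouplike_unit gG.
apply: (mulIr gU); rewrite -scalerAl mulVr // convE convt_antipode_mulr.
have <- : comul (h * g) = tmul (comul h) (tens g g) by rewrite comulM (grouplike_comul gG).
by rewrite -convE conv_antipodel counitM (grouplike_counit gG) mulr1.
Qed.

(** Antimultiplicativity of S for a group-like right factor. By [conv_id_antipode] it suffices to
    convolve h -> S(h g) with the identity, which gives a multiple of the counit. *)
Lemma antipode_mul_grouplike (g h : H) : grouplike g ->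
  antipode (h * g) = g^-1 * antipode h.
Proof.
move=> gG.
rewrite -(@conv_id_antipode _ _ (antipode \o amulr g)%VF g^-1) ?comp_lfunE ?lfunE //.
by move=> h'; apply: conv_antipode_grouplike.
Qed.

Lemma counit_skew (v g : H) : grouplike g -> comul v = tens v 1 + tens g v ->
  (counit v : K) = 0.
Proof.
move=> gG dv; have := lam_counit v; rewrite lamE dv linearD /= !sliceL_tens.
rewrite (grouplike_counit gG) scale1r -[RHS]add0r => /addIr/eqP.
by rewrite scaler_eq0 oner_eq0 orbF => /eqP.
Qed.

(** Apply S * id to h v, where the counit vanishes. The two terms of Delta(v) give the convolution
    of h -> S(h v) with id, and the known convolution of h -> S(h g) times v; their sum is 0, and
    [conv_id_antipode] concludes. *)
Lemma antipode_mul_skew (v g h : H) : grouplike g -> comul v = tens v 1 + tens g v ->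
  antipode (h * v) = - (g^-1 * v) * antipode h.
Proof.
move=> gG dv.
rewrite -(@conv_id_antipode _ _ (antipode \o amulr v)%VF (- (g^-1 * v))) ?comp_lfunE ?lfunE //.
move=> h'; have := conv_antipodel (h' * v).
rewrite counitM (counit_skew gG dv) mulr0 scale0r convE comulM dv tmulDr linearD /=.
have -> : convt antipode \1 (tmul (comul h') (tens v 1)) = conv (antipode \o amulr v)%VF \1 h'.
  rewrite convE; elim/tens_ind: (comul h') => [a b|s t IHs IHt].
    by rewrite tmulE !convt_tens !id_lfunE comp_lfunE lfunE /= mulr1.
  by rewrite tmulDl !linearD /= IHs IHt.
have -> : convt antipode \1 (tmul (comul h') (tens g v)) = conv (antipode \o amulr g)%VF \1 h' * v.
  rewrite convE; elim/tens_ind: (comul h') => [a b|s t IHs IHt].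
    by rewrite tmulE !convt_tens !id_lfunE comp_lfunE lfunE /= mulrA.
  by rewrite tmulDl !linearD /= IHs IHt mulrDl.
rewrite (conv_antipode_grouplike _ gG) -scalerAl => /eqP; rewrite addr_eq0 => /eqP ->.
by rewrite scalerN.
Qed.

End AntipodeSkewPrimitive.

(** In k[X] the sum times -X is (1 - X)^p - 1 = -X^p. Cancelling X is legitimate there but not for
    [N], which may be a zero divisor; hence the evaluation at the end. *)
Lemma sum_geometric_pchar (K : fieldType) (A : falgType K) (p : nat) (N : A) :
  p \in [pchar K] -> \sum_(j < p) (1 - N) ^+ j = N ^+ p.-1.
Proof.
move=> pK; have p_pr := pcharf_prime pK.
have E : \sum_(j < p) (1 - 'X) ^+ j = 'X ^+ p.-1 :> {poly K}.
  have pX : p \in [pchar {poly K}] by rewrite pchar_poly.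
  apply: (mulfI (_ : - 'X != 0 :> {poly K})); first by rewrite oppr_eq0 polyX_eq0.
  have := subrX1 (1 - 'X : {poly K}) p.
  rewrite -(pFrobenius_autE pX) rmorphB rmorph1 /= pFrobenius_autE.
  have sub1 (P : {poly K}) : 1 - P - 1 = - P by rewrite addrAC subrr add0r.
  by rewrite !sub1 => <-; rewrite mulNr -exprS prednK ?prime_gt0.
have := congr1 (horner_alg N) E.
rewrite rmorph_sum rmorphXn /= horner_algX => <-.
by apply: eq_bigr => j _; rewrite rmorphXn rmorphB rmorph1 /= horner_algX.
Qed.

Section ExactEigenvector.
Variables (q : nat) (K : fieldType) (H : hopfAlgType K) (s : seq H).
Hypothesis qK : (q%:R : K) != 0.
Hypothesis sC : closed_grouplikes s.
Variables (x v : H) (theta : K) (i : nat).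
Hypothesis xs : x \in s.
Hypothesis xq : x ^+ q = 1.
Hypothesis tq : theta ^+ q = 1.
Hypothesis vS : v \notin <<s>>%VS.
Hypothesis dv : comul v = tens v 1 + tens (x ^+ i) v.
Hypothesis xv : x * v - theta *: (v * x) \in <<s>>%VS.

(* Average the conjugates of v, weighted by a character of the cyclic group. *)
Lemma exists_exact_eigenvector : exists w : H, [/\ w \notin <<s>>%VS,
  comul w = tens w 1 + tens (x ^+ i) w & x * w = theta *: (w * x)].
Proof.
have xG := cg_grouplike sC xs; have xU := grouplike_unit xG; have xVG := grouplikeV xG.
have q0 : (0 < q)%N by rewrite lt0n; apply: contra qK => /eqP ->.
have t0 : theta != 0.
  by apply/eqP => t0; move: tq; rewrite t0 expr0n eqn0Ngt q0 => /eqP; rewrite eq_sym oner_eq0.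
pose T h := x * h * x^-1.
have gcomm : x * x ^+ i * x^-1 = x ^+ i by rewrite -exprS exprSr mulrK.
have dT n : comul (iter n T v) = tens (iter n T v) 1 + tens (x ^+ i) (iter n T v).
  elim: n => [|n IHn] //; rewrite iterS /T !comulM IHn (grouplike_comul xG) (grouplike_comul xVG).
  by rewrite tmulDr tmulDl !tmulE mulr1 mulrV // gcomm.
have TX n h : iter n T h = x ^+ n * h * (x^-1) ^+ n.
  elim: n => [|n IHn]; first by rewrite !expr0 mul1r mulr1.
  by rewrite iterS IHn /T exprS exprSr !mulrA.
have Tq h : iter q T h = h by rewrite TX exprVn xq invr1 mul1r mulr1.
have LM := span_stabilizes sC.
have xL : x \in <<s>>%VS by rewrite memv_span.
have xVL : x^-1 \in <<s>>%VS by rewrite memv_span // (cg_inv sC).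
have TB a b : T (a - b) = T a - T b by rewrite /T mulrBr mulrBl.
have TZ a b : T (a *: b) = a *: T b by rewrite /T -scalerAr -scalerAl.
have TL a : a \in <<s>>%VS -> T a \in <<s>>%VS by move=> aL; rewrite /T !LM.
have Tv : T v - theta *: v \in <<s>>%VS.
  by have := LM _ _ xv xVL; rewrite mulrBl -scalerAl mulrK.
have TvX j : iter j T v - theta ^+ j *: v \in <<s>>%VS.
  elim: j => [|j IHj]; first by rewrite expr0 scale1r subrr mem0v.
  rewrite iterS -(subrK (T (theta ^+ j *: v)) (T _)) -TB -addrA memvD ?TL //.
  by rewrite TZ exprSr -scalerA -scalerBr memvZ.
pose w := q%:R^-1 *: \sum_(j < q) theta^-1 ^+ j *: iter j T v.
(* Modulo the group algebra each T^j v is theta^j v, so the weighted average is v again; this keeps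
   w out of the span. *)
have wv : w - v \in <<s>>%VS.
  have -> : w - v = q%:R^-1 *: \sum_(j < q) theta^-1 ^+ j *: (iter j T v - theta ^+ j *: v).
    have vq : v = q%:R^-1 *: (q%:R *: v) by rewrite scalerA mulVf // scale1r.
    rewrite [X in _ - X]vq -scalerBr; congr (_ *: _).
    under [RHS]eq_bigr => j _ do rewrite scalerBr scalerA -exprMn mulVf // expr1n scale1r.
    by rewrite sumrB sumr_const card_ord scaler_nat.
  by rewrite memvZ // memv_suml // => j _; rewrite memvZ.
have Tw : T w = theta *: w.
  rewrite /w TZ [RHS]scalerA mulrC -scalerA; congr (_ *: _).
  have -> : T (\sum_(j < q) theta^-1 ^+ j *: iter j T v) =
      \sum_(j < q) theta^-1 ^+ j *: iter j.+1 T v.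
    rewrite /T mulr_sumr mulr_suml; apply: eq_bigr => j _.
    by rewrite -scalerAr -scalerAl.
  rewrite scaler_sumr.
  have -> : \sum_(j < q) theta^-1 ^+ j *: iter j.+1 T v =
      \sum_(j < q) theta *: (theta^-1 ^+ j.+1 *: iter j.+1 T v).
    by apply: eq_bigr => j _; rewrite scalerA exprS mulrA mulfV // mul1r.
  rewrite -!scaler_sumr; congr (_ *: _).
  rewrite -(prednK q0) big_ord_recr [RHS]big_ord_recl /= addrC; congr (_ + _).
  by rewrite -iterS prednK // Tq exprVn tq invr1 expr0.
exists w; split.
- by apply: contra vS => wS; rewrite -[v](subKr w) memvB.
- rewrite /w lfunZ linear_sum tensZl tensZr tens_suml tens_sumr -scalerDr -big_split /=.
  congr (_ *: _); apply: eq_bigr => j _.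
  by rewrite lfunZ dT tensZl tensZr scalerDr.
by rewrite -[x * w](mulrVK xU) -/(T w) Tw scalerAl.
Qed.

End ExactEigenvector.

(** By Bezout the inverse of z is a power of z^b. This recovers [x] or [theta] from one of their
    powers. *)
Lemma coprime_expr1 (R : nzRingType) (z : R) q b :
  z ^+ q = 1 -> (0 < q)%N -> coprime q b -> exists a, z * (z ^+ b) ^+ a = 1.
Proof.
move=> zq q0 cop; have [a _] := Bezoutl b q0.
rewrite (eqP cop) => /dvdnP[c E]; exists a.
by rewrite -exprM mulnC -exprS -add1n E mulnC exprM zq expr1n.
Qed.

Lemma sum1_natr (R : nzRingType) n : \sum_(l < n) (1 : R) = n%:R.
Proof. by rewrite sumr_const card_ord. Qed.

(** * The indicator for q group-likes, computed in a monomial basis *)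

Section OrderQ.
Variables (p q : nat) (K : fieldType) (H : hopfAlgType K) (s : seq H).
Hypotheses (p_pr : prime p) (q_pr : prime q) (pK : p \in [pchar K]).
Hypothesis dimH : \dim {:H} = (p * q)%N.
Hypothesis sC : closed_grouplikes s.
Hypothesis spl : left_pointed s.
Hypothesis dS : \dim <<s>>%VS = q.
Variables (x v : H) (theta : K) (i : nat).
Hypothesis xs : x \in s.
Hypothesis sx : forall g, g \in s -> exists j, g = x ^+ j.
Hypothesis xq : x ^+ q = 1.
Hypothesis xord : forall j, x ^+ j = 1 -> (q %| j)%N.
Hypothesis tq : theta ^+ q = 1.
Hypothesis vS : v \notin <<s>>%VS.
Hypothesis dv : comul v = tens v 1 + tens (x ^+ i) v.
Hypothesis xv : x * v = theta *: (v * x).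

Let p0 : (0 < p)%N := prime_gt0 p_pr.
Let q0 : (0 < q)%N := prime_gt0 q_pr.
Let g := x ^+ i.
Let xG : grouplike x := cg_grouplike sC xs.
Let gG : grouplike g := grouplikeX i xG.
Let xU := grouplike_unit xG.

Let theta0 : theta != 0.
Proof.
by apply/eqP => t0; move: tq; rewrite t0 expr0n eqn0Ngt q0 => /eqP; rewrite eq_sym oner_eq0.
Qed.

Let xmod n : x ^+ (n %% q) = x ^+ n.
Proof. by rewrite {2}(divn_eq n q) exprD mulnC exprM xq expr1n mul1r. Qed.

Let xVE : x^-1 = x ^+ q.-1.
Proof. by apply: (mulrI xU); rewrite mulrV // -exprS prednK. Qed.

Let x_span u : u \in <<s>>%VS -> forall Q : H -> Prop,
  (forall a b, Q a -> Q b -> Q (a + b)) -> (forall c l, Q (c *: x ^+ l)) -> Q u.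
Proof.
move=> uS Q QD Qx; rewrite (coord_span (X := in_tuple s) uS); elim/big_ind: _ => //.
  by have := Qx 0 0%N; rewrite scale0r.
move=> j _; have gs : (in_tuple s)`_j \in s by rewrite mem_nth.
by have [l ->] := sx gs.
Qed.

(** m q divides p q with m > 1, so m = p. A root z of 1 + z + ... + z^(p-1) is a p-th root of unity,
    hence 1 in characteristic p. *)
Lemma adjunction_full : theta ^+ i = 1 /\ powers <<s>>%VS v p = fullv.
Proof.
have xv' : x * v - theta *: (v * x) \in <<s>>%VS by rewrite xv subrr mem0v.
have [m [[m1 m0 mc md _] _]] := cyclic_adjunction sC spl xs sx theta0 vS dv xv'.
have := coideal_subalg_dim (cg_grouplike sC) spl mc.
rewrite md dS dimH dvdn_pmul2r // => mp.
have {}mp : m = p.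
  by case/primeP: p_pr => _ /(_ _ mp) /orP[/eqP m1'|/eqP //]; move: m1; rewrite m1'.
rewrite {}mp in m1 m0 mc md; split.
  set z := theta^-1 ^+ i in m0.
  have zp : z ^+ p = 1.
    by apply/eqP; rewrite -subr_eq0 subrX1 m0 mulr0.
  have := pchar_unity pK zp; rewrite /z exprVn => /(congr1 (fun t => t^-1)).
  by rewrite invrK invr1.
by apply/eqP; rewrite eqEdim subvf md dS dimH leqnn.
Qed.

Let ti : theta ^+ i = 1 := proj1 adjunction_full.

Let xX_v c l : x ^+ c * v ^+ l = theta ^+ (c * l) *: (v ^+ l * x ^+ c).
Proof.
have E1 c' : x ^+ c' * v = theta ^+ c' *: (v * x ^+ c').
  elim: c' => [|c' IH]; first by rewrite !expr0 mul1r mulr1 scale1r.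
  rewrite {1}exprS -mulrA IH -scalerAr [x * (v * _)]mulrA xv -scalerAl scalerA -exprSr.
  by rewrite -mulrA -exprS.
elim: l => [|l IH]; first by rewrite muln0 !expr0 mul1r mulr1 scale1r.
rewrite exprSr [LHS]mulrA IH -scalerAl -[v ^+ l * x ^+ c * v]mulrA E1 -scalerAr scalerA -exprD.
by rewrite mulnS addnC mulrA.
Qed.

Let g_v : g * v = v * g.
Proof. by have := xX_v i 1; rewrite !expr1 muln1 ti scale1r. Qed.

Let gX l : g ^+ l = x ^+ (i * l). Proof. by rewrite exprM. Qed.

(** The image of this element under the antipode is [kapV n b], with g^(-l) in place of g^l; the
    latter is the kappa_b of the trace formula. *)
Let kap n b : H := \sum_(l < n) (theta ^+ b) ^+ l *: g ^+ l.

Let kap_v n b l : GRing.comm (kap n b) (v ^+ l).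
Proof.
apply: commrX; rewrite /GRing.comm /kap mulr_suml mulr_sumr; apply: eq_bigr => j _.
by rewrite -scalerAl -scalerAr; congr (_ *: _); apply/commr_sym/commrX; rewrite /GRing.comm g_v.
Qed.

Let kap_vX n b k l : kap n b ^+ k * v ^+ l = v ^+ l * kap n b ^+ k.
Proof. exact/commr_sym/commrX/commr_sym/kap_v. Qed.

Let kap_x n b c : GRing.comm (kap n b) (x ^+ c).
Proof.
rewrite /GRing.comm /kap mulr_suml mulr_sumr; apply: eq_bigr => j _.
by rewrite -scalerAl -scalerAr -!exprM -!exprD addnC.
Qed.

(** Induction through P_(n+1) = P_n * id and the binomial formula for Delta(v^j). In the l-th term,
    moving x^((i l + b) n) past v^l costs theta^(b n l), because theta^i = 1; the terms then
    reassemble into the j-th power of kap_n + theta^(b n) g^n = kap_(n+1). *)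
Lemma sweedler_basis n j b :
  sweedler H n (v ^+ j * x ^+ b) = v ^+ j * kap n b ^+ j * x ^+ (b * n).
Proof.
elim: n j b => [|n IHn] j b.
  rewrite sweedler0 counitM (grouplike_counit (grouplikeX b xG)) mulr1 muln0 expr0 mulr1.
  rewrite /kap big_ord0 expr0n; case: j => [|j]; first by rewrite expr0 counit1 mul1r scale1r.
  by rewrite exprS counitM (counit_skew gG dv) mul0r scale0r mulr0.
rewrite sweedlerS convE comulM (grouplike_comul (grouplikeX b xG)).
rewrite (comul_binomial j dv g_v) tmul_suml linear_sum.
have -> : kap n.+1 b = kap n b + (theta ^+ b) ^+ n *: g ^+ n by rewrite /kap big_ord_recr.
have cm : GRing.comm (kap n b) ((theta ^+ b) ^+ n *: g ^+ n).
  by rewrite /GRing.comm -scalerAr -scalerAl gX; congr (_ *: _); apply: kap_x.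
rewrite (exprDn_comm _ cm) mulr_sumr mulr_suml; apply: eq_bigr => l _ /=.
have lj : (l <= j)%N by rewrite -ltnS.
have -> : tmul (tens (v ^+ (j - l) * g ^+ l) (v ^+ l) *+ 'C(j, l)) (tens (x ^+ b) (x ^+ b)) =
    tens (v ^+ (j - l) * x ^+ (i * l + b)) (v ^+ l * x ^+ b) *+ 'C(j, l).
  by rewrite -scaler_nat tmulZl scaler_nat tmulE -mulrA gX -exprD.
rewrite linearMn /= convt_tens id_lfunE IHn mulrnAr mulrnAl; congr (_ *+ _).
have -> : kap n (i * l + b) = kap n b.
  by apply: eq_bigr => l' _; rewrite exprD exprM ti expr1n mul1r.
rewrite -[LHS]mulrA.
have -> : x ^+ ((i * l + b) * n) * (v ^+ l * x ^+ b) =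
    v ^+ l * (((theta ^+ b) ^+ n) ^+ l *: x ^+ (i * n * l)) * x ^+ (b * n.+1).
  rewrite [LHS]mulrA xX_v -[LHS]scalerAl -[v ^+ l * _ * _ in LHS]mulrA -exprD.
  rewrite -scalerAr -[RHS]scalerAl -[v ^+ l * _ * _ in RHS]mulrA -exprD.
  congr (_ *: (_ * x ^+ _)); last by lia.
  have -> : ((i * l + b) * n * l = i * (l * n * l) + b * n * l)%N by lia.
  by rewrite exprD [theta ^+ (i * _)]exprM ti expr1n mul1r !exprM.
rewrite exprZn gX -[(x ^+ (i * n)) ^+ l]exprM.
have -> : v ^+ j = v ^+ (j - l) * v ^+ l by rewrite -exprD subnK.
rewrite -!mulrA; congr (_ * _).
by rewrite [LHS]mulrA (kap_vX n b (j - l) l) -!mulrA.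
Qed.

Let kapV n b : H := \sum_(l < n) (theta ^+ b) ^+ l *: g^-1 ^+ l.

Let gX_V l : (g ^+ l)^-1 = g^-1 ^+ l. Proof. by rewrite exprVn. Qed.

Let S_kap h n b : antipode (h * kap n b) = kapV n b * antipode h.
Proof.
rewrite /kap mulr_sumr linear_sum mulr_suml; apply: eq_bigr => l _ /=.
rewrite -scalerAr lfunZ antipode_mul_grouplike; last exact: grouplikeX.
by rewrite gX_V scalerAl.
Qed.

Let S_basis j n b c : antipode (v ^+ j * kap n b ^+ j * x ^+ c) =
  x^-1 ^+ c * (kapV n b ^+ j * (- (g^-1 * v)) ^+ j).
Proof.
rewrite antipode_mul_grouplike; last exact: grouplikeX.
rewrite -exprVn; congr (_ * _).
have SX k h : antipode (h * kap n b ^+ k) = kapV n b ^+ k * antipode h.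
  elim: k h => [|k IHk] h; first by rewrite !expr0 mulr1 mul1r.
  by rewrite exprSr mulrA S_kap IHk mulrA -exprS.
rewrite SX; congr (_ * _); elim: j => [|j IHj].
  by rewrite !expr0 antipode_grouplike ?invr1 //; apply: grouplike1.
by rewrite exprSr (antipode_mul_skew _ gG dv) IHj -exprS.
Qed.

Let gV_v : GRing.comm g^-1 v.
Proof. by apply/commr_sym/commrV; rewrite /GRing.comm g_v. Qed.

Let kapV_v n b : GRing.comm (kapV n b) v.
Proof.
rewrite /GRing.comm /kapV mulr_suml mulr_sumr; apply: eq_bigr => l _.
by rewrite -scalerAl -scalerAr; congr (_ *: _); apply/commr_sym/commrX/commr_sym.
Qed.

Let kapV_g n b : GRing.comm (kapV n b) g^-1.
Proof.
rewrite /GRing.comm /kapV mulr_suml mulr_sumr; apply: eq_bigr => l _.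
by rewrite -scalerAl -scalerAr -exprS -exprSr.
Qed.

(** The antipode turns v into -g^(-1) v, and reordering x^b v^j contributes theta^b for each v. The
    resulting factor -theta^b g^(-1) kapV_m equals 1 - kapV_(m+1) by splitting off the term l =
    0. *)
Let twisted m b j : antipode (sweedler H m (x ^+ b * v ^+ j)) =
  x^-1 ^+ (b * m) * (1 - kapV m.+1 b) ^+ j * v ^+ j.
Proof.
rewrite xX_v lfunZ sweedler_basis lfunZ S_basis.
have -> : 1 - kapV m.+1 b = - (theta ^+ b *: (g^-1 * kapV m b)).
  rewrite /kapV big_ord_recl !expr0 scale1r opprD addrA subrr add0r mulr_sumr scaler_sumr.
  congr (- _); apply: eq_bigr => l _.
  by rewrite -scalerAr scalerA -exprS -exprS.
have -> : - (theta ^+ b *: (g^-1 * kapV m b)) = theta ^+ b *: (kapV m b * (- g^-1)).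
  by rewrite mulrN scalerN kapV_g.
have c1 : GRing.comm (kapV m b) (- g^-1) by apply: commrN.
have c2 : GRing.comm (- g^-1) v by apply/commr_sym/commrN/commr_sym.
rewrite exprZn (exprMn_comm _ c1) -mulNr (exprMn_comm _ c2).
by rewrite exprM -[RHS]mulrA -scalerAl -scalerAr -[_ * _ * v ^+ j]mulrA.
Qed.

Let I : finType := ('I_q * 'I_p)%type.
Let X (bj : I) : H := x ^+ bj.1 * v ^+ bj.2.

Let X_span w : w \in <<codom X>>%VS.
Proof.
have : w \in powers <<s>>%VS v p by rewrite (proj2 adjunction_full) memvf.
elim/powers_ind => [|a b aX bX|b j bS jp]; [exact: mem0v | exact: memvD |].
apply: (x_span bS (Q := fun b => b * v ^+ j \in _)) => [a c aX cX|c l].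
  by rewrite mulrDl memvD.
rewrite -scalerAl memvZ // -xmod; apply: memv_span.
apply/codomP; exists (Ordinal (ltn_pmod l q0), Ordinal jp).
by [].
Qed.

Let cardI : #|{: I}| = \dim {:H}.
Proof. by rewrite card_prod !card_ord dimH mulnC. Qed.

Let S1 : 1 \in <<s>>%VS.
Proof. by rewrite memv_span ?(cg_one sC). Qed.

Let SM : {in <<s>>%VS &, forall a b, a * b \in <<s>>%VS}.
Proof. by move=> a b; apply: span_stabilizes. Qed.

Let SX u k : u \in <<s>>%VS -> u ^+ k \in <<s>>%VS.
Proof. by move=> uS; elim: k => [|k IHk]; rewrite ?expr0 // exprS SM. Qed.

Let kapVS n b : kapV n b \in <<s>>%VS.
Proof.
rewrite memv_suml // => l _; rewrite memvZ // SX // memv_span //.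
apply: (cg_inv sC).
rewrite /g; elim: (i) => [|k IHk]; first by rewrite expr0 (cg_one sC).
by rewrite exprS (cg_mul sC).
Qed.

Let xVe k : x^-1 ^+ k = x ^+ (q.-1 * k).
Proof. by rewrite xVE exprM. Qed.

(** By [twisted] the operator preserves the exponent of v, so the diagonal entry at x^b v^j is the
    coefficient of x^b in an element of the group algebra. Summing over j < p gives a power of
    [kapV] by [sum_geometric_pchar]. [tau b] extends the coefficient of x^b to [H], as the dual
    functional of x^b v^0. *)
Lemma trace_formula : exists tau : 'I_q -> 'Hom(H, K^o),
  (forall b l, (tau b (x ^+ l) : K) = ((b : nat) == (l %% q)%N)%:R) /\
  forall m, indicator H m.+1 =
    \sum_(b < q) (tau b (x^-1 ^+ (b * m) * kapV m.+1 b ^+ p.-1) : K).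
Proof.
have [phi [phid phiX]] := dual_family X_span cardI.
pose j0 : 'I_p := Ordinal p0.
have phix b j l : (phi (b, j) (x ^+ l * v ^+ j) : K) = ((b : nat) == (l %% q)%N)%:R.
  have -> : x ^+ l * v ^+ j = X (Ordinal (ltn_pmod l q0), j) by rewrite /X /= xmod.
  by rewrite phiX xpair_eqE eqxx andbT.
exists (fun b => phi (b, j0)); split=> [b l|m].
  by rewrite -(phix b j0) /= expr0 mulr1.
have xVS : x^-1 \in <<s>>%VS by rewrite memv_span // (cg_inv sC).
rewrite /indicator (lftrace_dual _ phid) /=.
transitivity (\sum_(b < q) \sum_(j < p)
    (phi (b, j) (antipode (sweedler H m (X (b, j)))) : K)).
  by rewrite pair_big /=; apply: eq_bigr => -[b j] _; rewrite comp_lfunE.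
apply: eq_bigr => b _.
rewrite -(sum_geometric_pchar (kapV m.+1 b) pK) mulr_sumr linear_sum; apply: eq_bigr => j _ /=.
rewrite /X /= twisted.
have uS : x^-1 ^+ (b * m) * (1 - kapV m.+1 b) ^+ j \in <<s>>%VS.
  by rewrite SM ?SX // memvB.
apply: (x_span uS (Q := fun u => phi (b, j) (u * v ^+ j) = phi (b, j0) u)) => [u w IHu IHw|c l].
  by rewrite mulrDl !linearD /= IHu IHw.
rewrite -scalerAl !lfunZ; congr (_ *: _).
by rewrite phix -(phix b j0) /= expr0 mulr1.
Qed.

(** If p divides n both sides are 0, since p vanishes in k; otherwise this is Fermat's little
    theorem. *)
Let fermat n : n%:R ^+ p.-1 = (chi p n)%:R :> K.
Proof.
rewrite /chi; case: ifP => [pn|npn].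
  have -> : n%:R = 0 :> K by apply/eqP; rewrite -(dvdn_pcharf pK).
  by rewrite (pcharf0 pK) expr0n -subn1 subn_eq0 leqNgt prime_gt1.
have n0 : n%:R != 0 :> K by rewrite -(dvdn_pcharf pK) npn.
apply: (mulfI n0); rewrite mulr1 -exprS prednK //.
by rewrite -(pFrobenius_autE pK) pFrobenius_aut_nat.
Qed.

Let p1 : (0 < p.-1)%N.
Proof. by rewrite -subn1 subn_gt0 prime_gt1. Qed.

Let theta_b b : theta != 1 -> (b < q)%N -> (0 < b)%N -> theta ^+ b != 1.
Proof.
move=> t1 bq b0; apply: contraNneq t1 => tb.
have cop : coprime q b by rewrite prime_coprime // gtnNdvd.
by have [a] := coprime_expr1 tq q0 cop; rewrite tb expr1n mulr1 => ->.
Qed.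

(** A term x^l of u contributes for those b with b (m + 1) = l modulo q. As m + 1 is invertible
    there, exactly one b occurs, so each term counts once. *)
Let sum_tau (tau : 'I_q -> 'Hom(H, K^o)) m u :
  (forall b l, (tau b (x ^+ l) : K) = ((b : nat) == (l %% q)%N)%:R) ->
  ~~ (q %| m.+1)%N -> u \in <<s>>%VS ->
  \sum_(b < q) (tau b (x^-1 ^+ (b * m) * u) : K) = counit u.
Proof.
move=> tauE nq uS.
apply: (x_span uS (Q := fun u => \sum_(b < q) (tau b (x^-1 ^+ (b * m) * u) : K) = counit u)).
  move=> a c IHa IHc; rewrite linearD /= -IHa -IHc -big_split /=.
  by apply: eq_bigr => b _; rewrite mulrDr linearD.
move=> c l; rewrite lfunZ (grouplike_counit (grouplikeX l xG)) /=.
transitivity (c * \sum_(b < q) ((b : nat) == ((q.-1 * (b * m) + l) %% q)%N)%:R).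
  rewrite mulr_sumr; apply: eq_bigr => b _.
  by rewrite -scalerAr lfunZ xVe -exprD tauE.
congr (c * _); pose h (b : 'I_q) : 'I_q := Ordinal (ltn_pmod (b * m.+1) q0).
have h_inj : injective h.
  move=> b b' /(congr1 val) /= E; apply/val_inj => /=; move: E.
  wlog le : b b' / (b <= b')%N => [W|/esym/eqP].
    by case/orP: (leq_total b b') => [/W//|/W E /esym/E].
  rewrite eqn_mod_dvd ?leq_mul2r ?le ?orbT // -mulnBl Gauss_dvdl.
    move=> qd; apply/eqP; rewrite eqn_leq le /= -subn_eq0.
    apply: contraTT qd => nz; rewrite gtnNdvd ?lt0n //.
    exact: leq_ltn_trans (leq_subr _ _) (ltn_ord b').
  by rewrite prime_coprime.
rewrite -[RHS](_ : \sum_(b < q) ((b : nat) == (l %% q)%N)%:R = 1); last first.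
  rewrite (bigD1 (Ordinal (ltn_pmod l q0))) //= eqxx big1 ?addr0 // => b.
  by rewrite -val_eqE /= => /negPf ->.
rewrite [RHS](reindex_inj h_inj) /=; apply: eq_bigr => b _; congr (nat_of_bool _)%:R.
rewrite -[X in (X == _) = _](modn_small (ltn_ord b)) /= -(eqn_modDr (b * m)) -mulnS.
congr (_ == _); rewrite -addnA [(l + _)%N]addnC addnA -mulSnr prednK //.
by rewrite mulnC modnMDl.
Qed.

Let counit_kapV n : theta = 1 -> (counit (kapV n 0 ^+ p.-1) : K) = (chi p n)%:R.
Proof.
move=> t1; rewrite -fermat.
have cX (u : H) k : (counit (u ^+ k) : K) = (counit u : K) ^+ k.
  by elim: k => [|k IHk]; rewrite ?expr0 ?counit1 // !exprS counitM IHk.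
rewrite cX; congr (_ ^+ _); rewrite linear_sum -[RHS]sum1_natr; apply: eq_bigr => l _ /=.
by rewrite lfunZ cX (grouplike_counit (grouplikeV gG)) expr0 !expr1n; apply: mul1r.
Qed.

Let kapV_g1 n b : g = 1 -> kapV n b = (\sum_(l < n) (theta ^+ b) ^+ l)%:A.
Proof.
move=> g1; rewrite /kapV scaler_suml; apply: eq_bigr => l _.
by rewrite g1 invr1 expr1n.
Qed.

Let dvd_g1 : (q %| i)%N -> g = 1.
Proof. by case/dvdnP=> c E; rewrite /g E mulnC exprM xq expr1n. Qed.

Let ndvd_theta : ~~ (q %| i)%N -> theta = 1.
Proof.
move=> qi; have cop : coprime q i by rewrite prime_coprime.
by have [a] := coprime_expr1 tq q0 cop; rewrite ti expr1n mulr1.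
Qed.

Let tau1 (tau : 'I_q -> 'Hom(H, K^o)) m (b : 'I_q) :
  (forall b l, (tau b (x ^+ l) : K) = ((b : nat) == (l %% q)%N)%:R) ->
  (tau b (x^-1 ^+ (b * m)) : K) = (q %| b * m.+1)%N%:R.
Proof.
move=> tauE; rewrite xVe tauE; congr (nat_of_bool _)%:R.
rewrite -[X in (X == _) = _](modn_small (ltn_ord b)) -(eqn_modDr (b * m)) -mulnS.
by rewrite -mulSnr prednK // modnMr.
Qed.

(** Since theta^i = 1, theta = 1 or g = 1. If g = 1, [kapV] is a scalar. For theta other than 1 only
    b = 0 survives: if q divides n, the geometric sums at the other b vanish, otherwise their
    coefficients do. For theta = 1 and g = 1 one counts the b with q dividing b n. For theta = 1 and
    g other than 1, [kapV] does not depend on b and [sum_tau] reduces the sum to a counit. *)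
Lemma indicator_order_q n : (0 < n)%N ->
  indicator H n =
    (if (theta == 1) && (q %| i)%N then (chi p n * chi q n)%N else chi p n)%:R.
Proof.
case: n => // m _; have [tau [tauE ->]] := trace_formula; set n := m.+1.
have termE b : g = 1 -> tau b (x^-1 ^+ (b * m) * kapV n b ^+ p.-1) =
    (\sum_(l < n) (theta ^+ b) ^+ l) ^+ p.-1 * (q %| b * n)%N%:R :> K.
  move=> g1; rewrite (kapV_g1 _ _ g1) exprZn expr1n -scalerAr mulr1 lfunZ.
  by rewrite (tau1 m b tauE).
have [t1|t1] := eqVneq theta 1; last first.
  have g1 : g = 1 by apply: dvd_g1; apply: contraNT t1 => /ndvd_theta ->.
  rewrite (bigD1 (Ordinal q0)) //= termE //= expr0 mul0n dvdn0 mulr1 -fermat.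
  rewrite -[RHS]addr0; congr (_ ^+ _ + _).
    by rewrite -[RHS]sum1_natr; apply: eq_bigr => l _; rewrite expr1n.
  rewrite big1 // => b b0; rewrite termE //.
  have {}b0 : (0 < b)%N by rewrite lt0n; apply: contraNneq b0 => b0; apply/eqP/val_inj.
  case: (boolP (q %| n)%N) => [/dvdnP[c En]|nqn].
    have tb := theta_b t1 (ltn_ord b) b0.
    have : (theta ^+ b - 1) * (\sum_(l < n) (theta ^+ b) ^+ l) = 0.
      by rewrite -subrX1 -exprM mulnC En -mulnA mulnC -mulnA exprM tq expr1n subrr.
    by move/eqP; rewrite mulf_eq0 subr_eq0 (negPf tb) /= => /eqP ->; rewrite expr0n gtn_eqF // mul0r.
  by rewrite Euclid_dvdM // (negPf nqn) orbF gtnNdvd // mulr0.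
case: (boolP (q %| i)%N) => [qi|nqi] /=.
  transitivity (\sum_(b < q) (chi p n)%:R * ((q %| b * n)%N%:R : K)).
    apply: eq_bigr => b _; rewrite termE ?dvd_g1 // -fermat; congr (_ ^+ _ * _).
    by rewrite -[RHS]sum1_natr; apply: eq_bigr => l _; rewrite t1 !expr1n.
  rewrite -mulr_sumr natrM; congr (_ * _); rewrite /chi; case: ifP => [qn|nqn].
    by rewrite -[RHS]sum1_natr; apply: eq_bigr => b _; rewrite dvdn_mull.
  rewrite (bigD1 (Ordinal q0)) //= mul0n dvdn0 big1 ?addr0 // => b b0.
  rewrite Euclid_dvdM // nqn orbF gtnNdvd // lt0n.
  by apply: contra b0 => /eqP b0; apply/eqP/val_inj.
have kap0 b : kapV n b = kapV n 0.
  by apply: eq_bigr => l _; rewrite t1 !expr1n.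
rewrite -(counit_kapV n t1).
case: (boolP (q %| n)%N) => [qn|nqn]; last first.
  rewrite -(sum_tau tauE nqn (SX p.-1 (kapVS n 0))).
  by apply: eq_bigr => b _; rewrite kap0.
(* When q divides n, [kapV] is fixed by g, hence by the generator x, so the factors x^(-b m)
   disappear. This is the sum of [sum_tau] with m = 0, whose condition concerns 1 instead of n. *)
have nq1 : ~~ (q %| 1)%N by rewrite gtnNdvd ?prime_gt1.
rewrite -(sum_tau tauE nq1 (SX p.-1 (kapVS n 0))).
apply: eq_bigr => b _; rewrite kap0; congr (tau b _ : K).
rewrite muln0 expr0 mul1r.
have gk : g^-1 * kapV n 0 = kapV n 0.
  have : (g^-1 - 1) * kapV n 0 = 0.
    have -> : kapV n 0 = \sum_(l < n) g^-1 ^+ l.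
      by apply: eq_bigr => l _; rewrite expr0 expr1n scale1r.
    case/dvdnP: qn => c ->; rewrite -subrX1 exprVn /g -exprM.
    have -> : (i * (c * q) = q * (i * c))%N by lia.
    by rewrite exprM xq expr1n invr1 subrr.
  by rewrite mulrBl mul1r => /eqP; rewrite subr_eq0 => /eqP.
have cop : coprime q i by rewrite prime_coprime.
have [a xa] := coprime_expr1 xq q0 cop.
have xV : x^-1 = g ^+ a by rewrite -[RHS]mul1r -(mulVr xU) -mulrA xa mulr1.
have gk' : g * kapV n 0 = kapV n 0.
  by rewrite -{1}gk mulrA mulrV ?mul1r // grouplike_unit.
have gkX c : g ^+ c * kapV n 0 = kapV n 0.
  by elim: c => [|c IHc]; rewrite ?expr0 ?mul1r // exprSr -mulrA gk'.
by rewrite xV -exprM -(prednK p1) exprS mulrA gkX.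
Qed.

Let comm_theta : commutative_alg H -> theta = 1.
Proof.
move=> cH; apply/eqP; rewrite -subr_eq0.
have : (theta - 1) *: (v * x) = 0 by rewrite scalerBl scale1r -xv cH subrr.
move/eqP; rewrite scaler_eq0 => /orP[//|/eqP vx0]; case/negP: vS.
by rewrite -[v](mulrK xU) vx0 mul0r mem0v.
Qed.

(** Slicing Delta(v) and its flip with a functional that kills the group algebra but not v leaves 1
    = g. *)
Let cocomm_dvd : cocommutative H -> (q %| i)%N.
Proof.
move=> cH; apply: xord; have [f fS fv] := separating_functional vS.
have gs : g \in <<s>>%VS by apply: SX; apply: memv_span.
have := cH v; rewrite dv linearD /= !tswapE => /(congr1 (sliceL H f)).
by rewrite !linearD /= !sliceL_tens (fS _ S1) (fS _ gs) fv !scale0r add0r addr0 !scale1r.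
Qed.

Let trivial_comm : theta = 1 -> commutative_alg H.
Proof.
move=> t1; have comm1 u w : (forall bj, u * X bj = X bj * u) -> u * w = w * u.
  move=> uX; rewrite (coord_span (X := codom_tuple X) (X_span w)) mulr_suml mulr_sumr.
  apply: eq_bigr => j _; rewrite -scalerAl -scalerAr; congr (_ *: _).
  by rewrite nth_codom uX.
have x_v c l : GRing.comm (x ^+ c) (v ^+ l).
  by rewrite /GRing.comm xX_v t1 expr1n scale1r.
move=> u w; apply: (comm1) => bj; symmetry; apply: (comm1) => bj'.
have c1 : GRing.comm (x ^+ bj'.1) (X bj).
  by apply: commrM; [apply/commr_sym/commrX/commr_sym/commrX | apply: x_v].
have c2 : GRing.comm (v ^+ bj'.2) (X bj).
  by apply: commrM; [apply/commr_sym/x_v | apply/commr_sym/commrX/commr_sym/commrX].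
by apply/commr_sym; rewrite [X in GRing.comm X _]/X; apply/commr_sym/commrM; apply/commr_sym.
Qed.

(** With g = 1 the binomial expansion of Delta(v^j) is symmetric under exchanging l and j - l. *)
Let trivial_cocomm : g = 1 -> cocommutative H.
Proof.
move=> g1 h; rewrite (coord_span (X := codom_tuple X) (X_span h)) !linear_sum.
apply: eq_bigr => k _ /=; rewrite !lfunZ nth_codom; congr (_ *: _).
case: (enum_val _) => [b j]; rewrite /X /=.
rewrite comulM (grouplike_comul (grouplikeX b xG)) (comul_binomial j dv g_v).
rewrite tmul_sumr linear_sum [RHS](reindex_inj rev_ord_inj) /=.
apply: eq_bigr => l _; have lj : (l <= j)%N by rewrite -ltnS.
rewrite subSS subKn // bin_sub // -/g g1 !expr1n !mulr1 -!scaler_nat.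
by rewrite !tmulZr linearZ /= !tmulE tswapE.
Qed.

Lemma commutative_cocommutative_order_q :
  commutative_alg H /\ cocommutative H <-> (theta == 1) && (q %| i)%N.
Proof.
split=> [[cH ccH]|/andP[/eqP t1 qi]].
  by rewrite (comm_theta cH) eqxx cocomm_dvd.
by split; [apply: trivial_comm | apply/trivial_cocomm/dvd_g1].
Qed.

End OrderQ.

(** * Descent of cocommutativity *)

Section CocommutativeBaseChange.
Variables (K E : fieldType) (sigma : {rmorphism K -> E}) (H : hopfAlgType K).
Local Notation HE := (bc_hopf sigma H).
Local Notation embH := (@emb K E sigma H).

Lemma emb2_inj (U V : vectType K) : injective (@emb2 K E sigma U V).
Proof.
move=> t r tr; apply: sliceL_ext => f; apply: (@emb_inj _ _ sigma).
pose fE : 'Hom(base_change sigma U, E^o) := bc_ext sigma (fun u => sigma (f u : K) : E^o).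
have fEE u : fE (emb sigma u) = sigma (f u : K).
  by rewrite /fE bc_ext_emb // => *; rewrite ?linearD ?rmorphD // functZ rmorphM.
have slE (w : tensor U V) : emb sigma (sliceL V f w) = sliceL _ fE (emb2 sigma w).
  elim/tens_ind: w => [u v|w w' IHw IHw']; last by rewrite emb2D !linearD /= embD IHw IHw'.
  by rewrite emb2_tens !sliceL_tens fEE embZ.
by rewrite !slE tr.
Qed.

Lemma tswap_emb2 (U V : vectType K) (t : tensor U V) :
  tswap _ _ (emb2 sigma t) = emb2 sigma (tswap U V t).
Proof.
elim/tens_ind: t => [u v|t r IHt IHr]; last by rewrite emb2D [LHS]linearD [in RHS]linearD /= emb2D IHt IHr.
by rewrite emb2_tens !tswapE emb2_tens.
Qed.

Lemma cocommutative_emb : cocommutative HE <-> cocommutative H.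
Proof.
split=> cH h.
  by apply: emb2_inj; rewrite -tswap_emb2; have := cH (embH h); rewrite comul_emb.
elim/(@base_change_ind _ _ sigma H): h => [a h|u v IHu IHv]; last by rewrite !linearD /= IHu IHv.
by rewrite !lfunZ comul_emb tswap_emb2 cH.
Qed.

End CocommutativeBaseChange.

(** * The two surviving cases *)

Section OrderPQ.
Variables (p q : nat) (K : fieldType) (H : hopfAlgType K) (s : seq H).
Hypotheses (p_pr : prime p) (q_pr : prime q) (neq_qp : q != p) (pK : p \in [pchar K]).
Hypothesis dimH : \dim {:H} = (p * q)%N.
Hypothesis us : uniq s.
Hypothesis sG : forall g, (g \in s) = grouplike g.

(** The boolean records which alternative of the theorem holds. Here it is commutativity of the
    group, since a group algebra is always cocommutative. *)
Lemma indicator_group_algebra : size s = (p * q)%N -> exists b : bool,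
  (commutative_alg H /\ cocommutative H <-> b) /\
  forall n, (0 < n)%N ->
    indicator H n = (if b then (chi p n * chi q n)%N else chi p n)%:R.
Proof.
move=> sz; have [gT [e [e_inj cT eM eG _]]] := grouplike_group us sG.
rewrite sz in cT; have cD : #|gT| = \dim {:H} by rewrite cT dimH.
have [cH1 cH2] := group_commutative e_inj eM eG cD.
have ccH := group_cocommutative e_inj eG cD.
exists (abelian [set: gT]); split=> [|n n0].
  by split=> [[/cH1]|/cH2].
rewrite (group_indicator e_inj eM eG cD n0); case: ifP => [ab|/negbT nab].
  by rewrite (card_roots_abelian p_pr q_pr neq_qp cT).
rewrite -(GRing.natr_mod_pchar pK).
by rewrite (card_roots_nonabelian p_pr q_pr neq_qp cT _ nab) (GRing.natr_mod_pchar pK).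
Qed.

Hypothesis spl : left_pointed s.
Hypothesis spr : right_pointed s.

(** Everything is computed over [E]. Commutativity and cocommutativity hold over [E] exactly when
    they hold for [H], and the value of the indicator descends because [sigma] is injective and the
    answer is an integer. *)
Lemma indicator_order_q_grouplikes : size s = q -> exists b : bool,
  (commutative_alg H /\ cocommutative H <-> b) /\
  forall n, (0 < n)%N ->
    indicator H n = (if b then (chi p n * chi q n)%N else chi p n)%:R.
Proof.
move=> sq; have [x [xG xq xgen xord]] := prime_grouplikes_generator us sG q_pr sq.
have sC := grouplikes_closed sG.
have nS : <<s>>%VS != fullv.
  apply/eqP => S; have := dim_span_grouplikes us sG; rewrite S dimH sq => /eqP.
  rewrite -{2}[q]mul1n eqn_pmul2r ?prime_gt0 // => /eqP p1.
  by move: p_pr; rewrite p1.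
have [E [sigma [theta [i [v [vL dv xv tq]]]]]] :=
  exists_skew_eigenvector us sG spl spr xG xq xgen nS.
pose HE : hopfAlgType E := bc_hopf sigma H.
pose e : H -> HE := @emb K E sigma H.
have eX h j : e (h ^+ j) = e h ^+ j.
  elim: j => [|j IHj]; first by rewrite !expr0; apply: emb1.
  by rewrite !exprS -IHj; apply: embM.
have eC : closed_grouplikes (map e s) := closed_grouplikes_emb sigma sC.
have pE := pchar_rmorph pK sigma.
have exs : e x \in map e s by rewrite map_f // sG.
have exq : e x ^+ q = 1 by rewrite -eX xq; apply: emb1.
have qE : (q%:R : E) != 0.
  by rewrite -(dvdn_pcharf pE) dvdn_prime2 // eq_sym.
have [w [wL dw xw]] := exists_exact_eigenvector qE eC exs exq tq vL dv xv.
have exgen g : g \in map e s -> exists j, g = e x ^+ j.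
  by move=> /mapP[h hs ->]; have [j ->] := xgen h (etrans (esym (sG h)) hs); exists j.
have exord j : e x ^+ j = 1 -> (q %| j)%N.
  by rewrite -eX -[RHS](emb1 sigma) => /emb_inj/xord.
have dS : \dim <<map e s>>%VS = q by rewrite dim_span_emb_grouplikes.
have dE : \dim {:HE} = (p * q)%N by rewrite -dimH; apply: dim_base_change.
have epl : left_pointed (map e s) := left_pointed_emb (sigma := sigma) spl.
exists ((theta == 1) && (q %| i)%N); split=> [|n n0].
  rewrite -(commutative_cocommutative_order_q p_pr q_pr pE dE eC epl dS exs exgen exq exord tq wL dw xw).
  have [cE cH] := commutative_emb sigma H; have [ccE ccH] := cocommutative_emb sigma H.
  by split=> -[c cc]; split; [apply: cH | apply: ccH | apply: cE | apply: ccE].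
apply: (fmorph_inj sigma); rewrite -indicator_emb rmorph_nat.
exact: (indicator_order_q p_pr q_pr pE dE eC epl dS exs exgen exq tq wL dw xw n0).
Qed.

End OrderPQ.

Theorem theorem1p1 (p q : nat) (p_prime : prime p) (q_prime : prime q)
    (neq_qp : q != p) (k : fieldType) (char_k : p \in [pchar k])
    (H : hopfAlgType k) (H_pointed : pointed H)
    (dimH : \dim (fullv : {vspace H}) = (p * q)%N) :
  (commutative_alg H /\ cocommutative H ->
     forall n : nat, (0 < n)%N ->
       indicator H n = (chi p n * chi q n)%:R) /\
  (~ (commutative_alg H /\ cocommutative H) ->
     forall n : nat, (0 < n)%N -> indicator H n = (chi p n)%:R).
Proof.
suff [b [cb ib]] : exists b : bool, (commutative_alg H /\ cocommutative H <-> b) /\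
    forall n, (0 < n)%N ->
      indicator H n = (if b then (chi p n * chi q n)%N else chi p n)%:R.
  split=> [/cb bT n n0|ncb n n0]; first by rewrite ib // bT.
  by rewrite ib //; case: b cb {ib} => // cb; case: ncb; apply/cb.
have [s [us sG]] := exists_grouplike_seq H.
have spl := pointed_left_pointed H_pointed sG.
have spr := pointed_right_pointed H_pointed sG.
have := coideal_subalg_dim (cg_grouplike (grouplikes_closed sG)) spl (group_coideal_subalg sG).
rewrite (dim_span_grouplikes us sG) dimH => spq.
(* The number of group-likes divides p q. If p divides it, the cofactor is 1, which is excluded, or
   q, the group algebra; otherwise it is 1, which is excluded, or q. *)
case: (boolP (p %| size s)%N) => [/dvdnP[c sE]|nps].
  move: spq; rewrite sE mulnC dvdn_pmul2l ?prime_gt0 // => /(proj2 (primeP q_prime))/orP[]/eqP cE.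
    by case: (size_grouplikes_neq_p p_prime q_prime neq_qp char_k dimH us sG spl spr); rewrite sE cE mul1n.
  by apply: (@indicator_group_algebra p q k H s) => //; rewrite sE cE mulnC.
move: spq; rewrite Gauss_dvdr; last by rewrite coprime_sym prime_coprime.
move=> /(proj2 (primeP q_prime))/orP[]/eqP sE; last first.
  exact: (@indicator_order_q_grouplikes p q k H s).
have s1 : s = [:: 1].
  have : 1 \in s by rewrite sG grouplike1.
  by case: s sE {us sG spl spr nps} => [|g []] //= _; rewrite inE => /eqP ->.
by subst s; case: (not_connected p_prime q_prime neq_qp char_k dimH sG spl spr).
Qed.
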